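(* Let $(R,\mathfrak m,k)$ be a local ring and $x$ a Conca generator of $\mathfrak m$. Put $e=\operatorname{rank}_k(\mathfrak m/\mathfrak m^2)$, $r=\operatorname{rank}_k(\mathfrak m^2)$, and $\mathcal E=\operatorname{Ext}_R(k,k)$. Choose $x_1,\dots,x_e\in\mathfrak m\smallsetminus\mathfrak m^2$ such that $x_1x,\dots,x_rx$ form a $k$-basis of $\mathfrak m^2$, the images of $x_{r+1},\dots,x_e$ in $\mathfrak m/\mathfrak m^2$ form a $k$-basis of the kernel of the map $\mathfrak m/\mathfrak m^2\to\mathfrak m^2$ induced by multiplication by $x$, and $x_e=x$. Let $a^{ij}_h\in k$ be the uniquely determined elements with $$x_ix_j=\sum_{h=1}^r a^{ij}_h\,x_hx_e\quad\text{for}\quad 1\le i\le j\le e-1.$$ Let $\xi_1,\dots,\xi_e$ be the basis of $\mathcal E^1\cong\operatorname{Hom}_k(\mathfrak m/\mathfrak m^2,k)$ dual to the basis of $\mathfrak m/\mathfrak m^2$ given by $x_1,\dots,x_e$. The following hold. (1) There is an isomorphism of graded $k$-algebras $$\mathcal E\cong\frac{k\{\xi_1,\dots,\xi_e\}}{(\phi_1,\dots,\phi_r)},$$ where, for $h=1,\dots,r$, $$\phi_h=[\xi_h,\xi_e]+\sum_{1\le i<j\le e-1}a^{ij}_h[\xi_i,\xi_j]+\sum_{i=1}^{e-1}a^{ii}_h\xi_i^2 .$$ (2) The images of the words in $\{\xi_1,\dots,\xi_e\}$ that contain no subword from the set $\{\xi_e\xi_1,\dots,\xi_e\xi_r\}$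 form a basis of $\mathcal E$ over $k$. (3) Each bounded below (respectively, finitely presented) graded $\mathcal E$-module has a resolution of length $2$ by bounded below (respectively, finite) graded free $\mathcal E$-modules.
   Context: A local ring $(R,\mathfrak m,k)$ is a commutative Noetherian ring $R$ with unique maximal ideal $\mathfrak m$ and residue field $k=R/\mathfrak m$. Conca generator: an element $x$ is a Conca generator of an ideal $J$ if $x\in J$, $x\neq0=x^2$ and $xJ=J^2$. If $x$ is a Conca generator of $\mathfrak m$, then $\mathfrak m^3=0$ and $x\notin\mathfrak m^2$, and multiplication by $x$ induces a surjection $\mathfrak m/\mathfrak m^2\to\mathfrak m^2$ sending the class of $x$ to $0$, so elements $x_1,\dots,x_e$ as in the statement exist; they minimally generate $\mathfrak m$. $\mathcal E=\operatorname{Ext}_R(k,k)$ is a graded $k$-algebra, $\mathcal E=\bigoplus_{n\ge0}\operatorname{Ext}^n_R(k,k)$, with the composition product: it is the cohomology of the DG algebra $\operatorname{Hom}_R(G,G)$, where $G$ is a free resolution of $k$ over $R$. $k\{\xi_1,\dots,\xi_e\}$ denotes the non-commutative polynomial ring (free associative algebra) on indeterminates $\xi_1,\dots,\xi_e$ of degree 1 (the same letters are used for the indeterminates and for the corresponding basis elements of $\mathcal E^1$); $[\xi_i,\xi_j]=\xi_i\xi_j+\xi_j\xi_i$; $(\phi_1,\dots,\phi_r)$ is the two-sided ideal generated by $\phi_1,\dots,\phi_r$. A subword of a word is a string of consecutive letters. Graded modules are left modules. A graded module $\mathcal M$ is bounded below if $\mathcal M^n=0$ for all $n\ll0$; ''finite''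 means finitely generated. A resolution of length 2 of $\mathcal M$ is an exact sequence $0\to\mathcal F_2\to\mathcal F_1\to\mathcal F_0\to\mathcal M\to0$ (zero terms $\mathcal F_i$ are allowed). *)

(* Defs.v *)
From HB Require Import structures.
From mathcomp Require Import all_boot all_order all_algebra.
From mathcomp Require Import zify.
From mathcomp Require Import finmap boolp.
From mathcomp.multinomials Require Import monalg.

Set Implicit Arguments.
Unset Strict Implicit.
Unset Printing Implicit Defensive.

Import Order.TTheory GRing.Theory Num.Theory.
Local Open Scope ring_scope.

(* Ideals are Prop-valued predicates; no decidability is assumed. *)
Section Ideals.
Variable R : comNzRingType.
Implicit Types I J : R -> Prop.

Definition is_ideal I := I 0 /\ forall a y z, I y -> I z -> I (a * y + z).

Definition ideal_mul I J (z : R) := exists s : seq (R * R),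
  (forall t, t \in s -> I t.1 /\ J t.2) /\ z = \sum_(t <- s) t.1 * t.2.

Definition maximal_ideal I :=
  [/\ is_ideal I, ~ I 1 &
      forall J, is_ideal J -> ~ J 1 -> (forall z, I z -> J z) ->
        forall z, J z -> I z].

Definition noetherian := forall I, is_ideal I ->
  exists s : seq R, forall z,
    I z <-> exists c : 'I_(size s) -> R, z = \sum_i c i * s`_i.

Definition conca_generator (x : R) J :=
  [/\ J x, x != 0, x ^+ 2 = 0 &
      forall z, (exists2 y, J y & z = x * y) <-> ideal_mul J J z].
End Ideals.

(* The residue field is given as a field k with a surjection R ->> k whose
   kernel is the unique maximal ideal, rather than as a literal quotient. *)
Record localRing := LocalRing {
  lr_ring :> comNzRingType;
  residue : fieldType;
  res : {rmorphism lr_ring -> residue};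
  res_surj : forall a, exists c, res c = a;
  lr_noetherian : noetherian lr_ring;
  lr_local : forall I : lr_ring -> Prop,
    maximal_ideal I <-> (forall z, I z <-> res z = 0)
}.
Arguments res {_}.
Arguments res_surj {_}.

Section LocalRing.
Variable L : localRing.

Definition maxid (z : L) : Prop := res z = 0.
Definition maxid2 : L -> Prop := ideal_mul maxid maxid.

(* For ideals N \subset M with maxid * M \subset N, the images of the v i form
   a k-basis of M / N.  The scalars are written through their lifts to R. *)
Definition quot_kbasis (M N : L -> Prop) (I : finType) (v : I -> L) :=
  [/\ forall i, M (v i),
      forall y, M y -> exists c : I -> L, N (y - \sum_i c i * v i) &
      forall c : I -> L, N (\sum_i c i * v i) -> forall i, res (c i) = 0].

Definition quot_krank (M N : L -> Prop) (n : nat) :=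
  exists v : 'I_n -> L, quot_kbasis M N v.

Definition lift_res (a : residue L) : L := projT1 (cid (res_surj a)).

Lemma lift_resK : cancel lift_res res.
Proof. by move=> a; rewrite /lift_res; case: cid. Qed.
End LocalRing.

Section Bases.
Variables (A : pzRingType).

Definition is_basis (V : lmodType A) (I : choiceType) (b : I -> V) :=
  forall v, exists! c : {malg A[I]}, v = \sum_(i <- msupp c) c@_i *: b i.

Definition finitely_generated (V : lmodType A) :=
  exists s : seq V, forall v,
    exists c : 'I_(size s) -> A, v = \sum_i c i *: s`_i.
End Bases.

Section Gradings.

Inductive sum_of (I : Type) (V : zmodType) (P : I -> V -> Prop) : V -> Prop :=
| sum_of0 : sum_of P 0
| sum_ofD i u v : P i u -> sum_of P v -> sum_of P (u + v).

Definition is_grading (I : choiceType) (V : zmodType) (P : I -> V -> Prop) :=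
  [/\ forall i, P i 0 /\ (forall u v, P i u -> P i v -> P i (u - v)),
      forall v, sum_of P v &
      forall (s : seq I) (w : I -> V), uniq s -> (forall i, P i (w i)) ->
        \sum_(i <- s) w i = 0 -> forall i, i \in s -> w i = 0].

Variables (I : Type) (V : zmodType).
Implicit Types (P : I -> V -> Prop).

Lemma sum_of_incl P i u : P i u -> sum_of P u.
Proof. by move=> Pu; rewrite -[u]addr0; apply: sum_ofD Pu (sum_of0 _). Qed.

Lemma sum_of_add P u v : sum_of P u -> sum_of P v -> sum_of P (u + v).
Proof.
elim=> [|i w w' Pw _ IH] Pv; first by rewrite add0r.
by rewrite -addrA; apply: sum_ofD Pw (IH Pv).
Qed.

Lemma sum_of_opp P : (forall i u, P i u -> P i (- u)) ->
  forall u, sum_of P u -> sum_of P (- u).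
Proof.
move=> PN u; elim=> [|i w w' Pw _ IH]; first by rewrite oppr0; exact: sum_of0.
by rewrite opprD; exact: sum_ofD (PN _ _ Pw) IH.
Qed.
End Gradings.

Lemma sum_of_mul (I : Type) (A : pzRingType) (P Q S : I -> A -> Prop) :
  (forall i j u v, P i u -> Q j v -> sum_of S (u * v)) ->
  forall u v, sum_of P u -> sum_of Q v -> sum_of S (u * v).
Proof.
move=> PQ u v; elim=> [|i w w' Pw _ IH] Qv.
  by rewrite mul0r; exact: sum_of0.
rewrite mulrDl; apply: sum_of_add (IH Qv) => {IH}.
elim: Qv => [|j x y Qx _ IH]; first by rewrite mulr0; exact: sum_of0.
by rewrite mulrDr; apply: sum_of_add IH; apply: PQ Pw Qx.
Qed.

(* Quotient of a ring by a two-sided ideal (possibly the whole ring); the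
   quotient group is the library's {quot _}. *)
Record ideal2 (A : pzRingType) := Ideal2 {
  ideal2_mem :> A -> Prop;
  ideal2_0 : ideal2_mem 0;
  ideal2_B : forall u v, ideal2_mem u -> ideal2_mem v -> ideal2_mem (u - v);
  ideal2_Ml : forall a u, ideal2_mem u -> ideal2_mem (a * u);
  ideal2_Mr : forall a u, ideal2_mem u -> ideal2_mem (u * a)
}.

Section Quotient2.
Variables (A : pzRingType) (I : ideal2 A).

Definition ideal2_pred : A -> bool := fun a => `[< I a >].

Lemma ideal2_zmod_closed : zmod_closed ideal2_pred.
Proof.
split; first by apply/asboolP/ideal2_0.
by move=> u v /asboolP Iu /asboolP Iv; apply/asboolP/ideal2_B.
Qed.
HB.instance Definition _ :=
  GRing.isZmodClosed.Build A ideal2_pred ideal2_zmod_closed.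

Definition quot2 : Type :=
  Quotient.quot (GRing.ZmodClosed.clone A ideal2_pred _).
HB.instance Definition _ := GRing.Zmodule.on quot2.

Definition class2 (a : A) : quot2 := \pi_quot2%qT a.

Lemma class2_eq a b : class2 a = class2 b <-> I (a - b).
Proof.
split=> [/eqP|/asboolP Iab]; last first.
  by apply/eqP; rewrite /class2 -Quotient.idealrBE; exact: Iab.
by rewrite /class2 -Quotient.idealrBE => /asboolP.
Qed.

Lemma class2_surj (q : quot2) : exists a, class2 a = q.
Proof. by exists (repr q); rewrite /class2 reprK. Qed.

Lemma class2_is_zmod : zmod_morphism class2.
Proof. exact: raddfB. Qed.
HB.instance Definition _ :=
  GRing.isZmodMorphism.Build A quot2 class2 class2_is_zmod.

Definition quot2_mul (p q : quot2) : quot2 := class2 (repr p * repr q).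

Lemma class2M a b : class2 (a * b) = quot2_mul (class2 a) (class2 b).
Proof.
apply/class2_eq; set a' := repr _; set b' := repr _.
have Ia : I (a - a') by apply/class2_eq; rewrite /class2 reprK.
have Ib : I (b - b') by apply/class2_eq; rewrite /class2 reprK.
have -> : a * b - a' * b' = (a - a') * b - a' * (b' - b).
  by rewrite mulrBl mulrBr opprB addrA subrK.
apply: ideal2_B; first exact: ideal2_Mr.
apply: ideal2_Ml; rewrite -opprB -sub0r; apply: ideal2_B => //.
exact: ideal2_0.
Qed.

Fact quot2_mulA : associative quot2_mul.
Proof.
move=> p q s; have [a <-] := class2_surj p; have [b <-] := class2_surj q.
by have [c <-] := class2_surj s; rewrite -!class2M mulrA.
Qed.
Fact quot2_mul1l : left_id (class2 1) quot2_mul.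
Proof. by move=> p; have [a <-] := class2_surj p; rewrite -class2M mul1r. Qed.
Fact quot2_mul1r : right_id (class2 1) quot2_mul.
Proof. by move=> p; have [a <-] := class2_surj p; rewrite -class2M mulr1. Qed.
Fact quot2_mulDl : left_distributive quot2_mul +%R.
Proof.
move=> p q s; have [a <-] := class2_surj p; have [b <-] := class2_surj q.
by have [c <-] := class2_surj s; rewrite -!(class2M, raddfD) mulrDl.
Qed.
Fact quot2_mulDr : right_distributive quot2_mul +%R.
Proof.
move=> p q s; have [a <-] := class2_surj p; have [b <-] := class2_surj q.
by have [c <-] := class2_surj s; rewrite -!(class2M, raddfD) mulrDr.
Qed.
HB.instance Definition _ := GRing.Zmodule_isPzRing.Build quot2
  quot2_mulA quot2_mul1l quot2_mul1r quot2_mulDl quot2_mulDr.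

Lemma class2_is_monoid : monoid_morphism class2.
Proof. by split=> // a b; rewrite class2M. Qed.
HB.instance Definition _ :=
  GRing.isMonoidMorphism.Build A quot2 class2 class2_is_monoid.
End Quotient2.

(* The ring Q, as a K-module along the structure map eta.  The library's
   algebra structures presuppose 1 != 0 and are therefore not used. *)
Definition alg_along (K Q : pzRingType) (eta : {rmorphism K -> Q}) : Type := Q.

Section AlgAlong.
Variables (K Q : pzRingType) (eta : {rmorphism K -> Q}).
HB.instance Definition _ := GRing.PzRing.on (alg_along eta).

Definition along_scale (a : K) (v : alg_along eta) : alg_along eta :=
  (eta a : alg_along eta) * v.

Fact along_scaleA a b v : along_scale a (along_scale b v) = along_scale (a * b) v.
Proof. by rewrite /along_scale rmorphM mulrA. Qed.
Fact along_scale1 : left_id 1 along_scale.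
Proof. by move=> v; rewrite /along_scale rmorph1 mul1r. Qed.
Fact along_scaleDr : right_distributive along_scale +%R.
Proof. by move=> a u v; rewrite /along_scale mulrDr. Qed.
Fact along_scaleDl v : {morph along_scale^~ v : a b / a + b}.
Proof. by move=> a b; rewrite /along_scale rmorphD mulrDl. Qed.
HB.instance Definition _ := GRing.Zmodule_isLmodule.Build K (alg_along eta)
  along_scaleA along_scale1 along_scaleDr along_scaleDl.
End AlgAlong.

(* Words in the letters 0, ..., e-1 under concatenation; the free associative
   algebra is their monoid algebra. *)
Definition word (e : nat) := seq 'I_e.
HB.instance Definition _ e := Choice.on (word e).

Fact word_unit e (u v : word e) : u ++ v = [::] -> u = [::] /\ v = [::].
Proof. by case: u v => [|? ?] []. Qed.
HB.instance Definition _ e := Choice_isMonomialDef.Build (word e)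
  (@catA 'I_e) (@cat0s 'I_e) (@cats0 'I_e) (@word_unit e).

Notation freealg K e := {malg K[word e]}.

Definition letter (K : nzRingType) e (i : 'I_e) : freealg K e :=
  << ([:: i] : word e) >>.

Definition freealg_deg (K : nzRingType) e (d : nat) (p : freealg K e) :=
  forall w : word e, p@_w != 0 -> size w = d.

Section Presentation.
Variables (K : nzRingType) (e : nat) (I : finType) (phi : I -> freealg K e).

Definition generated2 (p : freealg K e) : Prop :=
  exists s : seq (freealg K e * I * freealg K e),
    p = \sum_(t <- s) t.1.1 * phi t.1.2 * t.2.

Fact generated2_0 : generated2 0.
Proof. by exists [::]; rewrite big_nil. Qed.
Fact generated2_Ml a u : generated2 u -> generated2 (a * u).
Proof.
move=> [s ->]; exists [seq (a * t.1.1, t.1.2, t.2) | t <- s].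
rewrite big_map mulr_sumr; apply: eq_bigr => t _; by rewrite !mulrA.
Qed.
Fact generated2_Mr a u : generated2 u -> generated2 (u * a).
Proof.
move=> [s ->]; exists [seq (t.1.1, t.1.2, t.2 * a) | t <- s].
rewrite big_map mulr_suml; apply: eq_bigr => t _; by rewrite !mulrA.
Qed.
Fact generated2_B u v : generated2 u -> generated2 v -> generated2 (u - v).
Proof.
move=> [s ->] /(generated2_Ml (-1)); rewrite mulN1r => -[s' ->].
by exists (s ++ s'); rewrite big_cat.
Qed.

Definition generated_ideal2 : ideal2 (freealg K e) :=
  Ideal2 generated2_0 generated2_B generated2_Ml generated2_Mr.

Definition presented_unit : {rmorphism K -> quot2 generated_ideal2} :=
  @class2 _ generated_ideal2 \o (fun a : K => a%:MP).

Definition presented : Type := alg_along presented_unit.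
HB.instance Definition _ := GRing.PzRing.on presented.
HB.instance Definition _ := GRing.Lmodule.on presented.

Definition presented_class (p : freealg K e) : presented :=
  @class2 _ generated_ideal2 p.

Definition presented_deg (d : nat) (v : presented) : Prop :=
  exists2 p, freealg_deg d p & v = presented_class p.
End Presentation.

Section Endomorphisms.
Variables (R : comNzRingType) (V : lmodType R).

Definition endo : Type := {linear V -> V}.
HB.instance Definition _ := gen_eqMixin endo.
HB.instance Definition _ := gen_choiceMixin endo.

Lemma endoP (f g : endo) : (f : V -> V) =1 g -> f = g.
Proof.
move=> /funext fg; case: f g fg => [f cf] [g cg] /= fg.
case: _ / fg in cg *; congr GRing.Linear.Pack.
case: cf cg => [[p] [q]] [[p'] [q']].
by congr GRing.Linear.Class; congr (_ _); apply: Prop_irrelevance.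
Qed.

Definition endo_id : endo := (idfun : {linear V -> V}).
Definition endo_zero : endo := (\0 : {linear V -> V}).
Definition endo_add (f g : endo) : endo := (f \+ g : {linear V -> V}).
Definition endo_opp (f : endo) : endo := (\- f : {linear V -> V}).
Definition endo_comp (f g : endo) : endo := (f \o g : {linear V -> V}).
Definition endo_scale (a : R) (f : endo) : endo := (a \*: f : {linear V -> V}).

Fact endo_addA : associative endo_add.
Proof. by move=> f g h; apply: endoP => v /=; rewrite addrA. Qed.
Fact endo_addC : commutative endo_add.
Proof. by move=> f g; apply: endoP => v /=; rewrite addrC. Qed.
Fact endo_add0 : left_id endo_zero endo_add.
Proof. by move=> f; apply: endoP => v /=; rewrite add0r. Qed.
Fact endo_addN : left_inverse endo_zero endo_opp endo_add.
Proof. by move=> f; apply: endoP => v /=; rewrite addNr. Qed.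
HB.instance Definition _ := GRing.isZmodule.Build endo
  endo_addA endo_addC endo_add0 endo_addN.

Fact endo_compA : associative endo_comp.
Proof. by move=> f g h; apply: endoP. Qed.
Fact endo_comp1f : left_id endo_id endo_comp.
Proof. by move=> f; apply: endoP. Qed.
Fact endo_compf1 : right_id endo_id endo_comp.
Proof. by move=> f; apply: endoP. Qed.
Fact endo_compDl : left_distributive endo_comp +%R.
Proof. by move=> f g h; apply: endoP. Qed.
Fact endo_compDr : right_distributive endo_comp +%R.
Proof. by move=> f g h; apply: endoP => v; exact: linearD. Qed.
HB.instance Definition _ := GRing.Zmodule_isPzRing.Build endo
  endo_compA endo_comp1f endo_compf1 endo_compDl endo_compDr.

Fact endo_scaleA a b f : endo_scale a (endo_scale b f) = endo_scale (a * b) f.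
Proof. by apply: endoP => v /=; rewrite scalerA. Qed.
Fact endo_scale1 : left_id 1 endo_scale.
Proof. by move=> f; apply: endoP => v /=; rewrite scale1r. Qed.
Fact endo_scaleDr : right_distributive endo_scale +%R.
Proof. by move=> a f g; apply: endoP => v /=; rewrite scalerDr. Qed.
Fact endo_scaleDl f : {morph endo_scale^~ f : a b / a + b}.
Proof. by move=> a b; apply: endoP => v /=; rewrite scalerDl. Qed.
HB.instance Definition _ := GRing.Zmodule_isLmodule.Build R endo
  endo_scaleA endo_scale1 endo_scaleDr endo_scaleDl.

Lemma endoD (f g : endo) v : (f + g : endo) v = f v + g v. Proof. by []. Qed.
Lemma endoN (f : endo) v : (- f : endo) v = - f v. Proof. by []. Qed.
Lemma endoM (f g : endo) v : (f * g : endo) v = f (g v). Proof. by []. Qed.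
Lemma endoZ a (f : endo) v : (a *: f : endo) v = a *: f v. Proof. by []. Qed.
Lemma endo_scaleAl a (f g : endo) : a *: (f * g) = (a *: f) * g.
Proof. by apply: endoP. Qed.
Lemma endo_scaleAr a (f g : endo) : a *: (f * g) = f * (a *: g).
Proof. by apply: endoP => v; symmetry; exact: (linearZZ (f : {linear V -> V})). Qed.
End Endomorphisms.

(* A complex G of free R-modules concentrated in nonnegative degrees is given by
   a set of generators with degrees: G is the free module on all of them, and
   G_i is the span of the generators of degree i. *)
Definition in_deg (R : comNzRingType) (B : choiceType) (dg : B -> nat)
    (i : nat) (t : {malg R[B]}) :=
  forall b, t@_b != 0 -> dg b = i.

(* k is an R-module along res, hence the scaling law res \; *%R of eps. *)
Record free_resolution (L : localRing) := FreeResolution {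
  gen : choiceType;
  gdeg : gen -> nat;
  bd : {linear {malg L[gen]} -> {malg L[gen]}};
  eps : {linear {malg L[gen]} -> residue L | res \; *%R};
  bd_deg : forall i t, in_deg gdeg i t -> forall b, (bd t)@_b != 0 ->
    (gdeg b).+1 = i;
  bd_bd : forall t, bd (bd t) = 0;
  eps_deg : forall i t, in_deg gdeg i.+1 t -> eps t = 0;
  bd_exact : forall i t, in_deg gdeg i.+1 t -> bd t = 0 ->
    exists2 u, in_deg gdeg i.+2 u & bd u = t;
  eps_exact : forall t, in_deg gdeg 0 t ->
    (eps t = 0 <-> exists2 u, in_deg gdeg 1 u & bd u = t);
  eps_surj : forall a, exists2 t, in_deg gdeg 0 t & eps t = a
}.
Arguments bd {_}.
Arguments eps {_}.

Section LinearExtension.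
Variables (R : comNzRingType) (B : choiceType).
Local Notation T := {malg R[B]}.
Implicit Types (phi : B -> T) (t : T).

Definition ext_fun phi t : T := \sum_(b <- msupp t) t@_b *: phi b.

Lemma ext_funE phi t (D : {fset B}) : (msupp t `<=` D)%fset ->
  ext_fun phi t = \sum_(b <- D) t@_b *: phi b.
Proof.
move=> tD; rewrite /ext_fun (big_fset_incl _ tD) //= => b _ /mcoeff_outdom ->.
by rewrite scale0r.
Qed.

Fact ext_fun_is_linear phi : linear (ext_fun phi).
Proof.
move=> a t u; set D := (msupp t `|` msupp u)%fset.
have tD : (msupp t `<=` D)%fset by exact: fsubsetUl.
have uD : (msupp u `<=` D)%fset by exact: fsubsetUr.
have sD : (msupp (a *: t + u) `<=` D)%fset.
  apply: fsubset_trans (msuppD_le _ _) _.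
  by apply: fsetUSS => //; exact: msuppZ_le.
rewrite (ext_funE _ tD) (ext_funE _ uD) (ext_funE _ sD) scaler_sumr -big_split.
by apply: eq_bigr => b _; rewrite /= mcoeffD mcoeffZ scalerDl scalerA.
Qed.
HB.instance Definition _ phi :=
  GRing.isLinear.Build R T T *:%R (ext_fun phi) (ext_fun_is_linear phi).

Definition ext_endo phi : endo T := (ext_fun phi : {linear T -> T}).

Lemma ext_endoU phi b : ext_endo phi << b >> = phi b.
Proof.
rewrite /= (ext_funE _ msuppU_le) big_seq_fset1 mcoeffUU.
by rewrite scale1r.
Qed.

Lemma malg_lin t : t = \sum_(b <- msupp t) t@_b *: << b >>.
Proof.
rewrite {1}[t]monalgE; apply: eq_bigr => b _.
apply/malgP => c; rewrite mcoeffZ !mcoeffU; case: eqP => _ //=.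
  by rewrite !mulr1n mulr1.
by rewrite !mulr0n mulr0.
Qed.

Lemma eq_endo_gen (f g : endo T) t :
  (forall b, b \in msupp t -> f << b >> = g << b >>) -> f t = g t.
Proof.
move=> fg; rewrite [t]malg_lin (linear_sum (f : {linear T -> T})).
rewrite (linear_sum (g : {linear T -> T})); apply: eq_big_seq => b bt.
by rewrite !(linearZZ (_ : {linear T -> T})) fg.
Qed.
End LinearExtension.

(* The part of the DG algebra Hom_R(G,G) in degree n: maps G_i -> G_(i-n). *)
Section ExtAlgebra.
Variables (L : localRing) (G : free_resolution L).
Local Notation T := {malg L[gen G]}.
Local Notation E := (endo T).
Local Notation dG := (bd G : E).
Local Notation indeg := (@in_deg L (gen G) (@gdeg L G)).

Definition hom_deg (n : int) (f : E) :=
  forall i t, indeg i t -> forall b, (f t)@_b != 0 ->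
    (gdeg b)%:Z = i%:Z - n.

Definition hom_diff (n : int) (f : E) : E :=
  dG * f - (-1) ^+ `|n|%N *: (f * dG).

Definition cocycle (n : nat) (f : E) := hom_deg n f /\ hom_diff n f = 0.

Definition coboundary (n : nat) (f : E) :=
  exists2 h, hom_deg (n%:Z - 1) h & f = hom_diff (n%:Z - 1) h.

Lemma hom_deg0 n : hom_deg n 0.
Proof. by move=> i t _ b; rewrite mcoeff0 eqxx. Qed.

Lemma hom_degB n f g : hom_deg n f -> hom_deg n g -> hom_deg n (f - g).
Proof.
move=> hf hg i t it b; rewrite endoD endoN mcoeffB => nz.
case: (eqVneq (f t)@_b 0) => [f0|]; last exact: hf it _.
case: (eqVneq (g t)@_b 0) => [g0|]; last exact: hg it _.
by move: nz; rewrite f0 g0 subrr eqxx.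
Qed.

Lemma hom_deg1 : hom_deg 0 1.
Proof. by move=> i t it b /it ->; rewrite subr0. Qed.

Lemma in_deg_hom n f i j t : hom_deg n f -> indeg i t -> j%:Z = i%:Z - n ->
  indeg j (f t).
Proof. by move=> hf it ji b /(hf i t it) bE; lia. Qed.

Lemma hom_deg_lt n f i t : hom_deg n f -> indeg i t -> i%:Z < n -> f t = 0.
Proof.
move=> hf it lt_in; apply/malgP => b; rewrite mcoeff0; apply/eqP.
by apply: contraPT (lt_in) => /(hf i t it) bE; lia.
Qed.

Lemma hom_degM m n f g : hom_deg m f -> hom_deg n g -> hom_deg (m + n) (f * g).
Proof.
move=> hf hg i t it b.
case: (ltP (i%:Z) n) => [lt_in|le_ni].
  by rewrite endoM (hom_deg_lt hg it lt_in) (linear0 (f : {linear T -> T}))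
             mcoeff0 eqxx.
have gt : indeg `|i%:Z - n|%N (g t) by apply: in_deg_hom hg it _; lia.
by rewrite endoM => /(hf _ _ gt) ->; lia.
Qed.

Lemma hom_degZ n a f : hom_deg n f -> hom_deg n (a *: f).
Proof.
move=> hf i t it b; rewrite endoZ mcoeffZ => nz; apply: (hf i t it).
by apply: contraNneq nz => ->; rewrite mulr0.
Qed.

Lemma bd_hom_deg : hom_deg 1 dG.
Proof. by move=> i t it b /(bd_deg it) <-; lia. Qed.

Lemma bdM : dG * dG = 0.
Proof. by apply: endoP => t; rewrite endoM bd_bd. Qed.

Fact sign_abszD (m n : int) :
  (-1) ^+ `|(m + n)%R|%N = (-1) ^+ `|m|%N * (-1) ^+ `|n|%N :> L.
Proof.
rewrite -exprD -[LHS]signr_odd -[RHS]signr_odd; congr (_ ^+ nat_of_bool _).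
lia.
Qed.

Lemma hom_diffB n f g : hom_diff n (f - g) = hom_diff n f - hom_diff n g.
Proof.
by rewrite /hom_diff mulrBr mulrBl scalerBr opprD addrACA -opprD.
Qed.

Lemma hom_diffZ n a f : hom_diff n (a *: f) = a *: hom_diff n f.
Proof.
rewrite /hom_diff scalerBr -endo_scaleAr -endo_scaleAl; congr (_ - _).
by rewrite !scalerA mulrC.
Qed.

Lemma hom_diffM m n f g : hom_diff (m + n) (f * g)
  = hom_diff m f * g + (-1) ^+ `|m|%N *: (f * hom_diff n g).
Proof.
rewrite /hom_diff mulrBl mulrBr scalerBr -endo_scaleAl -endo_scaleAr !scalerA.
by rewrite -sign_abszD !mulrA addrA subrK.
Qed.

Lemma hom_diff1 : hom_diff 0 1 = 0.
Proof. by rewrite /hom_diff expr0 scale1r mulr1 mul1r subrr. Qed.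

Lemma cocycle0 n : cocycle n 0.
Proof.
split; first exact: hom_deg0.
by rewrite /hom_diff mulr0 mul0r scaler0 subrr.
Qed.

Lemma cocycleB n f g : cocycle n f -> cocycle n g -> cocycle n (f - g).
Proof.
move=> [hf df] [hg dg]; split; first exact: hom_degB.
by rewrite hom_diffB df dg subrr.
Qed.

Lemma cocycleN n f : cocycle n f -> cocycle n (- f).
Proof. by rewrite -sub0r; apply: cocycleB; exact: cocycle0. Qed.

Lemma cocycle1 : cocycle 0 1.
Proof. by split; [exact: hom_deg1 | exact: hom_diff1]. Qed.

Lemma cocycleM m n f g : cocycle m f -> cocycle n g -> cocycle (m + n) (f * g).
Proof.
move=> [hf df] [hg dg]; split; first by rewrite PoszD; exact: hom_degM.
by rewrite PoszD hom_diffM df dg mul0r mulr0 scaler0 addr0.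
Qed.

Lemma cocycleZ n a f : cocycle n f -> cocycle n (a *: f).
Proof.
move=> [hf df]; split; first exact: hom_degZ.
by rewrite hom_diffZ df scaler0.
Qed.

Lemma coboundaryN n f : coboundary n f -> coboundary n (- f).
Proof.
move=> [h hh ->]; exists (- h); first by rewrite -[- h]sub0r; exact: hom_degB (hom_deg0 _) hh.
by rewrite -[in RHS](scaleN1r h) hom_diffZ scaleN1r.
Qed.

Lemma coboundaryMl m n f g : cocycle m f -> coboundary n g ->
  coboundary (m + n) (f * g).
Proof.
move=> [hf df] [h hh ->].
have e : (m + n)%N%:Z - 1 = m%:Z + (n%:Z - 1) by lia.
exists ((-1) ^+ `|m|%N *: (f * h)); rewrite e.
  by apply: hom_degZ; exact: hom_degM.
by rewrite hom_diffZ hom_diffM df mul0r add0r scalerA -expr2 sqrr_sign scale1r.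
Qed.

Lemma coboundaryMr m n f g : coboundary m f -> cocycle n g ->
  coboundary (m + n) (f * g).
Proof.
move=> [h hh ->] [hg dg].
have e : (m + n)%N%:Z - 1 = (m%:Z - 1) + n%:Z by lia.
exists (h * g); rewrite e; first exact: hom_degM.
by rewrite hom_diffM dg mulr0 scaler0 addr0.
Qed.

Definition cocycles_pred : E -> bool := fun f => `[< sum_of cocycle f >].

Fact cocycles_subring : subring_closed cocycles_pred.
Proof.
split.
- by apply/asboolP; apply: sum_of_incl cocycle1.
- move=> f g /asboolP zf /asboolP zg; apply/asboolP; apply: sum_of_add zf _.
  by apply: sum_of_opp zg; exact: cocycleN.
move=> f g /asboolP zf /asboolP zg; apply/asboolP.
apply: (sum_of_mul _ zf zg) => i j u v zu zv.
by apply: sum_of_incl (cocycleM zu zv).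
Qed.
HB.instance Definition _ :=
  GRing.isSubringClosed.Build E cocycles_pred cocycles_subring.

(* The ring of cocycles, the direct sum of its parts of degree n >= 0. *)
Record cocycles := Cocycles { cocycle_val :> E; _ : cocycles_pred cocycle_val }.
HB.instance Definition _ := [isSub for cocycle_val].
HB.instance Definition _ := [Choice of cocycles by <:].
HB.instance Definition _ :=
  GRing.SubChoice_isSubPzRing.Build E cocycles_pred cocycles cocycles_subring.

Definition coboundaries (z : cocycles) := sum_of coboundary (val z).

Lemma cocyclesP (z : cocycles) : sum_of cocycle (val z).
Proof. exact/asboolP/(valP z). Qed.

Fact coboundaries0 : coboundaries 0.
Proof. by rewrite /coboundaries raddf0; exact: sum_of0. Qed.
Fact coboundariesB u v : coboundaries u -> coboundaries v -> coboundaries (u - v).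
Proof.
move=> bu bv; rewrite /coboundaries raddfB; apply: sum_of_add bu _.
by apply: sum_of_opp bv; exact: coboundaryN.
Qed.
Fact coboundariesMl a u : coboundaries u -> coboundaries (a * u).
Proof.
move=> bu; rewrite /coboundaries rmorphM.
apply: (sum_of_mul _ (cocyclesP a) bu) => i j f g zf bg.
by apply: sum_of_incl (coboundaryMl zf bg).
Qed.
Fact coboundariesMr a u : coboundaries u -> coboundaries (u * a).
Proof.
move=> bu; rewrite /coboundaries rmorphM.
apply: (sum_of_mul _ bu (cocyclesP a)) => i j f g bf zg.
by apply: sum_of_incl (coboundaryMr bf zg).
Qed.

Definition coboundary_ideal : ideal2 cocycles :=
  Ideal2 coboundaries0 coboundariesB coboundariesMl coboundariesMr.

Lemma scalar_cocycle (c : L) : cocycles_pred (c *: (1 : E)).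
Proof. by apply/asboolP; apply: sum_of_incl (cocycleZ _ cocycle1). Qed.

Definition scalar_map (c : L) : cocycles := Cocycles (scalar_cocycle c).

Lemma scalar_map1 : scalar_map 1 = 1.
Proof. by apply: val_inj; rewrite rmorph1 /= scale1r. Qed.
Lemma scalar_mapB c c' : scalar_map (c - c') = scalar_map c - scalar_map c'.
Proof. by apply: val_inj; rewrite raddfB /= scalerBl. Qed.
Lemma scalar_mapM c c' : scalar_map (c * c') = scalar_map c * scalar_map c'.
Proof.
by apply: val_inj; rewrite rmorphM /= -endo_scaleAl mul1r scalerA.
Qed.
End ExtAlgebra.

(* An element of the maximal ideal acts on G by a null-homotopic map, so that
   the cohomology of Hom_R(G,G) is a k-algebra. *)
Section NullHomotopy.
Variables (L : localRing) (G : free_resolution L) (y : L).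
Hypothesis y0 : res y = 0.
Local Notation T := {malg L[gen G]}.
Local Notation E := (endo T).
Local Notation dG := (bd G : E).
Local Notation indeg := (@in_deg L (gen G) (@gdeg L G)).

Definition is_htpy (h : E) (b : gen G) (u : T) :=
  indeg (gdeg b).+1 u /\ dG u = y *: << b >> - h (dG << b >>).

Definition htpy_gen (h : E) (b : gen G) : T :=
  if pselect (exists u, is_htpy h b u) is left e then projT1 (cid e) else 0.

Definition htpy_step (h : E) : E := ext_endo (htpy_gen h).

Definition htpy_iter (n : nat) : E := iter n htpy_step 0.

Definition htpy : E := ext_endo (fun b => htpy_iter (gdeg b).+1 << b >>).

Lemma in_degU b : indeg (gdeg b) (<< b >> : T).
Proof. by move=> c; rewrite mcoeffU; case: (eqVneq b c) => [->|_] //; rewrite eqxx. Qed.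

Lemma in_deg_supp i t b : indeg i t -> b \in msupp t -> gdeg b = i.
Proof. by move=> it; rewrite -mcoeff_neq0 => /it. Qed.

Lemma in_degD i t u : indeg i t -> indeg i u -> indeg i (t + u).
Proof.
move=> it iu b; rewrite mcoeffD => nz.
case: (eqVneq t@_b 0) => [t0|/it //]; apply: iu.
by apply: contraNneq nz => u0; rewrite t0 u0 addr0.
Qed.

Lemma in_degZ i a t : indeg i t -> indeg i (a *: t).
Proof.
move=> it b; rewrite mcoeffZ => nz; apply: it.
by apply: contraNneq nz => ->; rewrite mulr0.
Qed.

Lemma in_degN i t : indeg i t -> indeg i (- t).
Proof. by rewrite -scaleN1r; exact: in_degZ. Qed.

Lemma in_degS_bd i t : indeg i.+1 t -> indeg i (dG t).
Proof. by move=> it b /(bd_deg it) []. Qed.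

Lemma in_deg0_bd t : indeg 0 t -> dG t = 0.
Proof.
move=> it; apply/malgP => b; rewrite mcoeff0; apply/eqP.
by apply: contraT => /(bd_deg it).
Qed.

Lemma htpy_iterS n b : htpy_iter n.+1 << b >> = htpy_gen (htpy_iter n) b.
Proof. exact: ext_endoU. Qed.

Lemma htpy_bd_coh n b : (forall i t, (i < n)%N -> indeg i t ->
    htpy_iter n.+1 t = htpy_iter n t) -> (gdeg b <= n)%N ->
  htpy_iter n.+1 (dG << b >>) = htpy_iter n (dG << b >>).
Proof.
move=> IH; case Db: (gdeg b) => [|i] le_bn.
  have -> : dG << b >> = 0 by apply: in_deg0_bd; rewrite -Db; exact: in_degU.
  by rewrite !(linear0 (_ : {linear T -> T})).
by apply: (IH i) => //; apply: in_degS_bd; rewrite -Db; exact: in_degU.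
Qed.

Lemma htpy_stable n : forall i t, (i < n)%N -> indeg i t ->
  htpy_iter n.+1 t = htpy_iter n t.
Proof.
elim: n => [//|n IH] i t lt_in it; apply: eq_endo_gen => b bt.
rewrite !htpy_iterS; have lt_bn : (gdeg b <= n)%N.
  by rewrite (in_deg_supp it bt).
rewrite /htpy_gen; suff -> : is_htpy (htpy_iter n.+1) b = is_htpy (htpy_iter n) b.
  by [].
by apply: funext => u; rewrite /is_htpy htpy_bd_coh.
Qed.

Lemma htpy_stableD n m i t : (i < n)%N -> indeg i t ->
  htpy_iter (m + n) t = htpy_iter n t.
Proof.
move=> lt_in it; elim: m => [//|m IH]; rewrite addSn (htpy_stable _ it) //.
exact: leq_trans lt_in (leq_addl _ _).
Qed.

Lemma htpyE i t : indeg i t -> htpy t = htpy_iter i.+1 t.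
Proof.
move=> it; apply: eq_endo_gen => b bt; rewrite ext_endoU.
by rewrite (in_deg_supp it bt).
Qed.

Lemma htpy_sol b : is_htpy htpy b (htpy << b >>).
Proof.
have [n] := ubnP (gdeg b); elim: n b => // n IH b lt_bn.
have dE : htpy_iter (gdeg b) (dG << b >>) = htpy (dG << b >>).
  case Db: (gdeg b) => [|i].
    have -> : dG << b >> = 0 by apply: in_deg0_bd; rewrite -Db; exact: in_degU.
    by rewrite !(linear0 (_ : {linear T -> T})).
  by rewrite (@htpyE i) //; apply: in_degS_bd; rewrite -Db; exact: in_degU.
have homog i t : (i < gdeg b)%N -> indeg i t ->
    indeg i.+1 (htpy t) /\ dG (htpy t) + htpy (dG t) = y *: t.
  move=> lt_ib it; have Hb c : c \in msupp t -> is_htpy htpy c (htpy << c >>).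
    move=> ct; apply: IH; rewrite (in_deg_supp it ct).
    exact: leq_trans lt_ib lt_bn.
  split.
    rewrite [t]malg_lin (linear_sum (htpy : {linear T -> T})) big_seq.
    elim/big_rec: _ => [|c u ct iu]; first by move=> c; rewrite mcoeff0 eqxx.
    apply: in_degD iu; rewrite (linearZZ (htpy : {linear T -> T})).
    apply: in_degZ; have [+ _] := Hb _ ct.
    by rewrite (in_deg_supp it ct).
  apply: (@eq_endo_gen _ _ (dG * htpy + htpy * dG) (y *: (1 : E)) t) => c ct.
  by have [_ hc] := Hb c ct; rewrite endoD !endoM hc subrK.
have ex : exists u, is_htpy htpy b u.
  have iv : indeg (gdeg b) (y *: << b >> - htpy (dG << b >>)).
    apply: in_degD; first by apply: in_degZ; exact: in_degU.
    apply: in_degN; case Db: (gdeg b) => [|i].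
      have -> : dG << b >> = 0 by apply: in_deg0_bd; rewrite -Db; exact: in_degU.
      by rewrite (linear0 (_ : {linear T -> T})) => c; rewrite mcoeff0 eqxx.
    have ib : indeg i (dG << b >>).
      by apply: in_degS_bd; rewrite -Db; exact: in_degU.
    by have [] := homog i (dG << b >>) _ ib; rewrite ?Db.
  case Db: (gdeg b) iv => [|i] iv.
    have b0 : indeg 0 (<< b >> : T) by rewrite -Db; exact: in_degU.
    have /(eps_exact iv) [u iu uE] : eps G (y *: << b >> - htpy (dG << b >>)) = 0.
      rewrite (in_deg0_bd b0) (linear0 (htpy : {linear T -> T})) subr0.
      by rewrite linearZ /= y0 mul0r.
    by exists u; rewrite /is_htpy Db.
  have ib : indeg i (dG << b >>).
    by apply: in_degS_bd; rewrite -Db; exact: in_degU.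
  suff /(bd_exact iv) [u iu uE] : dG (y *: << b >> - htpy (dG << b >>)) = 0.
    by exists u; rewrite /is_htpy Db.
  have lt_ib : (i < gdeg b)%N by rewrite Db.
  have [_] := homog _ _ lt_ib ib; rewrite [dG (dG _)]bd_bd (linear0 (htpy : {linear T -> T})) addr0 => hE.
  rewrite (linearB (bd G)) (linearZZ (bd G)) -[bd G _ as X in _ - X]/(dG _).
  by rewrite hE subrr.
have htpyb : htpy << b >> = htpy_gen (htpy_iter (gdeg b)) b.
  by rewrite /htpy ext_endoU htpy_iterS.
have isE : is_htpy (htpy_iter (gdeg b)) b = is_htpy htpy b.
  by apply: funext => u; rewrite /is_htpy dE.
rewrite htpyb /htpy_gen isE; case: pselect => [e|//].
by case: cid.
Qed.

Lemma htpy_deg : hom_deg (- 1) htpy.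
Proof.
move=> i t it b; rewrite [t]malg_lin (linear_sum (htpy : {linear T -> T})).
rewrite raddf_sum /= => nz; suff : gdeg b = i.+1 by lia.
apply/eqP; apply: contraNT nz => nb; rewrite big_seq big1 // => c ct.
rewrite (linearZZ (htpy : {linear T -> T})) mcoeffZ.
have [hc _] := htpy_sol c; have [->|/hc] := eqVneq (htpy << c >>)@_b 0.
  by rewrite mulr0.
by rewrite (in_deg_supp it ct) => bE; rewrite bE eqxx in nb.
Qed.

Lemma htpy_diff : hom_diff (- 1) htpy = y *: (1 : E).
Proof.
rewrite /hom_diff expr1 scaleN1r opprK; apply: endoP => t.
apply: eq_endo_gen => b _; have [_ hb] := htpy_sol b.
by rewrite endoD !endoM hb subrK.
Qed.

Lemma scalar_coboundary : coboundaries (scalar_map G y).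
Proof.
apply: (@sum_of_incl _ _ _ 0%N); exists htpy; first exact: htpy_deg.
by rewrite sub0r htpy_diff.
Qed.
End NullHomotopy.

Section Ext.
Variables (L : localRing) (G : free_resolution L).
Local Notation T := {malg L[gen G]}.
Local Notation E := (endo T).

Local Notation coh := (quot2 (coboundary_ideal G)).

Definition ext_unit (a : residue L) : coh :=
  @class2 _ (coboundary_ideal G) (scalar_map G (lift_res a)).

Lemma scalar_map_eq (c c' : L) : res c = res c' ->
  @class2 _ (coboundary_ideal G) (scalar_map G c) =
  @class2 _ (coboundary_ideal G) (scalar_map G c').
Proof.
move=> cc'; apply/class2_eq.
rewrite -scalar_mapB; apply: scalar_coboundary.
by rewrite raddfB /= cc' subrr.
Qed.

Fact ext_unit_is_zmod : zmod_morphism ext_unit.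
Proof.
move=> a b; rewrite /ext_unit -raddfB -scalar_mapB; apply: scalar_map_eq.
by rewrite raddfB /= !lift_resK.
Qed.
HB.instance Definition _ :=
  GRing.isZmodMorphism.Build (residue L) coh ext_unit ext_unit_is_zmod.

Fact ext_unit_is_monoid : monoid_morphism ext_unit.
Proof.
split=> [|a b].
  rewrite -(rmorph1 (@class2 _ (coboundary_ideal G))) -scalar_map1.
  by apply: scalar_map_eq; rewrite lift_resK rmorph1.
rewrite /ext_unit -rmorphM -scalar_mapM; apply: scalar_map_eq.
by rewrite rmorphM /= !lift_resK.
Qed.
HB.instance Definition _ :=
  GRing.isMonoidMorphism.Build (residue L) coh ext_unit ext_unit_is_monoid.

(* Ext_R(k,k) with the composition product: [f] * [g] = [f \o g], and a in k
   acts as multiplication by any lift of a to R. *)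
Definition Ext : Type := alg_along ext_unit.
HB.instance Definition _ := GRing.PzRing.on Ext.
HB.instance Definition _ := GRing.Lmodule.on Ext.

Definition Ext_class (z : cocycles G) : Ext :=
  @class2 _ (coboundary_ideal G) z.

Definition Ext_deg (n : nat) (v : Ext) :=
  exists2 z : cocycles G, cocycle n z & v = Ext_class z.

Lemma Ext_scaleE (c : L) (z : cocycles G) :
  res c *: Ext_class z = Ext_class (scalar_map G c * z).
Proof.
rewrite /Ext_class rmorphM; congr (_ * _).
by apply: scalar_map_eq; rewrite lift_resK.
Qed.

Lemma Ext_scaleAl a (u v : Ext) : a *: (u * v) = (a *: u) * v.
Proof. exact: mulrA. Qed.

Lemma Ext_scaleAr a (u v : Ext) : a *: (u * v) = u * (a *: v).
Proof.
have ExtM s t : Ext_class (s * t) = Ext_class s * Ext_class t.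
  exact: (rmorphM (@class2 _ (coboundary_ideal G))).
have [z zu] := class2_surj u; have [t tv] := class2_surj v.
have -> : u = Ext_class z by [].
have -> : v = Ext_class t by [].
rewrite -[a]lift_resK -ExtM !Ext_scaleE -ExtM.
congr Ext_class; apply: val_inj; rewrite !rmorphM /=.
by rewrite -!endo_scaleAl !mul1r -endo_scaleAr.
Qed.

(* Under Ext^1_R(k,k) = Hom_k(m/m^2,k), the class v of degree 1 takes the class
   of y in m to a: for any g in G_0 over 1 in k and any u in G_1 over y g, a
   representing cocycle f of v has eps (f u) = a.  This is independent of the
   choices; the other sign convention replaces v by - v. *)
Definition Ext1_eval (v : Ext) (y : L) (a : residue L) :=
  exists z : cocycles G, [/\ cocycle 1 z, v = Ext_class z &
    forall g u : T, in_deg (@gdeg L G) 0 g -> eps G g = 1 ->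
      in_deg (@gdeg L G) 1 u -> bd G u = y *: g ->
      eps G ((z : E) u) = a].
End Ext.

Record gmodule (A : pzRingType) (Adeg : nat -> A -> Prop) := GModule {
  gm_sort :> lmodType A;
  gm_deg : int -> gm_sort -> Prop;
  gm_grading : is_grading gm_deg;
  gm_scale : forall i j a v, Adeg i a -> gm_deg j v -> gm_deg (i%:Z + j) (a *: v)
}.

Section GradedModules.
Variables (A : pzRingType) (Adeg : nat -> A -> Prop).
Local Notation gmod := (gmodule Adeg).

Definition bounded_below (M : gmod) :=
  exists N : int, forall n (v : M), n < N -> gm_deg n v -> v = 0.

Definition graded_free (M : gmod) := exists (I : choiceType) (b : I -> M),
  (forall i, exists n, gm_deg n (b i)) /\ is_basis b.

Definition finite_free (M : gmod) := graded_free M /\ finitely_generated M.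

Definition bounded_below_free (M : gmod) := graded_free M /\ bounded_below M.

Definition deg0_hom (M N : gmod) (f : {linear M -> N}) :=
  forall n v, gm_deg n v -> gm_deg n (f v).

Definition exact_at (M N P : gmod) (f : {linear M -> N}) (g : {linear N -> P}) :=
  forall v, g v = 0 <-> exists u, f u = v.

Definition finitely_presented (M : gmod) :=
  exists (F1 F0 : gmod) (d1 : {linear F1 -> F0}) (d0 : {linear F0 -> M}),
    [/\ finite_free F1 /\ finite_free F0, deg0_hom d1 /\ deg0_hom d0,
        exact_at d1 d0 & forall v, exists u, d0 u = v].

Definition has_resolution2 (P : gmod -> Prop) (M : gmod) :=
  exists (F2 F1 F0 : gmod) (d2 : {linear F2 -> F1}) (d1 : {linear F1 -> F0})
    (d0 : {linear F0 -> M}),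
    [/\ [/\ P F2, P F1 & P F0], [/\ deg0_hom d2, deg0_hom d1 & deg0_hom d0],
        injective d2, exact_at d2 d1 /\ exact_at d1 d0 &
        forall v, exists u, d0 u = v].
End GradedModules.

(* From here on e = n.+1, and the indices 1, ..., e are shifted to 0, ..., n:
   x_e is x ord_max, and x_1, ..., x_r are indexed through 'I_r. *)
Section ConcaData.
Variable L : localRing.

Definition sub_ord (n r : nat) (le_rn : (r <= n)%N) (h : 'I_r) : 'I_n.+1 :=
  widen_ord (leqW le_rn) h.

Definition conca_basis (n r : nat) (le_rn : (r <= n)%N) (x : 'I_n.+1 -> L) :=
  [/\ forall i, maxid (x i) /\ ~ maxid2 (x i),
      quot_kbasis (@maxid2 L) (eq^~ 0)
        (fun h : 'I_r => x (sub_ord le_rn h) * x ord_max) &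
      quot_kbasis (fun y => maxid y /\ y * x ord_max = 0) (@maxid2 L)
        (fun i : {i : 'I_n.+1 | (r <= i)%N} => x (val i))].

Definition structure_constants (n r : nat) (le_rn : (r <= n)%N)
    (x : 'I_n.+1 -> L) (a : 'I_n.+1 -> 'I_n.+1 -> 'I_r -> residue L) :=
  forall i j : 'I_n.+1, (i <= j)%N -> (j < n)%N ->
  forall c : 'I_r -> L, (forall h, res (c h) = a i j h) ->
    x i * x j = \sum_h c h * (x (sub_ord le_rn h) * x ord_max).
End ConcaData.

Section Relations.
Variables (K : nzRingType) (n r : nat) (le_rn : (r <= n)%N).
Variable (a : 'I_n.+1 -> 'I_n.+1 -> 'I_r -> K).
Local Notation X := (@letter K n.+1).

Definition anticomm (p q : freealg K n.+1) := p * q + q * p.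

Definition conca_rel (h : 'I_r) : freealg K n.+1 :=
  anticomm (X (sub_ord le_rn h)) (X ord_max)
  + \sum_(i < n.+1 | (i < n)%N) \sum_(j < n.+1 | (i < j < n)%N)
      a i j h *: anticomm (X i) (X j)
  + \sum_(i < n.+1 | (i < n)%N) a i i h *: X i ^+ 2.

Definition reduced_word (w : word n.+1) : bool :=
  [forall h : 'I_r, ~~ infix [:: ord_max; sub_ord le_rn h] w].
End Relations.

(* Main.v *)
(* Let x = x_e be the Conca generator.  Since xi_e xi_h is the only monomial of phi_h
   that starts with xi_e and ends with one of xi_1, ..., xi_r, rewriting by the phi_h
   expresses every word through reduced words, and phi_h vanishes in E.  It remains to
   see that reduced words are independent in E.  As y z lies in x m for all y, z in m,
   an induction along the resolution G gives: if d u is in m G and y in m, then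
   y d u = x d s for some s.  This allows one to build recursively, for each reduced word
   i w, a chain u with d u = x_i U_w - x s, and these chains are dual to the
   reduced words under evaluation of cocycles, which gives (1) and (2).

   For (3), let t = xi_e, let J be the right ideal spanned by the reduced words that are
   not powers of t, and call a reduced word t^m xi_i with i < e a block.  Then E is the
   sum of k[t] and J, J is freely generated as a right ideal by the blocks, and by the
   relations t J is contained in J and t a in J implies a in J.  The freeness over blocks
   passes to submodules of free modules.  If Z is the kernel of a map between graded
   free modules, then J M meets Z in J Z, so that t is cancellable in Z modulo J Z; hence
   a minimal set of homogeneous generators of Z, when Z is bounded below, satisfies no
   relation. *)

Require Import Defs.
From HB Require Import structures.
From mathcomp Require Import all_boot all_order all_algebra.
From mathcomp Require Import zify ring.
From mathcomp Require Import finmap boolp.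
From mathcomp Require classical_sets.
From mathcomp.multinomials Require Import monalg.

Set Implicit Arguments.
Unset Strict Implicit.
Unset Printing Implicit Defensive.

Import Order.TTheory GRing.Theory Num.Theory.
Local Open Scope ring_scope.

(** Rewriting alone shows neither that the [xi i] generate the Ext algebra nor that no further
    relations hold. Both come from a pairing: a cocycle of degree m, followed by [eps], is evaluated
    on the chains of degree m whose boundary lies in m G. The induction on degrees therefore carries
    two statements: dual chains exist, which gives independence, and a chain on which all reduced
    words vanish lies in m G plus the boundaries, which gives generation. As G need be neither
    minimal nor finitely generated in each degree, a Zorn argument is used to show that a cocycle
    with vanishing pairing is a coboundary. Finiteness of the resolutions in (3) rests on a bound
    for Z / J Z. Modulo J the algebra is k[t], with one dimension in each degree, so the homogeneous
    components of M / J M have bounded dimension when M is finite free. The kernel Z inherits the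
    bound because Z / J Z embeds in M / J M, and the bound limits the number of minimal generators
    of Z. *)

(** Zorn's lemma for a property of finite character, to be read as independence. The second clause
    is maximality: an element outside [X] becomes dependent together with finitely many members of
    [X]. It provides a complement of the boundaries modulo m G, and later minimal generators. *)
Lemma tukey (T : eqType) (ind : seq T -> Prop) :
  ind [::] -> (forall s t, {subset s <= t} -> ind t -> ind s) ->
  exists X : T -> Prop, (forall s, (forall b, b \in s -> X b) -> ind s) /\
    forall b, X b \/ exists2 s, (forall c, c \in s -> X c) & ~ ind (b :: s).
Proof.
move=> ind0 indS.
pose P (X : T -> Prop) := forall s, (forall b, b \in s -> X b) -> ind s.
have [F FP Ftot|X [PX Xmax]] := @classical_sets.Zorn_bigcup T P.
  move=> s sF.
  (* A finite list in the union of a chain lies in one member; the empty list is kept apart because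
     the chain may be empty. *)
  have [->|[X FX sX]] : s = [::] \/ exists2 X, F X & forall b, b \in s -> X b.
  - elim: s sF => [|b s IH] sF; [by left|right].
    have [Y FY Yb] := sF b (mem_head _ _).
    have [s0|[X FX sX]] := IH (fun c cs => sF c (mem_behead (s := b :: s) cs)).
      by exists Y => // c; rewrite s0 inE => /eqP ->.
    have [XY|YX] := Ftot _ _ FX FY.
      by exists Y => // c; rewrite inE => /orP[/eqP ->//|/sX]; exact: XY.
    by exists X => // c; rewrite inE => /orP[/eqP ->|/sX//]; exact: YX.
  - by [].
  - exact: FP FX s sX.
exists X; split=> // b; apply: contrapT => /not_orP[nXb nE].
apply: (Xmax (fun c => c = b \/ X c)).
  by split=> [c Xc|XX]; [right | apply: nXb; apply: XX; left].
move=> s sX; apply: contrapT => nind; apply: nE.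
exists [seq c <- s | c != b] => [c|].
  by rewrite mem_filter => /andP[/eqP cb /sX[]].
move=> is'; apply: nind; apply: indS is' => c cs; rewrite inE mem_filter cs.
by case: eqP.
Qed.

(** * Conca generators *)

Section ConcaRing.
Variables (L : localRing) (n r : nat) (le_rn : (r <= n)%N) (x : 'I_n.+1 -> L).
Hypothesis conca_x : conca_generator (x ord_max) (@maxid L).
Hypothesis basis_x : conca_basis le_rn x.
Local Notation xe := (x ord_max).
Local Notation xh h := (x (Defs.sub_ord le_rn h)).

Lemma maxidM (c y : L) : maxid y -> maxid (c * y).
Proof. by rewrite /maxid rmorphM => ->; rewrite mulr0. Qed.

Lemma maxid_sum (I : Type) (s : seq I) (P : pred I) (y : I -> L) :
  (forall i, P i -> maxid (y i)) -> maxid (\sum_(i <- s | P i) y i).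
Proof. by move=> my; rewrite /maxid rmorph_sum big1. Qed.

Lemma conca_mem i : maxid (x i).
Proof. by have [/(_ i)[]] := basis_x. Qed.

Lemma conca_sqr : xe * xe = 0.
Proof. by have [_ _ + _] := conca_x; rewrite expr2. Qed.

Lemma conca_prod y z : maxid y -> maxid z -> exists2 w, maxid w & y * z = xe * w.
Proof.
move=> my mz; have [_ _ _ H] := conca_x.
suff /H[w mw ->] : ideal_mul (@maxid L) (@maxid L) (y * z) by exists w.
exists [:: (y, z)]; split; last by rewrite big_seq1.
by move=> t; rewrite inE => /eqP ->.
Qed.

Lemma conca_mul_mem2 y : maxid y -> maxid2 (y * xe).
Proof.
move=> my; exists [:: (y, xe)]; split; last by rewrite big_seq1.
by move=> t; rewrite inE => /eqP ->; split=> //; exact: conca_mem.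
Qed.

Lemma conca_basisP y : maxid2 y ->
  exists c : 'I_r -> L, y = \sum_h c h * (xh h * xe).
Proof.
have [_ [_ span _] _] := basis_x.
by move=> /span[c /eqP]; rewrite subr_eq0 => /eqP ->; exists c.
Qed.

Lemma conca_basis_free (c : 'I_r -> L) :
  \sum_h c h * (xh h * xe) = 0 -> forall h, maxid (c h).
Proof. by have [_ [_ _ +] _] := basis_x; apply. Qed.

Lemma conca_annih (i : 'I_n.+1) : (r <= i)%N -> x i * xe = 0.
Proof. by move=> ri; have [_ _ [/(_ (Sub i ri))[]]] := basis_x. Qed.

Lemma big_sub_ord (V : nmodType) (F : 'I_n.+1 -> V) :
  \sum_i F i = \sum_(h < r) F (Defs.sub_ord le_rn h) + \sum_(i < n.+1 | (r <= i)%N) F i.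
Proof.
rewrite (bigID (fun i : 'I_n.+1 => (i < r)%N)) /=; congr (_ + _).
  rewrite (big_ord_narrow (leqW le_rn)).
  by apply: eq_big.
by apply: eq_bigl => i; rewrite -leqNgt.
Qed.

(** Multiplication by x_e detects the first r coefficients: expanding [y * xe] in the basis of m^2
    leaves [y'] annihilated by x_e, hence a combination of the x_i with i >= r modulo m^2. The
    remainder in m^2 is itself a multiple of x_e and goes into the coefficient of [x ord_max]. *)
Lemma conca_gen y : maxid y -> exists c : 'I_n.+1 -> L, y = \sum_i c i * x i.
Proof.
move=> my; have [c yX] := conca_basisP (conca_mul_mem2 my).
have [_ _ [_ span _]] := basis_x.
pose y' := y - \sum_h c h * xh h.
have [|c' y'E] := span y'.
  split; last by rewrite mulrBl yX mulr_suml; apply/eqP; rewrite subr_eq0;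
    apply/eqP/eq_bigr => h _; rewrite mulrA.
  rewrite /maxid rmorphB /= my maxid_sum ?subrr // => h _.
  exact: maxidM (conca_mem _).
have [c2 E2] := conca_basisP y'E.
pose c3 (i : 'I_n.+1) := if insub i : {? i : 'I_n.+1 | (r <= i)%N} is Some j then c' j else 0.
pose c1 (i : 'I_n.+1) := oapp c 0 (insub (i : nat)).
exists (fun i : 'I_n.+1 => if (i < r)%N then c1 i
                 else c3 i + (i == ord_max)%:R * \sum_h c2 h * xh h).
have -> : y = y' + \sum_h c h * xh h by rewrite subrK.
rewrite big_sub_ord addrC; congr (_ + _).
  apply: eq_bigr => h _ /=; rewrite ltn_ord /c1 (_ : insub _ = Some h) //; exact: valK.
move/eqP: E2; rewrite subr_eq => /eqP ->; rewrite addrC.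
under [RHS]eq_bigr => i ri do rewrite ltnNge ri /= mulrDl.
rewrite big_split /=; congr (_ + _).
  rewrite (big_sub (fun i : 'I_n.+1 => (r <= i)%N) (fun i => c3 i * x i)) /=.
  by apply: eq_bigr => i _; rewrite /c3 valK.
rewrite (bigD1 ord_max le_rn) /= eqxx mul1r [X in _ = _ + X]big1.
  by rewrite addr0 mulr_suml; apply: eq_bigr => h _; rewrite mulrA.
by move=> i /andP[_ /negPf ->]; rewrite !mul0r.
Qed.

(** Multiplied by x_e, the relation keeps only the indices below r, whose coefficients lie in m by
    independence of the x_h x_e. The other terms then sum to an element of m^2, and their classes
    are independent modulo m^2. *)
Lemma conca_free (c : 'I_n.+1 -> L) :
  \sum_i c i * x i = 0 -> forall i, maxid (c i).
Proof.
move=> E.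
have ch h : maxid (c (Defs.sub_ord le_rn h)).
  apply: (conca_basis_free (c := fun h => c (Defs.sub_ord le_rn h))).
  have := congr1 (fun y => y * xe) E; rewrite mul0r mulr_suml big_sub_ord.
  rewrite [X in _ + X]big1 => [|i ri]; last by rewrite -mulrA conca_annih ?mulr0.
  rewrite addr0 => E'; apply: etrans E'; apply: eq_bigr => h' _; exact: mulrA.
have [_ _ [_ _ free]] := basis_x.
move=> i; have [lt_ir|ri] := ltnP i r.
  by have := ch (Ordinal lt_ir); congr (maxid (c _)); apply: val_inj.
apply: (free (fun j => c (val j)) _ (Sub i ri)).
rewrite -(big_sub (fun i : 'I_n.+1 => (r <= i)%N) (fun i => c i * x i)) /=.
move/eqP: E; rewrite big_sub_ord addrC addr_eq0 => /eqP ->.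
exists [seq (- c (Defs.sub_ord le_rn h), xh h) | h <- index_enum 'I_r]; split.
  move=> t /mapP[h _ ->]; split; last exact: conca_mem.
  by rewrite /maxid rmorphN [res _]ch oppr0.
by rewrite big_map /= -sumrN; apply: eq_bigr => h _; rewrite mulNr.
Qed.

End ConcaRing.

(** * Free resolutions over a ring with a Conca generator *)

Section Resolution.
Variables (L : localRing) (G : free_resolution L).
Local Notation T := {malg L[gen G]}.
Local Notation E := (endo T).
Local Notation indeg := (@in_deg L (gen G) (@gdeg L G)).
Local Notation d := (bd G).
Local Notation ep := (eps G).
Implicit Types (f : E) (t u v w : T).

Lemma endo_raddfD f u v : f (u + v) = f u + f v.
Proof. exact: (linearD (f : {linear T -> T})). Qed.
Lemma endo_raddfB f u v : f (u - v) = f u - f v.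
Proof. exact: (linearB (f : {linear T -> T})). Qed.
Lemma endo_raddf0 f : f 0 = 0.
Proof. exact: (linear0 (f : {linear T -> T})). Qed.
Lemma endo_linearZ f a u : f (a *: u) = a *: f u.
Proof. exact: (linearZZ (f : {linear T -> T})). Qed.
Lemma endo_raddf_sum f (I : Type) (s : seq I) (P : pred I) (F : I -> T) :
  f (\sum_(i <- s | P i) F i) = \sum_(i <- s | P i) f (F i).
Proof. exact: (linear_sum (f : {linear T -> T})). Qed.

Lemma bdB u v : d (u - v) = d u - d v. Proof. exact: linearB. Qed.
Lemma bdD u v : d (u + v) = d u + d v. Proof. exact: linearD. Qed.
Lemma bd0 : d 0 = 0. Proof. exact: linear0. Qed.
Lemma bdZ a u : d (a *: u) = a *: d u. Proof. exact: linearZZ. Qed.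
Lemma bd_sum (I : Type) (s : seq I) (P : pred I) (F : I -> T) :
  d (\sum_(i <- s | P i) F i) = \sum_(i <- s | P i) d (F i).
Proof. exact: linear_sum. Qed.

Lemma epsZ a u : ep (a *: u) = res a * ep u.
Proof. by rewrite linearZ. Qed.

Lemma in_deg0 i : indeg i 0.
Proof. by move=> b; rewrite mcoeff0 eqxx. Qed.

Lemma in_degB i u v : indeg i u -> indeg i v -> indeg i (u - v).
Proof. by move=> iu iv; apply: in_degD iu (in_degN iv). Qed.

Lemma in_deg_sum i (I : Type) (s : seq I) (P : pred I) (F : I -> T) :
  (forall j, P j -> indeg i (F j)) -> indeg i (\sum_(j <- s | P j) F j).
Proof.
move=> iF; elim/big_rec: _ => [|j u Pj iu]; first exact: in_deg0.
by apply: in_degD => //; exact: iF.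
Qed.

(* [in_max v] says that [v] lies in the submodule [m G] *)
Definition in_max v := forall b, maxid v@_b.

Lemma in_max0 : in_max 0.
Proof. by move=> b; rewrite mcoeff0 /maxid rmorph0. Qed.
Lemma in_maxD u v : in_max u -> in_max v -> in_max (u + v).
Proof. by move=> mu mv b; rewrite mcoeffD /maxid rmorphD mu mv addr0. Qed.
Lemma in_maxZ a v : in_max v -> in_max (a *: v).
Proof. by move=> mv b; rewrite mcoeffZ; exact: maxidM. Qed.
Lemma in_maxN v : in_max v -> in_max (- v).
Proof. by move=> mv; rewrite -scaleN1r; exact: in_maxZ. Qed.
Lemma in_maxB u v : in_max u -> in_max v -> in_max (u - v).
Proof. by move=> mu mv; apply: in_maxD mu (in_maxN mv). Qed.
Lemma maxid_scale a v : maxid a -> in_max (a *: v).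
Proof. by move=> ma b; rewrite mcoeffZ mulrC; exact: maxidM. Qed.
Lemma in_max_sum (I : Type) (s : seq I) (P : pred I) (F : I -> T) :
  (forall j, P j -> in_max (F j)) -> in_max (\sum_(j <- s | P j) F j).
Proof.
move=> iF; elim/big_rec: _ => [|j u Pj iu]; first exact: in_max0.
by apply: in_maxD => //; exact: iF.
Qed.

Lemma in_max_endo f v : in_max v -> in_max (f v).
Proof.
move=> mv; rewrite [v]malg_lin endo_raddf_sum; apply: in_max_sum => b _.
by rewrite endo_linearZ; apply: maxid_scale; exact: mv.
Qed.

Lemma eps_in_max v : in_max v -> ep v = 0.
Proof.
move=> mv; rewrite [v]malg_lin linear_sum big1 // => b _.
by rewrite /= epsZ mv mul0r.
Qed.

Lemma eps_bd t : ep (d t) = 0.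
Proof.
rewrite [t]malg_lin !linear_sum big1 // => b _.
rewrite linearZ /= epsZ; case Db: (gdeg b) => [|[|i]].
- by rewrite in_deg0_bd ?linear0 ?mulr0 // -Db; exact: in_degU.
- have ib : indeg 1 (<< b >> : T) by rewrite -Db; exact: in_degU.
  have -> : ep (d << b >>) = 0; last by rewrite mulr0.
  by apply/(eps_exact (in_degS_bd ib)); exists << b >>.
rewrite (@eps_deg _ _ i) ?mulr0 //; apply: in_degS_bd.
by rewrite -Db; exact: in_degU.
Qed.

(** In degree 0 exactness asks for [eps v = 0] instead of [d v = 0]; lying in m G grants it, so all
    degrees can be treated alike. *)
Lemma max_cycle i v : in_max v -> indeg i v -> d v = 0 ->
  exists2 u, indeg i.+1 u & d u = v.
Proof.
case: i => [|i] mv iv dv; last exact: bd_exact.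
by apply/eps_exact => //; exact: eps_in_max.
Qed.

Lemma max_bd0 u : indeg 0 u -> in_max (d u).
Proof. by move=> iu; rewrite in_deg0_bd //; exact: in_max0. Qed.

Definition recoef v (c : gen G -> L) : T := [malg b in msupp v => c b].

Lemma recoefE v c b : (recoef v c)@_b = if b \in msupp v then c b else 0.
Proof. exact: mcoeffE. Qed.

Lemma in_deg_recoef i v c : indeg i v -> indeg i (recoef v c).
Proof.
move=> iv b; rewrite recoefE; case: ifP => [bv _|]; last by rewrite eqxx.
exact: in_deg_supp iv bv.
Qed.

Section Conca.
Variables (n r : nat) (le_rn : (r <= n)%N) (x : 'I_n.+1 -> L).
Hypothesis conca_x : conca_generator (x ord_max) (@maxid L).
Hypothesis basis_x : conca_basis le_rn x.
Local Notation xe := (x ord_max).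
Local Notation xh h := (x (Defs.sub_ord le_rn h)).

Lemma in_max_gen i v : in_max v -> indeg i v -> exists w : 'I_n.+1 -> T,
  (forall j, indeg i (w j)) /\ v = \sum_j x j *: w j.
Proof.
move=> mv iv; have [c vc] := choice (fun b => conca_gen basis_x (mv b)).
exists (fun j => recoef v (fun b => c b j)); split=> [j|].
  exact: in_deg_recoef.
apply/malgP => b; rewrite raddf_sum /=.
have [bv|/negbTE bv] := boolP (b \in msupp v).
  rewrite [LHS]vc; apply: eq_bigr => j _.
  by rewrite mcoeffZ recoefE bv mulrC.
rewrite mcoeff_outdom ?bv // big1 // => j _.
by rewrite mcoeffZ recoefE bv mulr0.
Qed.

Lemma in_max_free (w : 'I_n.+1 -> T) :
  \sum_j x j *: w j = 0 -> forall j, in_max (w j).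
Proof.
move=> E0 j b; apply: (conca_free basis_x (c := fun j => (w j)@_b)).
have := congr1 (mcoeff b) E0; rewrite mcoeff0 raddf_sum => E1; rewrite -[RHS]E1.
by apply: eq_bigr => i _; rewrite /= mcoeffZ mulrC.
Qed.

Lemma in_max_free2 (w : 'I_r -> T) :
  \sum_h (xh h * xe) *: w h = 0 -> forall h, in_max (w h).
Proof.
move=> E0 h b; apply: (conca_basis_free basis_x (c := fun h => (w h)@_b)).
have := congr1 (mcoeff b) E0; rewrite mcoeff0 raddf_sum => E1; rewrite -[RHS]E1.
by apply: eq_bigr => i _; rewrite /= mcoeffZ mulrC.
Qed.

Lemma in_max_prod y i v : maxid y -> in_max v -> indeg i v ->
  exists w, [/\ in_max w, indeg i w & y *: v = xe *: w].
Proof.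
move=> my mv iv.
have [c vc] := choice (fun b => (fun H => let: ex_intro2 z p q := H in
  ex_intro (fun z => maxid z /\ y * v@_b = xe * z) z (conj p q))
  (conca_prod conca_x my (mv b))).
exists (recoef v c); split.
- by move=> b; rewrite recoefE; case: ifP => _; [case: (vc b)|rewrite /maxid rmorph0].
- exact: in_deg_recoef.
apply/malgP => b; rewrite !mcoeffZ recoefE; case: ifP => [_|/negbT].
  by case: (vc b).
by move/mcoeff_outdom ->; rewrite !mulr0.
Qed.

(* Write [d u = sum x_j v_j] and [y x_j = x_e y_j]: by induction [y_j d v_j = x_e d s],
   so that [y_j v_j - x_e s] is a cycle in [m G], hence a boundary. *)
Lemma conca_lift i u y : indeg i u -> in_max (d u) -> maxid y ->
  exists2 s, indeg i s & y *: d u = xe *: d s.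
Proof.
elim: i u y => [|i IH] u y iu mu my.
  exists 0; first exact: in_deg0.
  by rewrite in_deg0_bd // bd0 !scaler0.
have [v [iv duE]] := in_max_gen mu (in_degS_bd iu).
have mv : forall j, in_max (d (v j)).
  apply: in_max_free; have := bd_bd u; rewrite duE bd_sum /= => E0.
  by rewrite -[RHS]E0; apply: eq_bigr => j _; rewrite bdZ.
have H j : exists q, indeg i.+1 q /\ (y * x j) *: v j = xe *: d q.
  have [y' my' yE] := conca_prod conca_x my (conca_mem basis_x j).
  have [s is' sE] := IH _ _ (iv j) (mv j) my'.
  have [|||q iq qE] := @max_cycle i (y' *: v j - xe *: s).
  - apply: in_maxB; apply: maxid_scale => //; exact: conca_mem basis_x _.
  - by apply: in_degB; apply: in_degZ.
  - by rewrite bdB !bdZ sE subrr.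
  exists q; split=> //; rewrite yE qE scalerBr !scalerA.
  by rewrite (conca_sqr conca_x) scale0r subr0.
have [q qP] := choice H.
exists (\sum_j q j); first by apply: in_deg_sum => j _; case: (qP j).
rewrite duE bd_sum !scaler_sumr; apply: eq_bigr => j _.
by rewrite scalerA; case: (qP j).
Qed.

Lemma conca_scale_sum (w : 'I_n.+1 -> T) :
  xe *: (\sum_j x j *: w j) =
  \sum_h (xh h * xe) *: w (Defs.sub_ord le_rn h).
Proof.
rewrite scaler_sumr (big_sub_ord le_rn) [X in _ + X]big1 ?addr0.
  by apply: eq_bigr => h _; rewrite scalerA mulrC.
by move=> i ri; rewrite scalerA mulrC (conca_annih basis_x) ?scale0r.
Qed.

(** With w = sum x_j v_j, multiplication by x_e leaves the terms x_h x_e v_h, and the hypothesis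
    puts each d v_h in m G. By [conca_lift], x_h d v_h = x_e d s, so x_h v_h - x_e s is a boundary;
    multiplying by x_e removes the correction because x_e has square zero. *)
Lemma conca_cycle i w : indeg i w -> in_max w -> xe *: d w = 0 ->
  exists2 u, indeg i.+1 u & xe *: d u = xe *: w.
Proof.
move=> iw mw E0; have [v [iv wE]] := in_max_gen mw iw.
have mv : forall h, in_max (d (v (Defs.sub_ord le_rn h))).
  apply: in_max_free2.
  rewrite -(conca_scale_sum (fun j => d (v j))) -[RHS]E0 wE bd_sum.
  by congr (_ *: _); apply: eq_bigr => j _; rewrite bdZ.
have H h : exists q, indeg i.+1 q /\
    (xh h * xe) *: v (Defs.sub_ord le_rn h) = xe *: d q.
  have mh := conca_mem basis_x (Defs.sub_ord le_rn h).
  have [s is' sE] := conca_lift (iv _) (mv h) mh.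
  have [|||q iq qE] := @max_cycle i (xh h *: v (Defs.sub_ord le_rn h) - xe *: s).
  - apply: in_maxB; apply: maxid_scale => //; exact: conca_mem basis_x _.
  - by apply: in_degB; apply: in_degZ.
  - by rewrite bdB !bdZ sE subrr.
  exists q; split=> //; rewrite qE scalerBr !scalerA mulrC.
  by rewrite (conca_sqr conca_x) scale0r subr0.
have [q qP] := choice H.
exists (\sum_h q h); first by apply: in_deg_sum => j _; case: (qP j).
rewrite wE conca_scale_sum bd_sum scaler_sumr; apply: eq_bigr => h _.
by case: (qP h).
Qed.
End Conca.
End Resolution.

(** * Coboundaries recognized by the augmentation *)

Section Coboundary.
Variables (L : localRing) (G : free_resolution L).
Local Notation T := {malg L[gen G]}.
Local Notation E := (endo T).
Local Notation indeg := (@in_deg L (gen G) (@gdeg L G)).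
Local Notation d := (bd G).
Local Notation ep := (eps G).
Implicit Types (f h z : E) (t u v w : T).

Lemma cocycle_bd n z u : cocycle n z -> d (z u) = (-1) ^+ n *: z (d u).
Proof.
move=> [_ dz]; have := congr1 (fun f : E => f u) dz.
by rewrite /hom_diff endoD endoN endoZ !endoM => /eqP; rewrite subr_eq0 => /eqP.
Qed.

(* Recursion on the degree of the generators *)
Lemma endo_rec (Q : E -> gen G -> T -> Prop) :
    (forall h h' b u, (forall c, (gdeg c < gdeg b)%N -> h << c >> = h' << c >>) ->
      Q h b u -> Q h' b u) ->
    (forall h b, (forall c, (gdeg c < gdeg b)%N -> Q h c (h << c >>)) ->
      exists u, Q h b u) ->
  exists h : E, forall b, Q h b (h << b >>).
Proof.
move=> Qloc Qex.
pose sol h b := if pselect (exists u, Q h b u) is left e then projT1 (cid e) else 0.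
(* [H k] has its final values on the generators of degree below [k]; [Qloc] transfers a solution
   found with such a partial map to [h]. *)
pose fix H (k : nat) {struct k} : gen G -> T := if k is k'.+1 then
  fun b => if (gdeg b < k')%N then H k' b else sol (ext_endo (H k')) b
  else fun=> 0.
pose h := ext_endo (fun b => H (gdeg b).+1 b); exists h.
have Hstab k b : (gdeg b < k)%N -> H k b = H (gdeg b).+1 b.
  elim: k => // k IH; rewrite ltnS leq_eqVlt => /predU1P[<- //|lt_bk].
  by rewrite [LHS]/= lt_bk IH.
have hH b c : (gdeg c < gdeg b)%N -> h << c >> = ext_endo (H (gdeg b)) << c >>.
  by move=> lt_cb; rewrite !ext_endoU Hstab.
move=> b; have [k] := ubnP (gdeg b); elim: k b => // k IH b lt_bk.
have [|u Qu] := Qex h b.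
  by move=> c lt_cb; apply: IH; apply: leq_trans lt_cb _.
have Qu' : Q (ext_endo (H (gdeg b))) b u by apply: Qloc Qu => c /hH.
have -> : h << b >> = sol (ext_endo (H (gdeg b))) b by rewrite ext_endoU /= ltnn.
apply: (Qloc (ext_endo (H (gdeg b)))) => [c /hH //|].
by rewrite /sol; case: pselect => [e|[]]; [case: cid | exists u].
Qed.

(** The homotopy [h] is built generator by generator from d h = z + s h d. The only obstruction is
    [eps] of the right side in degree [n]; [theta] prescribes [eps] of [h] in degree [n - 1] so as
    to cancel it. Above degree [n] the right side is a cycle of positive degree, hence a
    boundary. *)
Lemma coboundary_ext n z (theta : gen G -> residue L) : cocycle n z ->
    (forall b, gdeg b = n -> ep (z << b >>) =
       (-1) ^+ n * \sum_(c <- msupp (d << b >>)) res (d << b >>)@_c * theta c) ->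
  coboundary n z.
Proof.
move=> cz zE; have [zdeg _] := cz.
have [g0 ig0 eg0] := eps_surj G 1.
pose s : L := (-1) ^+ `|n%:Z - 1|%N.
have sE : s = - (-1) ^+ n.
  rewrite /s; case: n {cz zE zdeg s} => [|n]; first by rewrite expr0 expr1.
  by rewrite (_ : _ - _ = n%:Z) ?absz_nat ?exprS ?mulN1r ?opprK //; lia.
pose Q h b u := [/\ forall c, u@_c != 0 -> (gdeg c)%:Z = (gdeg b)%:Z - (n%:Z - 1),
  d u = z << b >> + s *: h (d << b >>) & (gdeg b).+1 = n -> ep u = theta b].
have dlow b c : c \in msupp (d << b >>) -> (gdeg c).+1 = gdeg b.
  by rewrite -mcoeff_neq0; apply: bd_deg; exact: in_degU.
have [h h' b u hh' [Q1 Q2 Q3]|h b IH|h hP] := endo_rec (Q := Q).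
- split=> //; rewrite Q2; congr (_ + _ *: _); apply: eq_endo_gen => c /dlow cb.
  by apply: hh'; rewrite -cb.
- have ib : indeg (gdeg b) (<< b >> : T) by exact: in_degU.
  have hdb c : (h (d << b >>))@_c != 0 -> (gdeg c)%:Z = (gdeg b)%:Z - n%:Z.
    rewrite [d << b >>]malg_lin endo_raddf_sum raddf_sum /=.
    apply: contra_neqP => nc; rewrite big_seq big1 // => a ab.
    rewrite endo_linearZ mcoeffZ; have := dlow _ _ ab => ab'.
    have [|hdeg _ _] := IH a; first by rewrite -ab'.
    have [->|/hdeg ca] := eqVneq (h << a >>)@_c 0; first by rewrite mulr0.
    by case: nc; rewrite ca -ab'; lia.
  have h0 : (gdeg b < n)%N -> h (d << b >>) = 0.
    move=> lt_bn; apply/malgP => c; rewrite mcoeff0; apply/eqP.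
    by apply: contraT => /hdb; lia.
  have z0 : (gdeg b < n)%N -> z << b >> = 0.
    by move=> lt_bn; apply: (hom_deg_lt zdeg ib); lia.
  have [lt_bn|le_nb] := ltnP (gdeg b) n.
    have [bn|bn] := eqVneq (gdeg b).+1 n; last first.
      exists 0; split; [by move=> c; rewrite mcoeff0 eqxx| |by move/eqP: bn].
      by rewrite bd0 h0 // z0 // scaler0 addr0.
    exists (lift_res (theta b) *: g0); split.
    - by move=> c /(in_degZ ig0) ->; rewrite -bn; lia.
    - by rewrite in_deg0_bd ?h0 ?z0 ?scaler0 ?addr0 //; exact: in_degZ.
    - by move=> _; rewrite epsZ lift_resK eg0 mulr1.
  set v := z << b >> + s *: h (d << b >>).
  have iv : indeg (gdeg b - n) v.
    apply: in_degD; first by apply: (in_deg_hom zdeg ib); lia.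
    by apply: in_degZ => c /hdb; lia.
  suff [u iu uE] : exists2 u, indeg (gdeg b - n).+1 u & d u = v.
    by exists u; split=> // [c /iu ->|]; lia.
  case bn: (gdeg b - n)%N => [|k]; rewrite bn in iv.
    apply/(eps_exact iv); have bn' : gdeg b = n by lia.
    rewrite linearD /= epsZ zE // [d << b >>]malg_lin endo_raddf_sum -malg_lin.
    rewrite linear_sum /= sE rmorphN rmorphXn rmorphN1 mulNr.
    apply/eqP; rewrite subr_eq0; apply/eqP; congr (_ * _).
    rewrite big_seq [RHS]big_seq; apply: eq_bigr => c cb.
    rewrite endo_linearZ epsZ; congr (_ * _).
    have cb' := dlow _ _ cb.
    have [|_ _ ->] := IH c; by [rewrite -cb' | | rewrite cb'].
  apply: (bd_exact iv); rewrite /v bdD bdZ (cocycle_bd _ cz) sE.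
  suff -> : d (h (d << b >>)) = z (d << b >>) by rewrite scaleNr subrr.
  have : ((d : E) * h : E) (d << b >>) = (z + s *: (h * (d : E)) : E) (d << b >>).
    apply: eq_endo_gen => c cb; have cb' := dlow _ _ cb.
    have [|_ hc _] := IH c; first by rewrite -cb'.
    by rewrite endoM hc.
  by rewrite endoM endoD endoZ !endoM bd_bd endo_raddf0 scaler0 addr0.
exists h.
  move=> i t it b; rewrite [t]malg_lin endo_raddf_sum raddf_sum /=.
  apply: contra_neqP => nb; rewrite big_seq big1 // => c ct.
  rewrite endo_linearZ mcoeffZ; have [hc _ _] := hP c.
  have [->|/hc bE] := eqVneq (h << c >>)@_b 0; first by rewrite mulr0.
  by case: nb; rewrite bE (in_deg_supp it ct).
rewrite /hom_diff -/s; apply: endoP => t; apply: eq_endo_gen => b _.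
have [_ hb _] := hP b.
by rewrite endoD endoN endoZ !endoM hb addrK.
Qed.

(* Modulo [m G], [phi] factors through the image of [d]; Zorn's lemma extends the
   resulting functional to all generators of degree [m]. *)
Lemma functional_ext m (phi : {linear T -> residue L | res \; *%R}) :
    (forall u, indeg m.+1 u -> in_max (d u) -> phi u = 0) ->
  exists theta : gen G -> residue L, forall u, indeg m.+1 u ->
    phi u = \sum_(c <- msupp (d u)) res (d u)@_c * theta c.
Proof.
move=> phi0; have phiZ a u : phi (a *: u) = res a * phi u by rewrite linearZ.
(* [D p] says that [p] is a boundary modulo m G, so [ind s] says that the generators of degree [m]
   in [s] are linearly independent modulo m G and the boundaries. *)
pose D p := exists2 u, indeg m.+1 u & in_max (p - d u).
pose ind (s : seq (gen G)) := forall p : T,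
  (forall b, p@_b != 0 -> b \in s /\ gdeg b = m) -> D p -> in_max p.
have [| |B [Bind Bmax]] := @tukey _ ind.
- move=> p ps _; have -> : p = 0; last exact: in_max0.
  by apply/malgP => b; rewrite mcoeff0; apply/eqP; apply: contraT => /ps[].
- by move=> s t st indt p ps; apply: indt => b /ps[/st].
(* By maximality [B] spans a complement of the boundaries: modulo m G, each generator is a
   combination [q.1] of elements of [B] plus the boundary of [q.2]. *)
have PU b : exists q : T * T, gdeg b = m -> [/\ forall c, q.1@_c != 0 -> B c /\ gdeg c = m,
    indeg m.+1 q.2 & in_max (<< b >> - q.1 - d q.2)].
  have [bm|bm] := eqVneq (gdeg b) m; last by exists (0, 0) => bm'; rewrite bm' eqxx in bm.
  have [Bb|[s sB /existsNP[p /not_implyP[ps /not_implyP[[u iu um] np]]]]] := Bmax b.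
    exists (<< b >>, 0) => _; split.
    - by move=> c /=; rewrite mcoeffU; have [<- //|_] := eqVneq b c; rewrite mulr0n eqxx.
    - exact: in_deg0.
    - by rewrite subrr bd0 subr0; exact: in_max0.
  have p1s c : (p - p@_b *: << b >>)@_c != 0 -> c \in s /\ gdeg c = m.
    rewrite mcoeffB mcoeffZ mcoeffU; have [<-|bc] := eqVneq b c.
      by rewrite mulr1n mulr1 subrr eqxx.
    rewrite mulr0n mulr0 subr0 => /ps[]; rewrite inE => /predU1P[cb|//].
    by rewrite cb eqxx in bc.
  have [pb0|pb0] := eqVneq (res p@_b) 0.
    case: np; rewrite -[p](subrK (p@_b *: << b >>)).
    apply: in_maxD; last exact: maxid_scale.
    apply: (Bind s) => //; exists u => //; rewrite addrAC.
    by apply: in_maxB => //; exact: maxid_scale.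
  pose a := lift_res (res p@_b)^-1.
  exists (- (a *: (p - p@_b *: << b >>)), a *: u) => _; split=> /=.
  - move=> c; rewrite mcoeffN oppr_eq0 mcoeffZ => nz.
    have /p1s[/sB] // : (p - p@_b *: << b >>)@_c != 0.
    by apply: contraNneq nz => ->; rewrite mulr0.
  - exact: in_degZ.
  have -> : << b >> - - (a *: (p - p@_b *: << b >>)) - d (a *: u) =
      a *: (p - d u) + (1 - a * p@_b) *: << b >>.
    rewrite bdZ opprK !scalerBr scalerBl scale1r scalerA.
    by rewrite [_ + (_ - _)]addrC -!addrA; congr (_ + _); rewrite addrC -addrA addrCA.
  apply: in_maxD; first exact: in_maxZ.
  apply: maxid_scale; rewrite /maxid rmorphB rmorph1 rmorphM /= lift_resK.
  by rewrite mulVf // subrr.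
have [q qP] := choice PU.
(* In effect the functional that is 0 on the complement spanned by [B] and agrees with [phi] on
   boundaries. *)
exists (fun c => phi (q c).2) => u iu.
pose S (F : gen G -> T) := \sum_(c <- msupp (d u)) (d u)@_c *: F c.
have idu c : c \in msupp (d u) -> gdeg c = m.
  by apply: in_deg_supp; exact: in_degS_bd.
pose u' := u - S (fun c => (q c).2).
have iS (F : gen G -> T) i : (forall c, gdeg c = m -> indeg i (F c)) -> indeg i (S F).
  move=> iF; rewrite /S big_seq; apply: in_deg_sum => c /idu cm.
  by apply: in_degZ; exact: iF.
have iu' : indeg m.+1 u' by apply: in_degB => //; apply: iS => c /qP[].
have phiS : phi (S (fun c => (q c).2)) = \sum_(c <- msupp (d u)) res (d u)@_c * phi (q c).2.
  by rewrite linear_sum; apply: eq_bigr => c _; exact: phiZ.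
rewrite -phiS; apply/eqP; rewrite -subr_eq0 -linearB; apply/eqP.
apply: phi0 => //.
(* Modulo m G the boundary of [u'] equals [p], which is supported on [B]; independence of [B] then
   forces [p] into m G. *)
pose p := S (fun c => (q c).1).
have duE : d u' - p = S (fun c => << c >> - (q c).1 - d (q c).2).
  rewrite /u' bdB {1}[d u]malg_lin bd_sum /p /S -!sumrB; apply: eq_bigr => c _.
  by rewrite bdZ !scalerBr addrAC.
have mS : in_max (d u' - p).
  rewrite duE /S big_seq; apply: in_max_sum => c /idu cm.
  by apply: in_maxZ; case: (qP c cm).
have ps b : p@_b != 0 -> B b /\ gdeg b = m.
  apply: contra_neqP => nb; rewrite raddf_sum big_seq big1 //= => c /idu cm.
  rewrite mcoeffZ; have [qc _ _] := qP c cm.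
  by have [->|/qc //] := eqVneq (q c).1@_b 0; rewrite mulr0.
rewrite -[d u'](subrK p); apply: in_maxD => //.
apply: (Bind (enum_fset (msupp p)) _ p) => [b|b pb|].
- by rewrite -mcoeff_neq0 => /ps[].
- by split; [rewrite -mcoeff_neq0 | case: (ps b pb)].
by exists u' => //; rewrite -opprB; exact: in_maxN.
Qed.

(* [G] need not be minimal: a cocycle is detected on the chains whose boundary lies
   in [m G]. *)
Lemma coboundary_eps n z : cocycle n z ->
  (forall u, indeg n u -> in_max (d u) -> ep (z u) = 0) -> coboundary n z.
Proof.
move=> cz z0; case: n => [|m] in cz z0 *.
  apply: (coboundary_ext (theta := fun=> 0) cz) => b b0.
  have ib : indeg 0 (<< b >> : T) by rewrite -b0; exact: in_degU.
  rewrite z0 //; last exact: max_bd0.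
  by rewrite in_deg0_bd // msupp0 big_seq_fset0 mulr0.
have phi_lin : linear_for (res \; *%R) (fun u => ep (z u)).
  by move=> a u v; rewrite endo_raddfD endo_linearZ linearP.
pose phi : {linear T -> residue L | res \; *%R} :=
  HB.pack (fun u => ep (z u)) (GRing.isLinear.Build _ _ _ _ _ phi_lin).
have [theta thetaP] := functional_ext (phi := phi) z0.
apply: (coboundary_ext (theta := fun c => (-1) ^+ m.+1 * theta c) cz) => b bm.
have ib : indeg m.+1 (<< b >> : T) by rewrite -bm; exact: in_degU.
rewrite [LHS](thetaP _ ib) mulr_sumr; apply: eq_bigr => c _.
rewrite [RHS]mulrCA [X in _ = _ * X]mulrA -expr2 sqrr_sign mul1r //.
Qed.

End Coboundary.

(** * Chains dual to the reduced words *)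

Section ReducedWords.
Variables (n r : nat) (le_rn : (r <= n)%N).
Local Notation red := (reduced_word le_rn).

Definition low_head (w : word n.+1) : bool := if w is i :: _ then (i < r)%N else false.

Lemma reduced_nil : red [::].
Proof. by apply/forallP. Qed.

Lemma reduced_cons i w : red (i :: w) = red w && ~~ ((i == ord_max) && low_head w).
Proof.
rewrite /reduced_word; apply/forallP/andP => [H|[/forallP H /negP hd] h].
  split; first by apply/forallP => h; apply: contra (H h) => /= ->; rewrite orbT.
  apply/negP => /andP[/eqP iE]; case: w H => //= j w H jr.
  have := H (Ordinal jr); rewrite iE /= eqxx /= (_ : _ == j) ?prefix0s //.
  exact/eqP/val_inj.
rewrite /= negb_or H andbT; apply/negP.
case: w {H} hd => [|j w] /= hd; first by rewrite andbF.
move=> /andP[/eqP iE /andP[/eqP jh _]]; apply: hd.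
by rewrite -iE eqxx -jh /=.
Qed.

Lemma reduced_cons_low (i : 'I_n.+1) w : (i < n)%N -> red (i :: w) = red w.
Proof. by move=> lt_in; rewrite reduced_cons -val_eqE /= ltn_eqF // andbT. Qed.

Lemma reduced_consW i w : red (i :: w) -> red w.
Proof. by rewrite reduced_cons => /andP[]. Qed.
End ReducedWords.

Section DualWords.
Variables (L : localRing) (G : free_resolution L).
Variables (n r : nat) (le_rn : (r <= n)%N) (x : 'I_n.+1 -> L).
Hypothesis conca_x : conca_generator (x ord_max) (@maxid L).
Hypothesis basis_x : conca_basis le_rn x.
Local Notation T := {malg L[gen G]}.
Local Notation E := (endo T).
Local Notation indeg := (@in_deg L (gen G) (@gdeg L G)).
Local Notation d := (bd G).
Local Notation ep := (eps G).
Local Notation xe := (x ord_max).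
Local Notation red := (reduced_word le_rn).
Local Notation lowh := (@low_head n r).

Variable z : 'I_n.+1 -> E.
Hypothesis cz : forall i, cocycle 1 (z i).
Hypothesis z_eval : forall i j (g u : T), indeg 0 g -> ep g = 1 -> indeg 1 u ->
  d u = x j *: g -> ep (z i u) = (i == j)%:R.

Lemma cocycle_eps_bd m (y : E) t : cocycle m y -> ep (y (d t)) = 0.
Proof.
move=> cy; have := congr1 ep (cocycle_bd t cy); rewrite eps_bd epsZ.
rewrite rmorphXn rmorphN1 => /esym/eqP.
by rewrite mulf_eq0 signr_eq0 => /eqP.
Qed.

(** [z_eval] only concerns chains over x_j g with eps g = 1. Each [w j] differs from a multiple of
    [g0] by a boundary d s_j, so up to a boundary [u] is a combination of chains over the x_j g0 and
    of the x_j s_j, and the latter pair to zero. *)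
Lemma eps_eval1 i u (w : 'I_n.+1 -> T) : indeg 1 u -> (forall j, indeg 0 (w j)) ->
  d u = \sum_j x j *: w j -> ep (z i u) = ep (w i).
Proof.
move=> iu iw duE; have [g0 ig0 eg0] := eps_surj G 1.
have Hu j : exists uj, indeg 1 uj /\ d uj = x j *: g0.
  have [|||uj] := @max_cycle _ G 0 (x j *: g0).
  - exact/maxid_scale/(conca_mem basis_x).
  - exact: in_degZ ig0.
  - by rewrite bdZ in_deg0_bd // scaler0.
  by exists uj.
have [v vP] := choice Hu.
pose c j := lift_res (ep (w j)).
have Hs j : exists sj, indeg 1 sj /\ d sj = w j - c j *: g0.
  have iwj : indeg 0 (w j - c j *: g0) by apply: in_degB => //; exact: in_degZ.
  have /(eps_exact iwj)[s is' sE] : ep (w j - c j *: g0) = 0.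
    by rewrite linearB /= epsZ lift_resK eg0 mulr1 subrr.
  by exists s.
have [s sP] := choice Hs.
pose u' := \sum_j (c j *: v j + x j *: s j).
have iu' : indeg 1 (u - u').
  apply: in_degB => //; apply: in_deg_sum => j _.
  by apply: in_degD; apply: in_degZ; [case: (vP j) | case: (sP j)].
have du' : d (u - u') = 0.
  rewrite bdB duE bd_sum -sumrB big1 // => j _.
  rewrite bdD !bdZ; have [_ ->] := vP j; have [_ ->] := sP j.
  by rewrite scalerBr !scalerA mulrC addrCA subrr addr0 subrr.
have [q _ qE] := bd_exact iu' du'.
have : ep (z i (u - u')) = 0 by rewrite -qE (cocycle_eps_bd _ (cz i)).
rewrite endo_raddfB linearB => /eqP; rewrite subr_eq0 => /eqP ->.
rewrite endo_raddf_sum linear_sum (bigD1 i) //= big1 ?addr0 => [|j ji].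
  rewrite endo_raddfD linearD !endo_linearZ /= !epsZ lift_resK.
  have [iv vE] := vP i; rewrite (z_eval _ ig0 eg0 iv vE) eqxx mulr1.
  by rewrite [res (x i)](conca_mem basis_x) mul0r addr0.
rewrite endo_raddfD linearD !endo_linearZ /= !epsZ.
have [iv vE] := vP j; rewrite (z_eval _ ig0 eg0 iv vE) eq_sym (negPf ji) mulr0.
by rewrite [res (x j)](conca_mem basis_x) mul0r addr0.
Qed.

(** Prepending the letter [i] to a cocycle amounts to replacing [u] by the component [v i] of its
    boundary; the sign comes from moving [y] past [d]. All recursions on words below go through this
    formula. *)
Lemma eps_pairing m (y : E) i u (v : 'I_n.+1 -> T) : cocycle m y ->
  indeg m.+1 u -> (forall j, indeg m (v j)) -> d u = \sum_j x j *: v j ->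
  ep (z i (y u)) = (-1) ^+ m * ep (y (v i)).
Proof.
move=> cy iu iv duE; have [yd _] := cy.
rewrite (@eps_eval1 i _ (fun j => (-1) ^+ m *: y (v j))).
- by rewrite epsZ rmorphXn rmorphN1.
- by apply: (in_deg_hom yd iu); lia.
- by move=> j; apply: in_degZ; apply: (in_deg_hom yd (iv j)); lia.
rewrite (cocycle_bd _ cy) duE endo_raddf_sum scaler_sumr.
by apply: eq_bigr => j _; rewrite endo_linearZ !scalerA mulrC.
Qed.

Definition word_endo (w : word n.+1) : E := \prod_(i <- w) z i.

Lemma word_endo_cons i w : word_endo (i :: w) = z i * word_endo w.
Proof. exact: big_cons. Qed.

Lemma cocycle_word w : cocycle (size w) (word_endo w).
Proof.
elim: w => [|i w IH]; first by rewrite /word_endo big_nil; exact: cocycle1.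
by rewrite word_endo_cons -[size _]add1n; apply: cocycleM.
Qed.

Definition in_max_bd i u := exists2 q, indeg i.+1 q & in_max (u - d q).

Lemma in_max_bdD i u v : in_max_bd i u -> in_max_bd i v -> in_max_bd i (u + v).
Proof.
move=> [p ip up] [q iq vq]; exists (p + q); first exact: in_degD.
by rewrite bdD opprD addrACA; exact: in_maxD.
Qed.

Lemma in_max_bdW i u : in_max u -> in_max_bd i u.
Proof. by move=> mu; exists 0; [exact: in_deg0 | rewrite bd0 subr0]. Qed.

Lemma eps_in_max_bd m (y : E) u : cocycle m y -> in_max_bd m u -> ep (y u) = 0.
Proof.
move=> cy [q _ mq]; rewrite -[u](subrK (d q)) endo_raddfD linearD /=.
by rewrite (cocycle_eps_bd _ cy) eps_in_max ?addr0 //; exact: in_max_endo.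
Qed.

(** [conca_cycle] replaces x_e w by x_e d v. Then u - x_e v is a cycle, hence a boundary, and x_e v
    lies in m G. *)
Lemma in_max_bd_of_sq i u w : indeg i.+1 u -> indeg i w -> in_max w ->
  d u = xe *: w -> in_max_bd i.+1 u.
Proof.
move=> iu iw mw duE.
have [|v iv vE] := conca_cycle conca_x basis_x iw mw.
  by rewrite -bdZ -duE bd_bd.
have iuv : indeg i.+1 (u - xe *: v) by apply: in_degB => //; exact: in_degZ.
have [|q iq qE] := bd_exact iuv; first by rewrite bdB bdZ vE duE subrr.
exists q => //; rewrite qE opprB addrCA subrr addr0.
exact/maxid_scale/(conca_mem basis_x).
Qed.

(* Up to [m G] and boundaries, the chains [u] with [d u] in [m G] represent
   [Tor_i(k, k)]; pairing them with the products of the [xi_i] by [eps], the [U w]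
   for reduced [w] form the dual basis.  The last clause is the recursion
   [d (U (i w)) = x_i U w] up to sign and a correction in [x_e G]. *)
Definition dual_word (U : word n.+1 -> T) (w : word n.+1) :=
  [/\ indeg (size w) (U w), in_max (d (U w)),
      ~~ lowh w -> xe *: d (U w) = 0,
      forall w', red w' -> size w' = size w ->
        ep (word_endo w' (U w)) = (w' == w)%:R &
      forall i w', w = i :: w' -> exists s,
        d (U w) = (-1) ^+ size w' *: (x i *: U w' - xe *: s)].

(** The second clause makes the pairing perfect: chains invisible to the reduced words are zero in
    Tor_m. The first covers all lengths up to [m], since in the next degree a word of length [m] is
    unfolded into its tail. *)
Definition dual_words m (U : word n.+1 -> T) :=
  (forall w, red w -> (size w <= m)%N -> dual_word U w) /\
  forall u, indeg m u -> in_max (d u) ->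
    (forall w, red w -> size w = m -> ep (word_endo w u) = 0) -> in_max_bd m u.

Lemma dual_words0 : exists U, dual_words 0 U.
Proof.
have [g0 ig0 eg0] := eps_surj G 1; exists (fun=> g0); split.
  move=> [|//] _ _; split=> //.
  - exact: max_bd0.
  - by rewrite in_deg0_bd // scaler0.
  by move=> [|//] _ _; rewrite /word_endo big_nil eg0.
move=> u iu _ /(_ [::] (reduced_nil _) erefl).
rewrite /word_endo big_nil => /(eps_exact iu)[q iq qE].
by exists q => //; rewrite qE subrr; exact: in_max0.
Qed.

(** Up to sign, [u] lies over the cycle x_i U_w - x_e s. If i is e, then w does not start with one
    of the first r letters, so x_e d U_w = 0 and s = 0 works; otherwise [conca_lift] supplies s. The
    words e w' see the coefficient of x_e in d u, so s must pair to zero with each w' that may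
    follow e. *)
Lemma dual_word_extend m U i w : dual_words m U -> red (i :: w) -> size w = m ->
  exists u, [/\ indeg m.+1 u, in_max (d u), ~~ lowh (i :: w) -> xe *: d u = 0,
    forall w', red w' -> size w' = m.+1 -> ep (word_endo w' u) = (w' == i :: w)%:R &
    exists s, d u = (-1) ^+ m *: (x i *: U w - xe *: s)].
Proof.
move=> [UP _] riw wm; have rw := reduced_consW riw.
have [|iU mU lU _ _] := UP w rw; first by rewrite wm.
rewrite wm in iU.
have [s [is' sE s0]] : exists s, [/\ indeg m s, x i *: d (U w) = xe *: d s &
    forall w', red w' -> size w' = m -> ~~ lowh w' -> ep (word_endo w' s) = 0].
  have [ie|ie] := eqVneq i ord_max.
    exists 0; split; first exact: in_deg0.
      rewrite ie bd0 scaler0 lU //; move: riw.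
      by rewrite reduced_cons ie eqxx => /andP[].
    by move=> *; rewrite endo_raddf0 linear0.
  have [s0 is0 sE] := conca_lift conca_x basis_x iU mU (conca_mem basis_x i).
  pose P (t : m.-tuple 'I_n.+1) := red t && ~~ lowh t.
  have PU (t : m.-tuple 'I_n.+1) : P t -> dual_word U t.
    by move=> /andP[rt _]; apply: UP; rewrite ?size_tuple.
  (* The subtracted chains remove these pairings without changing x_e d s, because x_e d (U t) = 0
     when [t] does not start low. *)
  exists (s0 - \sum_(t | P t) lift_res (ep (word_endo t s0)) *: U t); split.
  - apply: in_degB => //; apply: in_deg_sum => t /PU[it _ _ _ _].
    by apply: in_degZ; rewrite size_tuple in it.
  - rewrite bdB scalerBr bd_sum scaler_sumr big1 ?subr0 // => t Pt.
    have [_ _ lt _ _] := PU t Pt; rewrite bdZ scalerA mulrC -scalerA lt ?scaler0 //.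
    by case/andP: Pt.
  move=> w' rw' wm' lw'; rewrite endo_raddfB linearB endo_raddf_sum linear_sum /=.
  have Pt' : P (tcast wm' (in_tuple w')) by rewrite /P val_tcast rw'.
  rewrite (bigD1 _ Pt') /= big1 ?addr0.
    rewrite endo_linearZ epsZ lift_resK val_tcast /=.
    have [_ _ _ H _] := UP w' rw' (eq_leq wm').
    by rewrite H // eqxx mulr1 subrr.
  move=> t /andP[Pt tw]; have [_ _ _ H _] := PU t Pt.
  rewrite endo_linearZ epsZ H ?size_tuple //; case: eqVneq => [wt|_]; last by rewrite mulr0.
  by case/eqP: tw; apply: val_inj; rewrite /= val_tcast /= wt.
have [|||u iu uE] := @max_cycle _ G m (x i *: U w - xe *: s).
- by apply: in_maxB; apply: maxid_scale; exact: conca_mem basis_x _.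
- by apply: in_degB; apply: in_degZ.
- by rewrite bdB !bdZ sE subrr.
(* This sign cancels the one in [eps_pairing]. *)
have duE : d ((-1) ^+ m *: u) = (-1) ^+ m *: (x i *: U w - xe *: s).
  by rewrite bdZ uE.
exists ((-1) ^+ m *: u); split.
- exact: in_degZ.
- rewrite duE; apply: in_maxZ.
  by apply: in_maxB; apply: maxid_scale; exact: conca_mem basis_x _.
- rewrite /= -leqNgt => ri; rewrite duE scalerA mulrC -scalerA scalerBr !scalerA.
  rewrite (conca_sqr conca_x) mulrC (conca_annih basis_x) //.
  by rewrite !scale0r subr0 scaler0.
- move=> [//|j w'] rw' [wm']; rewrite word_endo_cons endoM.
  pose v j := (-1) ^+ m *: ((i == j)%:R *: U w - (j == ord_max)%:R *: s).
  rewrite (@eps_pairing m _ j _ v).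
  + rewrite /v endo_linearZ epsZ rmorphXn rmorphN1 mulrA -expr2 sqrr_sign mul1r.
    rewrite endo_raddfB linearB !endo_linearZ /= !epsZ !rmorph_nat eqseq_cons.
    have rw'' := reduced_consW rw'.
    have [_ _ _ UE _] := UP w rw (eq_leq wm).
    rewrite UE //; last by rewrite wm' wm.
    rewrite -natrM mulnb eq_sym; case: (eqVneq j ord_max) => [je|_]; last first.
      by rewrite mul0r subr0.
    rewrite s0 ?mulr0 ?subr0 //; move: rw'.
    by rewrite reduced_cons je eqxx => /andP[].
  + by rewrite -wm'; exact: cocycle_word.
  + exact: in_degZ.
  + by move=> k; apply: in_degZ; apply: in_degB; apply: in_degZ.
  rewrite duE /v; under eq_bigr => k _ do rewrite scalerA mulrC -scalerA.
  rewrite -scaler_sumr; congr (_ *: _).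
  under eq_bigr => k _ do rewrite scalerBr !scalerA ![x k * _]mulrC -!scalerA.
  rewrite sumrB; congr (_ - _).
    rewrite (bigD1 i) //= eqxx scale1r big1 ?addr0 // => k ki.
    by rewrite eq_sym (negPf ki) scale0r.
  rewrite (bigD1 ord_max) //= eqxx scale1r big1 ?addr0 // => k ki.
  by rewrite (negPf ki) scale0r.
by exists s.
Qed.

(** Write d u = sum x_j v_j. For j other than e all reduced words vanish on v_j, which is therefore
    trivial by induction; on v_e only the words that may follow e are known to vanish, and [C]
    collects the rest, a combination of the dual chains of words that start low. Removing boundaries
    leaves d u' = x_e (l + C), and d d u' = 0 forces [C] into m G. *)
Lemma dual_words_perfect m U u : dual_words m U ->
  indeg m.+1 u -> in_max (d u) ->
  (forall w, red w -> size w = m.+1 -> ep (word_endo w u) = 0) ->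
  in_max_bd m.+1 u.
Proof.
move=> [UP UN] iu mu u0.
have [v [iv duE]] := in_max_gen basis_x mu (in_degS_bd iu).
have mv : forall j, in_max (d (v j)).
  apply: (in_max_free basis_x); have := bd_bd u; rewrite duE bd_sum => E0.
  by rewrite -[RHS]E0; apply: eq_bigr => j _; rewrite bdZ.
have v0 j w : red (j :: w) -> size w = m -> ep (word_endo w (v j)) = 0.
  move=> rjw wm; have := u0 _ rjw (congr1 S wm).
  rewrite word_endo_cons endoM (eps_pairing j _ iu iv duE); last first.
    by rewrite -wm; exact: cocycle_word.
  by move=> /eqP; rewrite mulf_eq0 signr_eq0 => /eqP.
have [C [iC CE Cv]] : exists C, [/\ indeg m C,
    forall mu, indeg m mu -> in_max mu -> xe *: d (mu + C) = 0 -> in_max C &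
    in_max_bd m (v ord_max - C)].
  case: m UP UN iu u0 iv v0 => [|m] UP UN iu u0 iv v0.
    (* Words that start low are nonempty, so nothing has to be collected in degree 0. *)
    exists 0; split=> [||]; [exact: in_deg0 | by move=> *; exact: in_max0 |].
    rewrite subr0; apply: UN => // w rw /eqP/nilP wn.
    by apply: v0; rewrite wn // reduced_cons reduced_nil andbF.
  pose tw (h : 'I_r) (t : m.-tuple 'I_n.+1) : word n.+1 :=
    Defs.sub_ord le_rn h :: t.
  have ltn (h : 'I_r) : (Defs.sub_ord le_rn h < n)%N.
    exact: leq_trans (ltn_ord h) le_rn.
  have PU h (t : m.-tuple 'I_n.+1) : red t -> dual_word U (tw h t).
    by move=> rt; apply: UP; [rewrite reduced_cons_low | rewrite /= size_tuple].
  pose c h t := lift_res (ep (word_endo (tw h t) (v ord_max))).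
  pose C := \sum_h \sum_(t | red (t : m.-tuple _)) c h t *: U (tw h t).
  have iC : indeg m.+1 C.
    apply: in_deg_sum => h _; apply: in_deg_sum => t rt; apply: in_degZ.
    by have [it _ _ _ _] := PU h t rt; rewrite /= size_tuple in it.
  exists C; split=> // [y iy my E0|].
    have [l [il lE]] := in_max_gen basis_x my iy.
    (* Multiplied by x_e, the boundary of U_(h t) becomes x_h x_e U_t up to sign, so the coefficient
       of each x_h x_e lies in m G. Evaluating the word [t] on it kills the boundary d l_h and
       isolates [c h t]. *)
    have lh : forall h, in_max (d (l (Defs.sub_ord le_rn h)) +
        (-1) ^+ m *: \sum_(t | red (t : m.-tuple _)) c h t *: U t).
      apply: (in_max_free2 basis_x); rewrite -[RHS]E0.
      under eq_bigr => h _ do rewrite scalerDr.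
      rewrite big_split /= bdD scalerDr; congr (_ + _).
        rewrite -(conca_scale_sum basis_x (fun j => d (l j))) lE bd_sum.
        by congr (_ *: _); apply: eq_bigr => j _; rewrite bdZ.
      rewrite bd_sum scaler_sumr; apply: eq_bigr => h _.
      rewrite bd_sum scalerA !scaler_sumr; apply: eq_bigr => t rt.
      have [_ _ _ _ /(_ _ _ erefl)[s sE]] := PU h t rt.
      rewrite bdZ sE !scalerA size_tuple scalerBr !scalerA.
      rewrite [X in _ - X *: _](_ : _ = 0) ?scale0r ?subr0; last first.
        by rewrite mulrC !mulrA (conca_sqr conca_x) !mul0r.
      by congr (_ *: _); ring.
    apply: in_max_sum => h _; apply: in_max_sum => t rt; apply: maxid_scale.
    have ct := cocycle_word t; rewrite size_tuple in ct.
    have := eps_in_max (in_max_endo (word_endo t) (lh h)).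
    rewrite endo_raddfD linearD /= (cocycle_eps_bd _ ct) add0r.
    rewrite endo_linearZ epsZ => /eqP; rewrite mulf_eq0 rmorphXn rmorphN1 signr_eq0 /=.
    rewrite endo_raddf_sum linear_sum (bigD1 t) //= big1 ?addr0.
      rewrite endo_linearZ epsZ; have [|_ _ _ UE _] := UP t rt; first by rewrite size_tuple.
      by rewrite UE // eqxx mulr1 => /eqP.
    move=> t' /andP[rt' tt']; have [|_ _ _ H _] := UP t' rt'.
      by rewrite size_tuple.
    rewrite endo_linearZ epsZ H ?size_tuple //.
    by rewrite val_eqE eq_sym (negPf tt') mulr0.
  apply: UN; first exact: in_degB.
    rewrite bdB; apply: in_maxB => //; rewrite bd_sum; apply: in_max_sum => h _.
    rewrite bd_sum; apply: in_max_sum => t rt; rewrite bdZ; apply: in_maxZ.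
    by have [] := PU h t rt.
  move=> w rw wm; rewrite endo_raddfB linearB endo_raddf_sum linear_sum /=.
  case: w => [//|i w] in rw wm *; case: wm => wm.
  have Ezero h (t : m.-tuple 'I_n.+1) : red t -> (i :: w != tw h t) ->
      ep (word_endo (i :: w) (c h t *: U (tw h t))) = 0.
    move=> rt ne; have [_ _ _ H _] := PU h t rt.
    by rewrite endo_linearZ epsZ H ?(negPf ne) ?mulr0 //= size_tuple wm.
  have [lt_ir|ri] := ltnP i r; last first.
    rewrite v0 //; last first.
    - by rewrite /= wm.
    - by rewrite reduced_cons rw /= ltnNge ri andbF.
    rewrite sub0r big1 ?oppr0 // => h _; rewrite endo_raddf_sum linear_sum big1 // => t rt.
    apply: Ezero => //; apply/eqP => -[ih _]; move: ri.
    by rewrite ih leqNgt /= ltn_ord.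
  have iE : Defs.sub_ord le_rn (Ordinal lt_ir) = i by apply: val_inj.
  have twE : tw (Ordinal lt_ir) (tcast wm (in_tuple w)) = i :: w.
    by rewrite /tw iE val_tcast.
  rewrite (bigD1 (Ordinal lt_ir)) //= [X in _ - (_ + X)]big1 => [|h hi]; last first.
    rewrite endo_raddf_sum linear_sum big1 // => t rt; apply: Ezero => //.
    apply: contra hi => /eqP[ih _]; apply/eqP/val_inj.
    by rewrite /= ih.
  have rt : red (tcast wm (in_tuple w)) by rewrite val_tcast; exact: reduced_consW rw.
  rewrite addr0 endo_raddf_sum linear_sum (bigD1 _ rt) /= big1 => [|t /andP[rt' tt']].
    rewrite addr0 endo_linearZ epsZ /c lift_resK twE.
    have [|_ _ _ UE _] := UP _ rw; first by rewrite /= wm.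
    by rewrite UE // eqxx mulr1 subrr.
  apply: Ezero => //; rewrite -twE; apply: contra tt' => /eqP[/val_inj tt'].
  by rewrite tt'.
have vB j : exists q, indeg m.+1 q /\
    in_max (v j - (j == ord_max)%:R *: C - d q).
  suff [q iq mq] : in_max_bd m (v j - (j == ord_max)%:R *: C) by exists q.
  case: (eqVneq j ord_max) => [->|je]; first by rewrite scale1r.
  rewrite scale0r subr0; apply: UN => // w rw wm; apply: v0 => //.
  by rewrite reduced_cons rw (negPf je).
have [q qP] := choice vB.
have Hmu j : exists mu, [/\ in_max mu, indeg m mu &
    x j *: (v j - (j == ord_max)%:R *: C - d (q j)) = xe *: mu].
  have [iq mq] := qP j.
  apply: (in_max_prod conca_x (conca_mem basis_x j) mq).
  by apply: in_degB; [apply: in_degB => //; exact: in_degZ | exact: in_degS_bd].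
have [l lP] := choice Hmu.
(* The subtracted chain lies in m G, and it turns the boundary into a multiple of x_e. *)
pose u' := u - \sum_j x j *: q j.
have du'E : d u' = xe *: (\sum_j l j + C).
  rewrite /u' bdB duE bd_sum -sumrB scalerDr scaler_sumr.
  have -> : xe *: C = \sum_j x j *: ((j == ord_max)%:R *: C).
    rewrite (bigD1 ord_max) //= eqxx scale1r big1 ?addr0 // => j /negPf ->.
    by rewrite scale0r scaler0.
  rewrite -big_split; apply: eq_bigr => j _ /=; rewrite bdZ.
  by have [_ _ <-] := lP j; rewrite -scalerBr -scalerDr addrAC subrK.
have il : indeg m (\sum_j l j) by apply: in_deg_sum => j _; case: (lP j).
have ml : in_max (\sum_j l j) by apply: in_max_sum => j _; case: (lP j).
have mC : in_max C by apply: (CE _ il ml); rewrite -bdZ -du'E bd_bd.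
have iq : indeg m.+1 (\sum_j x j *: q j).
  by apply: in_deg_sum => j _; apply: in_degZ; case: (qP j).
rewrite -[u](subrK (\sum_j x j *: q j)); apply: in_max_bdD.
  apply: (in_max_bd_of_sq _ _ _ du'E); first exact: in_degB.
    exact: in_degD.
  exact: in_maxD.
apply: in_max_bdW; apply: in_max_sum => j _; apply: maxid_scale.
exact: conca_mem basis_x j.
Qed.

Lemma dual_words_ex m : exists U, dual_words m U.
Proof.
elim: m => [|m [U DU]]; first exact: dual_words0.
have Hex (w : word n.+1) : exists u, red w -> size w = m.+1 -> [/\ indeg m.+1 u,
    in_max (d u), ~~ lowh w -> xe *: d u = 0,
    forall w', red w' -> size w' = m.+1 -> ep (word_endo w' u) = (w' == w)%:R &
    forall i w', w = i :: w' -> exists s, d u = (-1) ^+ m *: (x i *: U w' - xe *: s)].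
  case: w => [|i w]; first by exists 0.
  have [rw|/negP nrw] := boolP (red (i :: w)); last by exists 0.
  have [wm|wm] := eqVneq (size w) m; last by exists 0 => _ [] wm'; rewrite wm' eqxx in wm.
  have [u [u1 u2 u3 u4 u5]] := dual_word_extend DU rw wm.
  by exists u => _ _; split=> // i' w' [<- <-].
have [V VP] := choice Hex.
exists (fun w => if size w == m.+1 then V w else U w); split; last first.
  by move=> u iu mu u0; exact: dual_words_perfect DU iu mu u0.
move=> w rw; rewrite leq_eqVlt => /predU1P[wm|lt_wm].
  have [u1 u2 u3 u4 u5] := VP w rw wm; rewrite /dual_word wm eqxx.
  split=> // i w' wE; have [s sE] := u5 i w' wE; exists s.
  have -> : size w' = m by move: wm; rewrite wE => -[].
  by rewrite ltn_eqF // sE.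
have [U1 _] := DU; have [u1 u2 u3 u4 u5] := U1 w rw lt_wm.
rewrite /dual_word (ltn_eqF lt_wm); split=> // i w' wE.
have [s sE] := u5 i w' wE; exists s; rewrite ltn_eqF //.
by move: lt_wm; rewrite wE /= => /ltnW.
Qed.
End DualWords.

(** * Words in the Ext algebra *)

Section PairSums.
Variables (V : nmodType) (n : nat).

Lemma big_pair_sym (F : 'I_n.+1 -> 'I_n.+1 -> V) :
  \sum_(i < n.+1 | (i < n)%N) \sum_(j < n.+1 | (j < n)%N) F i j =
  \sum_(i < n.+1 | (i < n)%N) \sum_(j < n.+1 | (i < j < n)%N) (F i j + F j i) +
  \sum_(i < n.+1 | (i < n)%N) F i i.
Proof.
under [X in _ = X + _]eq_bigr => i _ do rewrite big_split.
rewrite big_split /= [X in _ = _ + X + _](exchange_big_dep (fun i : 'I_n.+1 => (i < n)%N)) /=; last first.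
  by move=> i j _ /andP[].
rewrite -addrA -!big_split; apply: eq_bigr => i lt_in /=.
rewrite (bigID (fun j : 'I_n.+1 => (i < j)%N)) /=; congr (_ + _).
  by apply: eq_bigl => j; rewrite andbC.
rewrite (bigD1 i) /= ?ltnn ?lt_in // addrC; congr (_ + _).
apply: eq_bigl => j; rewrite -leqNgt andbT -val_eqE /= -andbA; congr (_ && _).
by rewrite andbC ltn_neqAle.
Qed.

Lemma big_pair_max (F : 'I_n.+1 -> 'I_n.+1 -> V) :
  \sum_i \sum_j F i j = \sum_(i < n.+1 | (i < n)%N) F i ord_max +
    \sum_(i < n.+1 | (i < n)%N) F ord_max i + F ord_max ord_max +
    \sum_(i < n.+1 | (i < n)%N) \sum_(j < n.+1 | (j < n)%N) F i j.
Proof.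
have neE (i : 'I_n.+1) : (i != ord_max) = (i < n)%N.
  by rewrite -val_eqE /= ltn_neqAle -ltnS ltn_ord andbT.
have sumE (H : 'I_n.+1 -> V) : \sum_i H i = H ord_max + \sum_(i < n.+1 | (i < n)%N) H i.
  by rewrite (bigD1 ord_max) //=; congr (_ + _); apply: eq_bigl => i; rewrite neE.
rewrite sumE; under [X in _ + X]eq_bigr => i _ do rewrite sumE.
rewrite sumE big_split /= addrA; congr (_ + _).
by rewrite -addrA addrC; congr (_ + _); exact: addrC.
Qed.
End PairSums.

Section ExtBasis.
Variables (L : localRing) (G : free_resolution L).
Variables (n r : nat) (le_rn : (r <= n)%N) (x : 'I_n.+1 -> L).
Hypothesis conca_x : conca_generator (x ord_max) (@maxid L).
Hypothesis basis_x : conca_basis le_rn x.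
Local Notation T := {malg L[gen G]}.
Local Notation E := (endo T).
Local Notation indeg := (@in_deg L (gen G) (@gdeg L G)).
Local Notation d := (bd G).
Local Notation ep := (eps G).
Local Notation xe := (x ord_max).
Local Notation xh h := (x (Defs.sub_ord le_rn h)).
Local Notation red := (reduced_word le_rn).

Local Notation cval := (@cocycle_val L G).

Lemma cocycle_valD (y y' : cocycles G) : cval (y + y') = cval y + cval y'.
Proof. exact: (raddfD (val : cocycles G -> E)). Qed.
Lemma cocycle_valB (y y' : cocycles G) : cval (y - y') = cval y - cval y'.
Proof. exact: (raddfB (val : cocycles G -> E)). Qed.
Lemma cocycle_valM (y y' : cocycles G) : cval (y * y') = cval y * cval y'.
Proof. exact: (rmorphM (val : cocycles G -> E)). Qed.
Lemma cocycle_val_sum (I : Type) (s : seq I) (P : pred I) (F : I -> cocycles G) :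
  cval (\sum_(i <- s | P i) F i) = \sum_(i <- s | P i) cval (F i).
Proof. exact: (raddf_sum (val : cocycles G -> E)). Qed.
Lemma cocycle_val_prod (I : Type) (s : seq I) (F : I -> cocycles G) :
  cval (\prod_(i <- s) F i) = \prod_(i <- s) cval (F i).
Proof. exact: (rmorph_prod (val : cocycles G -> E)). Qed.

Lemma cocycleDE (y y' : cocycles G) u : cval (y + y') u = cval y u + cval y' u.
Proof. by rewrite cocycle_valD. Qed.
Lemma cocycleBE (y y' : cocycles G) u : cval (y - y') u = cval y u - cval y' u.
Proof. by rewrite cocycle_valB. Qed.
Lemma cocycleME (y y' : cocycles G) u : cval (y * y') u = cval y (cval y' u).
Proof. by rewrite cocycle_valM. Qed.
Lemma scalar_mapE c u : cval (scalar_map G c) u = c *: u.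
Proof. by []. Qed.

Lemma eps_coboundary m (y : E) u : coboundary m y -> in_max (d u) -> ep (y u) = 0.
Proof.
move=> [h _ ->] mu; rewrite /hom_diff endoD endoN endoZ !endoM linearB /=.
rewrite eps_bd sub0r epsZ [ep (h _)]eps_in_max ?mulr0 ?oppr0 //.
exact: in_max_endo.
Qed.

Lemma eps_coboundaries (y : cocycles G) u : coboundaries y -> in_max (d u) ->
  ep ((y : E) u) = 0.
Proof.
rewrite /coboundaries => by_ mu.
elim: (val y) / by_ => [|m v w bv _ IH]; first by rewrite linear0.
by rewrite endoD linearD /= IH (eps_coboundary bv mu) addr0.
Qed.

Lemma Ext_class_eq (y y' : cocycles G) :
  Ext_class y = Ext_class y' <-> coboundaries (y - y').
Proof. exact: class2_eq. Qed.

Lemma eps_Ext_class (y y' : cocycles G) u : Ext_class y = Ext_class y' ->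
  in_max (d u) -> ep ((y : E) u) = ep ((y' : E) u).
Proof.
move=> /Ext_class_eq /eps_coboundaries H /H.
by rewrite cocycleBE linearB => /eqP; rewrite subr_eq0 => /eqP.
Qed.

Lemma Ext_class_at0 : Ext_class (0 : cocycles G) = 0.
Proof. exact: (raddf0 (@class2 _ (coboundary_ideal G))). Qed.
Lemma Ext_class0 m (y : cocycles G) : cocycle m y ->
  (forall u, indeg m u -> in_max (d u) -> ep ((y : E) u) = 0) -> Ext_class y = 0.
Proof.
move=> cy y0; rewrite -Ext_class_at0; apply/Ext_class_eq; rewrite subr0.
by apply: (sum_of_incl (i := m)); exact: coboundary_eps.
Qed.

Lemma Ext_classD (y y' : cocycles G) : Ext_class (y + y') = Ext_class y + Ext_class y'.
Proof. exact: (raddfD (@class2 _ (coboundary_ideal G))). Qed.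
Lemma Ext_classB (y y' : cocycles G) : Ext_class (y - y') = Ext_class y - Ext_class y'.
Proof. exact: (raddfB (@class2 _ (coboundary_ideal G))). Qed.
Lemma Ext_classM (y y' : cocycles G) : Ext_class (y * y') = Ext_class y * Ext_class y'.
Proof. exact: (rmorphM (@class2 _ (coboundary_ideal G))). Qed.

Lemma Ext_class_sum (I : Type) (s : seq I) (P : pred I) (F : I -> cocycles G) :
  Ext_class (\sum_(i <- s | P i) F i) = \sum_(i <- s | P i) Ext_class (F i).
Proof. exact: (raddf_sum (@class2 _ (coboundary_ideal G))). Qed.

Lemma Ext_class_prod (I : Type) (s : seq I) (F : I -> cocycles G) :
  Ext_class (\prod_(i <- s) F i) = \prod_(i <- s) Ext_class (F i).
Proof. exact: (rmorph_prod (@class2 _ (coboundary_ideal G))). Qed.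

Variable xi : 'I_n.+1 -> Ext G.
Hypothesis xi_eval : forall i j, Ext1_eval (xi i) (x j) (i == j)%:R.

(** [Ext1_eval] gives a representative for each pair [i], [j]. One of them serves for all [j],
    because the pairing with chains whose boundary lies in m G depends only on the class. *)
Lemma Ext1_cocycles : exists z : 'I_n.+1 -> cocycles G,
  [/\ forall i, cocycle 1 (z i), forall i, xi i = Ext_class (z i) &
      forall i j g u, indeg 0 g -> ep g = 1 -> indeg 1 u -> d u = x j *: g ->
        ep ((z i : E) u) = (i == j)%:R].
Proof.
have [z zP] := choice (fun i => xi_eval i ord0).
exists z; split=> [i|i|i j g u ig eg iu duE]; [by case: (zP i)..|].
have [_ xiE _] := zP i; have [y [cy yE yu]] := xi_eval i j.
rewrite -(yu g u) //; apply: eps_Ext_class; first by rewrite -xiE yE.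
by rewrite duE; exact/maxid_scale/(conca_mem basis_x).
Qed.

Definition Ext_word (w : word n.+1) : Ext G := \prod_(i <- w) xi i.

Lemma Ext_wordP z : (forall i, xi i = Ext_class (z i)) ->
  forall w, Ext_word w = Ext_class (\prod_(i <- w) z i).
Proof. by move=> zE w; rewrite Ext_class_prod; apply: eq_bigr. Qed.

(** The coefficient of [v] at [w] pairs a representative of [v] with the dual chain of [w]. After
    subtraction of the words with these coefficients, a homogeneous class pairs to zero with the
    dual chains; by perfectness these exhaust Tor_m, so the rest is a coboundary. *)
Lemma Ext_word_coef : exists coef : word n.+1 -> Ext G -> residue L,
  [/\ forall w a u v, coef w (a *: u + v) = a * coef w u + coef w v,
      forall w w', red w -> red w' -> coef w (Ext_word w') = (w == w')%:R &
      forall m v, Ext_deg m v ->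
        v = \sum_(t | red (t : m.-tuple 'I_n.+1)) coef t v *: Ext_word t].
Proof.
have [z [cz zE z_eval]] := Ext1_cocycles.
pose ze i := (z i : E).
have [U UP] := choice (dual_words_ex conca_x basis_x (z := ze) cz z_eval).
have [rep repP] := choice (@class2_surj _ (coboundary_ideal G)).
have wordE w : cval (\prod_(i <- w) z i) = word_endo ze w by exact: cocycle_val_prod.
pose coef (w : word n.+1) (v : Ext G) := ep ((rep v : E) (U (size w) w)).
have Uw w : red w -> dual_word le_rn x ze (U (size w)) w.
  by move=> rw; have [+ _] := UP (size w); apply.
have mU w : red w -> in_max (d (U (size w) w)) by move/Uw => [].
have coefE w (y : cocycles G) : red w -> coef w (Ext_class y) = ep ((y : E) (U (size w) w)).
  by move=> rw; apply: eps_Ext_class; [exact: repP | exact: mU].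
(* The value 0 at non-reduced words makes linearity hold for every [w]. *)
exists (fun w v => if red w then coef w v else 0); split=> [w a u v|w w' rw rw'|m v].
- case: ifP => rw; last by rewrite mulr0 addr0.
  have [[y yu] [y' yv]] := (class2_surj u, class2_surj v).
  have -> : u = Ext_class y by []. have -> : v = Ext_class y' by [].
  rewrite -[a]lift_resK Ext_scaleE.
  rewrite -Ext_classD !coefE // cocycleDE cocycleME linearD.
  by rewrite scalar_mapE epsZ lift_resK.
- rewrite rw (Ext_wordP zE) coefE // wordE.
  have [iU _ _ UE _] := Uw w rw; have [ww'|ww'] := eqVneq (size w') (size w).
    by rewrite UE // eq_sym.
  have [hw _] := cocycle_word cz w'.
  have -> : (w == w') = false by apply: contraNF ww' => /eqP ->.
  (* A longer word would lower the degree below 0; a shorter one lands in positive degree, where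
     [eps] vanishes. *)
  have [lt_ww'|le_ww'] := ltnP (size w) (size w').
    by rewrite (hom_deg_lt hw iU) ?linear0 //; lia.
  apply: (@eps_deg _ _ (size w - size w').-1).
  by apply: (in_deg_hom hw iU); move: ww' le_ww'; lia.
move=> [y cy ->].
pose c (t : m.-tuple 'I_n.+1) := lift_res (coef t (Ext_class y)).
have [y' y'E] : exists y', y' = y - \sum_(t | red (t : m.-tuple 'I_n.+1))
    scalar_map G (c t) * \prod_(i <- t) z i by eexists.
have valy' : cval y' = cval y - \sum_(t | red (t : m.-tuple 'I_n.+1)) c t *: word_endo ze t.
  rewrite y'E cocycle_valB cocycle_val_sum; congr (_ - _); apply: eq_bigr => t _.
  by rewrite cocycle_valM /= wordE -endo_scaleAl mul1r.
have cy' : cocycle m y'.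
  rewrite valy'; apply: cocycleB => //.
  elim/big_rec: _ => [|t w _ cw]; first exact: cocycle0.
  rewrite -[w]opprK; apply: cocycleB; last exact: cocycleN.
  by have := cocycle_word cz t; rewrite size_tuple; exact: cocycleZ.
have valy'E u : (y' : E) u = (y : E) u -
    \sum_(t | red (t : m.-tuple 'I_n.+1)) c t *: word_endo ze t u.
  rewrite valy' endoD endoN; congr (_ - _).
  by elim/big_rec2: _ => // t v1 v2 _ <-.
have y'U (t : m.-tuple 'I_n.+1) : red t -> ep ((y' : E) (U m t)) = 0.
  move=> rt; rewrite valy'E linearB linear_sum (bigD1 t) //= big1 => [|t' /andP[rt' tt']].
    have [_ _ _ UE _] := Uw t rt; rewrite size_tuple in UE.
    rewrite addr0 epsZ UE ?size_tuple // eqxx mulr1 lift_resK coefE //.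
    by rewrite size_tuple subrr.
  have [_ _ _ UE _] := Uw t rt; rewrite size_tuple in UE.
  by rewrite epsZ UE ?size_tuple // val_eqE (negPf tt') mulr0.
have : Ext_class y' = 0.
  apply: (Ext_class0 cy') => u iu mu.
  pose u' := u - \sum_(t | red (t : m.-tuple 'I_n.+1))
    lift_res (ep (word_endo ze t u)) *: U m t.
  have UPm t : red (t : m.-tuple 'I_n.+1) -> dual_word le_rn x ze (U m) t.
    by move=> rt; have := Uw t rt; rewrite size_tuple.
  have : in_max_bd m u'.
    have [_ UN] := UP m; apply: UN.
    - apply: in_degB => //; apply: in_deg_sum => t rt; apply: in_degZ.
      by have [+ _ _ _ _] := UPm t rt; rewrite size_tuple.
    - rewrite bdB; apply: in_maxB => //; rewrite bd_sum.
      apply: in_max_sum => t rt; rewrite bdZ; apply: in_maxZ.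
      by have [_ + _ _ _] := UPm t rt.
    move=> w rw wm; have rt : red (tcast wm (in_tuple w)) by rewrite val_tcast.
    rewrite endo_raddfB linearB endo_raddf_sum linear_sum (bigD1 _ rt) /= big1.
      have [_ _ _ UE _] := UPm _ rt; rewrite endo_linearZ epsZ UE ?size_tuple //.
      by rewrite val_tcast /= eqxx mulr1 lift_resK addr0 subrr.
    move=> t /andP[rt' tt']; have [_ _ _ UE _] := UPm _ rt'.
    rewrite endo_linearZ epsZ UE ?size_tuple //.
    case: eqVneq => [wt|_]; last by rewrite mulr0.
    by case/eqP: tt'; apply: val_inj; rewrite /= val_tcast /= wt.
  move/(eps_in_max_bd cy'); rewrite endo_raddfB linearB endo_raddf_sum linear_sum /=.
  rewrite big1 ?subr0 // => t rt.
  by rewrite endo_linearZ epsZ y'U ?mulr0.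
rewrite y'E Ext_classB => /eqP.
rewrite subr_eq0 => /eqP yE; rewrite {1}yE Ext_class_sum.
apply: eq_bigr => t rt; rewrite rt -Ext_scaleE lift_resK.
by rewrite -(Ext_wordP zE).
Qed.

Lemma Ext_word_deg w : Ext_deg (size w) (Ext_word w).
Proof.
have [z [cz zE _]] := Ext1_cocycles.
exists (\prod_(i <- w) z i); last exact: Ext_wordP.
have -> : (\prod_(i <- w) z i : E) = word_endo (fun i => z i : E) w.
  exact: cocycle_val_prod.
exact: cocycle_word.
Qed.

Lemma sum_of_Ext_deg v : sum_of (@Ext_deg L G) v.
Proof.
have [y <-] := class2_surj v; rewrite -/(Ext_class y).
have [f fE] : exists f, val y = f by eexists.
have := cocyclesP y; rewrite fE => cf.
elim: cf y fE => [|m f1 f2 c1 _ IH] y yE.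
  have -> : y = 0 by apply: val_inj.
  rewrite Ext_class_at0; exact: sum_of0.
have cp : cocycles_pred f1 by apply/asboolP; exact: sum_of_incl c1.
have Ep : Ext_deg m (Ext_class (Cocycles cp)) by exists (Cocycles cp).
have -> : Ext_class y = Ext_class (Cocycles cp) + Ext_class (y - Cocycles cp).
  by rewrite -Ext_classD addrC subrK.
apply: (sum_ofD Ep).
by apply: IH; rewrite raddfB /= yE addrC addKr.
Qed.

(** The left side is tested on chains u of degree 2 with boundary in m G. Writing d u = sum x_i v_i
    and d v_i = sum x_j g_ij turns xi_i xi_j into - eps g_ij, and d d u = 0 into sum x_i x_j g_ij =
    0. When the x_i x_j are expanded in the basis of m^2, the coefficient of x_h x_e lies in m G,
    and its augmentation is the relation. *)
Lemma Ext_relation (a : 'I_n.+1 -> 'I_n.+1 -> 'I_r -> residue L) (h : 'I_r) :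
  structure_constants le_rn x a ->
  let xh := xi (Defs.sub_ord le_rn h) in
  (xh * xi ord_max + xi ord_max * xh
  + \sum_(i < n.+1 | (i < n)%N) \sum_(j < n.+1 | (i < j < n)%N)
      a i j h *: (xi i * xi j + xi j * xi i)
  + \sum_(i < n.+1 | (i < n)%N) a i i h *: (xi i * xi i) = 0 :> Ext G).
Proof.
move=> aE /=; have [z [cz zE z_eval]] := Ext1_cocycles.
pose a' i j h := lift_res (a i j h).
pose Z i j : cocycles G := z i * z j.
pose y := Z (Defs.sub_ord le_rn h) ord_max + Z ord_max (Defs.sub_ord le_rn h)
  + \sum_(i < n.+1 | (i < n)%N) \sum_(j < n.+1 | (i < j < n)%N)
      scalar_map G (a' i j h) * (Z i j + Z j i)
  + \sum_(i < n.+1 | (i < n)%N) scalar_map G (a' i i h) * Z i i.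
have xiM i j : xi i * xi j = Ext_class (Z i j).
  by rewrite !zE -Ext_classM.
have -> : xi (Defs.sub_ord le_rn h) * xi ord_max + xi ord_max * xi (Defs.sub_ord le_rn h)
  + \sum_(i < n.+1 | (i < n)%N) \sum_(j < n.+1 | (i < j < n)%N)
      a i j h *: (xi i * xi j + xi j * xi i)
  + \sum_(i < n.+1 | (i < n)%N) a i i h *: (xi i * xi i) = Ext_class y.
  rewrite !Ext_classD !Ext_class_sum !xiM; congr (_ + _ + _).
    apply: eq_bigr => i _; rewrite Ext_class_sum; apply: eq_bigr => j _.
    by rewrite !xiM -Ext_classD -[a i j h]lift_resK Ext_scaleE.
  by apply: eq_bigr => i _; rewrite xiM -[a i i h]lift_resK Ext_scaleE.
have cZ i j : cocycle 2 (Z i j) by rewrite cocycle_valM; exact: (cocycleM (cz i) (cz j)).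
have cD (u v : E) : cocycle 2 u -> cocycle 2 v -> cocycle 2 (u + v).
  by move=> cu cv; rewrite -[v]opprK; apply: cocycleB => //; exact: cocycleN.
have cS (I : finType) (P : pred I) (F : I -> cocycles G) :
    (forall i, P i -> cocycle 2 (F i)) -> cocycle 2 (\sum_(i | P i) F i).
  move=> cF; rewrite cocycle_val_sum.
  elim/big_rec: _ => [|i u Pi cu]; first exact: cocycle0.
  by apply: cD => //; exact: cF.
have cM c u : cocycle 2 (u : cocycles G) -> cocycle 2 (scalar_map G c * u).
  move=> cu; rewrite cocycle_valM.
  by rewrite -endo_scaleAl mul1r; exact: cocycleZ.
have cDz (u v : cocycles G) : cocycle 2 u -> cocycle 2 v -> cocycle 2 (u + v).
  by move=> cu cv; rewrite cocycle_valD; exact: cD.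
apply: (@Ext_class0 2) => [|u iu mu].
  apply: (cDz); last by apply: cS => i _; exact: cM.
  apply: (cDz); first exact: (cDz).
  apply: (cS) => i _; apply: (cS) => j _; apply: cM; exact: cDz.
have [v [iv duE]] := in_max_gen basis_x mu (in_degS_bd iu).
have mv : forall j, in_max (d (v j)).
  apply: (in_max_free basis_x); have := bd_bd u; rewrite duE bd_sum => E0.
  by rewrite -[RHS]E0; apply: eq_bigr => j _; rewrite bdZ.
have [g gP] := choice (fun j => in_max_gen basis_x (mv j) (in_degS_bd (iv j))).
pose c i j := ep (g i j).
have ZE i j : ep ((Z i j : E) u) = - c i j.
  rewrite cocycleME (eps_pairing basis_x cz z_eval i (cz j) iu iv duE).
  have [ig giE] := gP i.
  by rewrite (eps_eval1 basis_x cz z_eval j (iv i) ig giE) expr1 mulN1r.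
pose ev (f : cocycles G) := ep ((f : E) u).
have evD f1 f2 : ev (f1 + f2) = ev f1 + ev f2.
  by rewrite /ev cocycleDE linearD.
have ev0 : ev 0 = 0 by apply: (@addrI _ (ev 0)); rewrite -evD !addr0.
have evS (I : finType) (P : pred I) (F : I -> cocycles G) :
    ev (\sum_(i | P i) F i) = \sum_(i | P i) ev (F i).
  by apply: (big_morph ev _ ev0) => f1 f2; exact: evD.
have evM e f : ev (scalar_map G e * f) = res e * ev f.
  by rewrite /ev cocycleME scalar_mapE epsZ.
rewrite -/(ev y) /y !(evD, evS) /= {1 2}/ev !ZE.
under eq_bigr => i _.
  rewrite evS; under eq_bigr => j _.
    by rewrite evM evD /ev !ZE lift_resK -opprD mulrN; over.
  by rewrite sumrN; over.
rewrite sumrN.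
under [X in _ + X]eq_bigr => i _ do rewrite evM /ev !ZE lift_resK mulrN.
rewrite sumrN -!opprD; apply/eqP; rewrite oppr_eq0; apply/eqP.
(* [a i j] is prescribed only for [i <= j]; [b] is its symmetric extension. *)
pose b (i j : 'I_n.+1) h := if (i <= j)%N then a' i j h else a' j i h.
have bE (i j : 'I_n.+1) : (i < n)%N -> (j < n)%N ->
    x i * x j = \sum_h b i j h * (xh h * xe).
  move=> lt_in lt_jn; rewrite /b; case: leqP => [le_ij|/ltnW le_ji].
    by apply: aE => // h'; exact: lift_resK.
  by rewrite mulrC; apply: aE => // h'; exact: lift_resK.
have key : in_max (g (Defs.sub_ord le_rn h) ord_max + g ord_max (Defs.sub_ord le_rn h) +
    \sum_(i < n.+1 | (i < n)%N) \sum_(j < n.+1 | (j < n)%N) b i j h *: g i j).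
  pose H h := g (Defs.sub_ord le_rn h) ord_max + g ord_max (Defs.sub_ord le_rn h) +
    \sum_(i < n.+1 | (i < n)%N) \sum_(j < n.+1 | (j < n)%N) b i j h *: g i j.
  apply: (in_max_free2 basis_x (w := H)).
  have E0 : \sum_i \sum_j (x i * x j) *: g i j = 0.
    have := bd_bd u; rewrite duE bd_sum => E1; rewrite -[RHS]E1.
    apply: eq_bigr => i _; have [_ giE] := gP i; rewrite bdZ giE scaler_sumr.
    by apply: eq_bigr => j _; rewrite scalerA.
  have maxE (F : 'I_n.+1 -> T) : \sum_(i < n.+1 | (i < n)%N) (x i * xe) *: F i =
      \sum_h (xh h * xe) *: F (Defs.sub_ord le_rn h).
    have -> : \sum_(i < n.+1 | (i < n)%N) (x i * xe) *: F i = \sum_i (x i * xe) *: F i.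
      rewrite [RHS](bigD1 ord_max) //= (conca_sqr conca_x) scale0r add0r.
      by apply: eq_bigl => i; rewrite -val_eqE /= ltn_neqAle -ltnS ltn_ord andbT.
    rewrite (big_sub_ord le_rn) [X in _ + X]big1 ?addr0 // => i ri.
    by rewrite (conca_annih basis_x) // scale0r.
  rewrite -[RHS]E0 big_pair_max (conca_sqr conca_x) scale0r addr0 maxE.
  under [X in _ = _ + X + _]eq_bigr => i _ do rewrite mulrC.
  rewrite (maxE (g ord_max)).
  under eq_bigr => h' _ do rewrite /H 2!scalerDr.
  rewrite !big_split /=; congr (_ + _).
  under [RHS]eq_bigr => i lt_in do
    under eq_bigr => j lt_jn do rewrite bE // scaler_suml.
  under eq_bigr => h' _ do rewrite scaler_sumr.
  rewrite exchange_big /=; apply: eq_bigr => i _.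
  under eq_bigr => h' _ do rewrite scaler_sumr.
  rewrite exchange_big /=; apply: eq_bigr => j _.
  by apply: eq_bigr => h' _; rewrite scalerA mulrC.
have := eps_in_max key; rewrite big_pair_sym !linearD !linear_sum /=.
move=> E1; rewrite -[RHS]E1 -!addrA; congr (_ + (_ + (_ + _))).
  apply: eq_bigr => i lt_in; rewrite linear_sum; apply: eq_bigr => j /andP[lt_ij lt_jn].
  rewrite linearD /= !epsZ /b (ltnW lt_ij) leqNgt lt_ij /= lift_resK.
  by rewrite mulrDr.
by apply: eq_bigr => i _; rewrite epsZ /b leqnn lift_resK.
Qed.
End ExtBasis.

(** * The presentation of the Ext algebra *)

Section LinearCombinations.
Variables (A : pzRingType) (V : lmodType A) (I : choiceType) (b : I -> V).
Implicit Types c : {malg A[I]}.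

Definition lincomb c : V := \sum_(i <- msupp c) c@_i *: b i.

Lemma lincombEw (D : {fset I}) c : (msupp c `<=` D)%fset ->
  lincomb c = \sum_(i <- D) c@_i *: b i.
Proof.
move=> cD; rewrite /lincomb (big_fset_incl _ cD) //= => i _ /mcoeff_outdom ->.
by rewrite scale0r.
Qed.

Lemma lincomb_is_zmod : zmod_morphism lincomb.
Proof.
move=> c c'; set D := (msupp c `|` msupp c')%fset.
rewrite (@lincombEw D c) ?fsubsetUl // (@lincombEw D c') ?fsubsetUr //.
rewrite (@lincombEw D) ?msuppB_le // -sumrB; apply: eq_bigr => i _.
by rewrite mcoeffB scalerBl.
Qed.
HB.instance Definition _ :=
  GRing.isZmodMorphism.Build {malg A[I]} V lincomb lincomb_is_zmod.

Lemma lincombU a i : lincomb << a *g i >> = a *: b i.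
Proof. by rewrite (lincombEw msuppU_le) big_seq_fset1 mcoeffUU. Qed.
End LinearCombinations.

(* Stated for an abstract ring, since products of [freealg] unfold to sums. *)
Lemma quadric_word (K : nzRingType) (A : nzRingType) (sc : K -> A -> A) (n r : nat)
    (le_rn : (r <= n)%N) (a : 'I_n.+1 -> 'I_n.+1 -> 'I_r -> K) (X : 'I_n.+1 -> A)
    (m : word n.+1 -> A) (h : 'I_r) (w : word n.+1) :
    (forall c p q, sc c (p * q) = sc c p * q) ->
    (forall i u, X i * m u = m (i :: u)) ->
  m [:: ord_max, Defs.sub_ord le_rn h & w]
  + (X (Defs.sub_ord le_rn h) * m (ord_max :: w)
   + \sum_(i < n.+1 | (i < n)%N) \sum_(j < n.+1 | (i < j < n)%N)
       sc (a i j h) (m [:: i, j & w] + m [:: j, i & w])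
   + \sum_(i < n.+1 | (i < n)%N) sc (a i i h) (m [:: i, i & w])) =
  (X (Defs.sub_ord le_rn h) * X ord_max + X ord_max * X (Defs.sub_ord le_rn h)
   + \sum_(i < n.+1 | (i < n)%N) \sum_(j < n.+1 | (i < j < n)%N)
       sc (a i j h) (X i * X j + X j * X i)
   + \sum_(i < n.+1 | (i < n)%N) sc (a i i h) (X i ^+ 2)) * m w.
Proof.
move=> scA Xm; rewrite !mulrDl !mulr_suml !addrA; congr (_ + _ + _).
- by rewrite -!mulrA !Xm addrC.
- apply: eq_bigr => i _; rewrite mulr_suml; apply: eq_bigr => j _.
  by rewrite -scA mulrDl -!mulrA !Xm.
- by apply: eq_bigr => i _; rewrite -scA expr2 -mulrA !Xm.
Qed.

Lemma quadric_morph (K A : nzRingType) (B : pzRingType) (scA : K -> A -> A)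
    (scB : K -> B -> B) (ev : A -> B) (n r : nat) (le_rn : (r <= n)%N)
    (a : 'I_n.+1 -> 'I_n.+1 -> 'I_r -> K) (X : 'I_n.+1 -> A) (Y : 'I_n.+1 -> B) (h : 'I_r) :
    ev 0 = 0 -> {morph ev : p q / p + q} -> {morph ev : p q / p * q} ->
    (forall c p, ev (scA c p) = scB c (ev p)) -> (forall i, ev (X i) = Y i) ->
  ev (X (Defs.sub_ord le_rn h) * X ord_max + X ord_max * X (Defs.sub_ord le_rn h)
   + \sum_(i < n.+1 | (i < n)%N) \sum_(j < n.+1 | (i < j < n)%N)
       scA (a i j h) (X i * X j + X j * X i)
   + \sum_(i < n.+1 | (i < n)%N) scA (a i i h) (X i ^+ 2)) =
  Y (Defs.sub_ord le_rn h) * Y ord_max + Y ord_max * Y (Defs.sub_ord le_rn h)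
  + \sum_(i < n.+1 | (i < n)%N) \sum_(j < n.+1 | (i < j < n)%N)
       scB (a i j h) (Y i * Y j + Y j * Y i)
  + \sum_(i < n.+1 | (i < n)%N) scB (a i i h) (Y i * Y i).
Proof.
move=> ev0 evD evM evZ evX; rewrite !evD !evM !evX !(big_morph ev evD ev0).
congr (_ + _ + _).
  apply: eq_bigr => i _; rewrite (big_morph ev evD ev0); apply: eq_bigr => j _.
  by rewrite evZ evD !evM !evX.
by apply: eq_bigr => i _; rewrite evZ expr2 evM !evX.
Qed.

Lemma generated2_mulr (K : nzRingType) e (I : finType) (phi : I -> freealg K e) i p :
  generated2 phi (phi i * p).
Proof. by exists [:: (1, i, p)]; rewrite big_seq1 mul1r. Qed.

(** * Rewriting of words into reduced words *)

Section Rewriting.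
Variables (K : nzRingType) (n r : nat) (le_rn : (r <= n)%N).
Variable (a : 'I_n.+1 -> 'I_n.+1 -> 'I_r -> K).
Local Notation red := (reduced_word le_rn).
Local Notation gen2 := (generated2 (conca_rel le_rn a)).
Local Notation F := (freealg K n.+1).
Local Notation X := (@letter K n.+1).
Local Notation mon w := (<< (w : word n.+1) >> : F).

(** [D] restricts the lengths of the reduced words: [pred1 d] keeps track of the degree, [predT]
    forgets it. *)
Definition red_span (D : pred nat) (p : F) :=
  exists2 q : F, forall w, q@_w != 0 -> red w && D (size w) & gen2 (p - q).

Lemma red_span_congr D p p' : gen2 (p - p') -> red_span D p' -> red_span D p.
Proof.
move=> gp [q qP gq]; exists q => //.
have -> : p - q = (p - p') - (- 1) * (p' - q) by rewrite mulN1r opprK addrA subrK.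
by apply: generated2_B => //; exact: generated2_Ml.
Qed.

Lemma red_span_gen D p : gen2 p -> red_span D p.
Proof. by move=> gp; exists 0 => [w|]; rewrite ?mcoeff0 ?eqxx ?subr0. Qed.

Lemma red_span0 D : red_span D 0.
Proof. by apply: red_span_gen; exact: generated2_0. Qed.

Lemma red_spanB D p p' : red_span D p -> red_span D p' -> red_span D (p - p').
Proof.
move=> [q qP gq] [q' qP' gq']; exists (q - q') => [w|].
  rewrite mcoeffB; have [->|/qP //] := eqVneq q@_w 0.
  by rewrite sub0r oppr_eq0; exact: qP'.
have -> : p - p' - (q - q') = (p - q) - (p' - q').
  by rewrite !opprD !opprK addrACA.
exact: generated2_B.
Qed.

Lemma red_spanD D p p' : red_span D p -> red_span D p' -> red_span D (p + p').
Proof.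
move=> sp sp'; rewrite -[p']opprK; apply: red_spanB => //.
by rewrite -sub0r; apply: red_spanB => //; exact: red_span0.
Qed.

Lemma red_spanZ D c p : red_span D p -> red_span D (c *: p).
Proof.
move=> [q qP gq]; exists (c *: q) => [w|].
  rewrite mcoeffZ => nz; apply: qP.
  by apply: contraNneq nz => ->; rewrite mulr0.
by rewrite -scalerBr -mul_malgC; exact: generated2_Ml.
Qed.

Lemma red_span_sum D (I : Type) (s : seq I) (P : pred I) (p : I -> F) :
  (forall i, P i -> red_span D (p i)) -> red_span D (\sum_(i <- s | P i) p i).
Proof.
move=> sp; elim/big_rec: _ => [|i q Pi sq]; first exact: red_span0.
by apply: red_spanD => //; exact: sp.
Qed.

Lemma malgU_scale c (w : word n.+1) : << c *g w >> = c *: mon w.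
Proof.
apply/malgP => u; rewrite mcoeffZ !mcoeffU; case: eqP => _.
  by rewrite !mulr1n mulr1.
by rewrite !mulr0n mulr0.
Qed.

Lemma letterU i c w : X i * << c *g w >> = c *: mon (i :: w).
Proof. rewrite malgM_def fgmulUU mul1r; exact: malgU_scale. Qed.

Lemma letter_mon i w : X i * mon w = mon (i :: w).
Proof. by rewrite letterU scale1r. Qed.

Lemma red_span_word w : red w -> red_span (pred1 (size w)) (mon w).
Proof.
move=> rw; exists (mon w); last by rewrite subrr; exact: generated2_0.
by move=> u; rewrite mcoeffU; have [<-|_] := eqVneq w u; rewrite ?mulr0n ?eqxx ?rw /=.
Qed.

Lemma red_span_letter i d p :
    (forall w, red w -> size w = d -> red_span (pred1 d.+1) (mon (i :: w))) ->
  red_span (pred1 d) p -> red_span (pred1 d.+1) (X i * p).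
Proof.
move=> H [q qP gq]; apply: (red_span_congr (p' := X i * q)).
  by rewrite -mulrBr; exact: generated2_Ml.
rewrite [q]monalgE mulr_sumr big_seq; apply: red_span_sum => w.
rewrite -mcoeff_neq0 => /qP/andP[rw /eqP wd].
by rewrite letterU; apply: red_spanZ; exact: H.
Qed.

Lemma red_span_low (i : 'I_n.+1) d p : (i < n)%N ->
  red_span (pred1 d) p -> red_span (pred1 d.+1) (X i * p).
Proof.
move=> lt_in; apply: red_span_letter => w rw <-.
by apply: (red_span_word (w := i :: w)); rewrite reduced_cons_low.
Qed.

Lemma conca_rewrite h w : gen2 (mon [:: ord_max, Defs.sub_ord le_rn h & w] -
  - (X (Defs.sub_ord le_rn h) * mon (ord_max :: w)
   + \sum_(i < n.+1 | (i < n)%N) \sum_(j < n.+1 | (i < j < n)%N)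
       a i j h *: (mon [:: i, j & w] + mon [:: j, i & w])
   + \sum_(i < n.+1 | (i < n)%N) a i i h *: mon [:: i, i & w])).
Proof.
rewrite opprK.
rewrite (quadric_word (sc := *:%R) le_rn a h w (@fgscaleAl _ _) letter_mon).
exact: (generated2_mulr (conca_rel le_rn a) h (mon w)).
Qed.

(* The rewriting rule: the relation [conca_rel h] eliminates the subword
   [ord_max; h], at the price of letters [ord_max] strictly further right. *)
Lemma red_span_max d p :
  red_span (pred1 d) p -> red_span (pred1 d.+1) (X ord_max * p).
Proof.
have [k] := ubnP d; elim: k d p => // k IH d p lt_dk.
apply: red_span_letter => w rw wd; have [loww|nlow] := boolP (low_head r w); last first.
  rewrite -wd; apply: (red_span_word (w := ord_max :: w)).
  by rewrite reduced_cons rw (negPf nlow) andbF.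
case: w loww rw wd => [//|j w] lowj rw wd.
have rw' := reduced_consW rw; rewrite /= in wd lowj.
pose h := Ordinal lowj; have jE : Defs.sub_ord le_rn h = j by exact: val_inj.
have lt_jn : (j < n)%N by exact: leq_trans lowj le_rn.
case: d wd lt_dk => // d [wd] lt_dk.
have sw : red_span (pred1 d) (mon w) by rewrite -wd; exact: red_span_word.
rewrite -jE; apply: (red_span_congr (conca_rewrite h w)).
rewrite -sub0r; apply: red_spanB; first exact: red_span0.
have rlow (i l : 'I_n.+1) : (i < n)%N -> (l < n)%N ->
    red_span (pred1 d.+2) (mon [:: i, l & w]).
  move=> lt_in lt_ln; rewrite -wd; apply: (red_span_word (w := [:: i, l & w])).
  by rewrite !reduced_cons_low.
apply: red_spanD; first apply: red_spanD.
- by apply: red_span_low; rewrite ?jE // -letter_mon; exact: IH.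
- apply: red_span_sum => i lt_in; apply: red_span_sum => l /andP[_ lt_ln].
  by apply: red_spanZ; apply: red_spanD; exact: rlow.
- by apply: red_span_sum => i lt_in; apply: red_spanZ; exact: rlow.
Qed.

Lemma red_span_mon w : red_span (pred1 (size w)) (mon w).
Proof.
elim: w => [|i w IH]; first by apply: red_span_word; exact: reduced_nil.
rewrite -letter_mon; have [->|ie] := eqVneq i ord_max; first exact: red_span_max.
apply: red_span_low IH; move: ie; rewrite -val_eqE /= => ie.
by rewrite ltn_neqAle ie -ltnS ltn_ord.
Qed.

Lemma red_span_all p : red_span predT p.
Proof.
rewrite [p]monalgE; apply: red_span_sum => w _; rewrite malgU_scale.
apply: red_spanZ; have [q qP gq] := red_span_mon w; exists q => // u /qP.
by move=> /andP[->].
Qed.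
End Rewriting.

Section Presentation.
Variables (L : localRing) (G : free_resolution L).
Variables (n r : nat) (le_rn : (r <= n)%N) (x : 'I_n.+1 -> L).
Variable (a : 'I_n.+1 -> 'I_n.+1 -> 'I_r -> residue L).
Hypothesis conca_x : conca_generator (x ord_max) (@maxid L).
Hypothesis basis_x : conca_basis le_rn x.
Hypothesis a_str : structure_constants le_rn x a.
Variable xi : 'I_n.+1 -> Ext G.
Hypothesis xi_eval : forall i j, Ext1_eval (xi i) (x j) (i == j)%:R.
Local Notation red := (reduced_word le_rn).
Local Notation K := (residue L).
Local Notation phi := (conca_rel le_rn a).
Local Notation F := (freealg K n.+1).

Definition Ext_eval (p : F) : Ext G := lincomb (Ext_word xi) p.

Lemma Ext_evalB p q : Ext_eval (p - q) = Ext_eval p - Ext_eval q.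
Proof. exact: raddfB. Qed.
Lemma Ext_evalD p q : Ext_eval (p + q) = Ext_eval p + Ext_eval q.
Proof. exact: raddfD. Qed.
Lemma Ext_eval_sum (I : Type) (s : seq I) (P : pred I) (p : I -> F) :
  Ext_eval (\sum_(i <- s | P i) p i) = \sum_(i <- s | P i) Ext_eval (p i).
Proof. exact: raddf_sum. Qed.
Lemma Ext_evalU c w : Ext_eval << c *g w >> = c *: Ext_word xi w.
Proof. exact: lincombU. Qed.

Lemma Ext_word_cat u w : Ext_word xi (u ++ w) = Ext_word xi u * Ext_word xi w.
Proof. exact: big_cat. Qed.

Lemma Ext_evalM p q : Ext_eval (p * q) = Ext_eval p * Ext_eval q.
Proof.
have evE f : Ext_eval f = \sum_(w <- msupp f) f@_w *: Ext_word xi w by [].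
rewrite malgME Ext_eval_sum [in RHS](evE p) mulr_suml.
apply: eq_bigr => u _; rewrite Ext_eval_sum (evE q) mulr_sumr.
apply: eq_bigr => w _.
by rewrite Ext_evalU Ext_word_cat -Ext_scaleAl -Ext_scaleAr scalerA.
Qed.

Lemma Ext_eval1 : Ext_eval 1 = 1.
Proof. by rewrite [1 in LHS]/(<< 1 *g _ >>) Ext_evalU scale1r /Ext_word big_nil. Qed.

Lemma Ext_evalZ c p : Ext_eval (c *: p) = c *: Ext_eval p.
Proof.
rewrite -mul_malgC Ext_evalM Ext_evalU /Ext_word big_nil.
by rewrite -Ext_scaleAl mul1r.
Qed.

Lemma Ext_eval_letter i : Ext_eval (letter _ i) = xi i.
Proof. by rewrite Ext_evalU scale1r /Ext_word big_seq1. Qed.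

Lemma Ext_eval_rel h : Ext_eval (phi h) = 0.
Proof.
rewrite -[RHS](Ext_relation conca_x basis_x xi_eval h a_str).
exact: (@quadric_morph K F (Ext G) (fun c p => c *: p) (fun c v => c *: v) Ext_eval
  _ _ le_rn a (@letter K n.+1) xi h (raddf0 Ext_eval) Ext_evalD Ext_evalM Ext_evalZ
  Ext_eval_letter).
Qed.

Lemma Ext_eval_gen p : generated2 phi p -> Ext_eval p = 0.
Proof.
move=> [s ->]; rewrite Ext_eval_sum big1 // => t _.
by rewrite !Ext_evalM Ext_eval_rel mulr0 mul0r.
Qed.

Lemma Ext_eval_red_inj q : (forall w, q@_w != 0 -> red w) -> Ext_eval q = 0 -> q = 0.
Proof.
move=> rq Eq0; have [coef [coefP coefW _]] := Ext_word_coef conca_x basis_x xi_eval.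
apply/malgP => w; rewrite mcoeff0; apply/eqP; apply: contraT => nz.
have rw := rq w nz.
have coef0 : coef w 0 = 0.
  have := coefP w 1 0 0; rewrite scale1r addr0 mul1r => /esym/eqP.
  by rewrite -subr_eq0 addrK => /eqP.
have /esym/eqP : coef w (Ext_eval q) = q@_w.
  rewrite /Ext_eval /lincomb.
  have -> : coef w (\sum_(i <- msupp q) q@_i *: Ext_word xi i) =
      \sum_(i <- msupp q) q@_i * coef w (Ext_word xi i).
    by elim/big_rec2: _ => // u v1 v2 _ <-; exact: coefP.
  have wq : w \in msupp q by rewrite -mcoeff_neq0.
  rewrite (big_fsetD1 w wq) /= coefW // eqxx mulr1 big1_seq ?addr0 // => u.
  rewrite in_fsetD1 => /andP[_ /andP[uw uq]]; rewrite coefW //.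
    by rewrite eq_sym (negPf uw) mulr0.
  by move: uq; rewrite -mcoeff_neq0 => /rq.
by rewrite Eq0 coef0 (negPf nz).
Qed.

(** Reduction modulo the relations preserves the image, and a combination of reduced words with
    image 0 is itself 0. *)
Lemma Ext_eval_inj p : Ext_eval p = 0 -> generated2 phi p.
Proof.
move=> p0; have [q qP gq] := red_span_all le_rn a p.
suff q0 : q = 0 by rewrite q0 subr0 in gq.
apply: Ext_eval_red_inj => [w /qP/andP[]//|].
by have := Ext_eval_gen gq; rewrite Ext_evalB p0 sub0r => /eqP; rewrite oppr_eq0 => /eqP.
Qed.

Lemma Ext_eval_surj m v : Ext_deg m v -> exists2 p, freealg_deg m p & Ext_eval p = v.
Proof.
move=> vm; have [coef [_ _ coefE]] := Ext_word_coef conca_x basis_x xi_eval.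
exists (\sum_(t | red (t : m.-tuple 'I_n.+1)) << coef t v *g (t : word n.+1) >>).
  move=> w; apply: contra_neqP => wm; rewrite raddf_sum big1 //= => t _.
  rewrite mcoeffU; case: eqVneq => [tw|//]; case: wm.
  by rewrite -tw size_tuple.
rewrite Ext_eval_sum [RHS](coefE _ _ vm); apply: eq_bigr => t _.
exact: Ext_evalU.
Qed.

Lemma Ext_eval_deg m p : freealg_deg m p -> Ext_deg m (Ext_eval p).
Proof.
move=> pm; rewrite /Ext_eval /lincomb.
have ExtD u v : Ext_deg m u -> Ext_deg m v -> Ext_deg m (u + v).
  move=> [y cy ->] [y' cy' ->]; exists (y + y'); last by rewrite Ext_classD.
  by rewrite cocycle_valD -[y' : endo _]opprK; apply: cocycleB => //; exact: cocycleN.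
rewrite big_seq; elim/big_rec: _ => [|w v wp IH].
  by exists 0; [exact: cocycle0 | rewrite Ext_class_at0].
have wm : size w = m by apply: pm; rewrite mcoeff_neq0.
suff Hw : Ext_deg m (p@_w *: Ext_word xi w) by exact: ExtD Hw IH.
have [y cy ->] := Ext_word_deg basis_x xi_eval w.
rewrite -[p@_w]lift_resK Ext_scaleE; eexists; last by [].
by rewrite cocycle_valM -endo_scaleAl mul1r -wm; exact: cocycleZ.
Qed.

Lemma presented_Ext_iso : exists f : {rmorphism presented phi -> Ext G},
  [/\ bijective f, scalable f,
      forall d p, presented_deg d p <-> Ext_deg d (f p) &
      forall i, f (presented_class phi (letter _ i)) = xi i].
Proof.
have [rep repP] := choice (@class2_surj _ (generated_ideal2 phi)).
pose f0 (v : presented phi) : Ext G := Ext_eval (rep v).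
have f0E p : f0 (presented_class phi p) = Ext_eval p.
  apply/eqP; rewrite -subr_eq0 -Ext_evalB; apply/eqP; apply: Ext_eval_gen.
  exact/(class2_eq (generated_ideal2 phi))/repP.
have classP (v : presented phi) : exists p, v = presented_class phi p.
  by exists (rep v); symmetry; exact: repP.
have classB p q : presented_class phi p - presented_class phi q = presented_class phi (p - q).
  by symmetry; exact: (raddfB (@class2 _ (generated_ideal2 phi))).
have classM p q : presented_class phi p * presented_class phi q = presented_class phi (p * q).
  by symmetry; exact: (rmorphM (@class2 _ (generated_ideal2 phi))).
have f0B : zmod_morphism f0.
  move=> u v; have [p ->] := classP u; have [q ->] := classP v.
  by rewrite classB !f0E Ext_evalB.
have f0M : monoid_morphism f0.
  split=> [|u v]; first by rewrite -[1]/(presented_class phi 1) f0E Ext_eval1.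
  have [p ->] := classP u; have [q ->] := classP v.
  by rewrite classM !f0E Ext_evalM.
pose f : {rmorphism presented phi -> Ext G} := HB.pack f0
  (GRing.isZmodMorphism.Build _ _ _ f0B) (GRing.isMonoidMorphism.Build _ _ _ f0M).
have f0inj : injective f0.
  move=> u v; have [p ->] := classP u; have [q ->] := classP v; rewrite !f0E.
  move=> /eqP; rewrite -subr_eq0 -Ext_evalB => /eqP/Ext_eval_inj.
  by move=> pq; apply/(class2_eq (generated_ideal2 phi)).
have f0surj v : exists u, f0 u = v.
  elim: (sum_of_Ext_deg v) => [|m v1 v2 /Ext_eval_surj[p _ <-] _ [u <-]].
    by exists (presented_class phi 0); rewrite f0E; exact: raddf0.
  have [q ->] := classP u; exists (presented_class phi (p + q)).
  by rewrite !f0E Ext_evalD.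
exists f; split=> [|c v|d v|i].
- have [g gP] := choice f0surj; exists g => // u.
  by apply: f0inj; rewrite gP.
- have [p ->] := classP v.
  have -> : c *: presented_class phi p = presented_class phi (c%:MP * p).
    by symmetry; exact: (rmorphM (@class2 _ (generated_ideal2 phi))).
  by rewrite [f _]f0E [f _]f0E mul_malgC Ext_evalZ.
- split=> [[p pd ->]|]; first by rewrite [f _]f0E; exact: Ext_eval_deg.
  move=> /Ext_eval_surj[p pd]; rewrite -f0E => /f0inj <-.
  by exists p.
by rewrite [f _]f0E Ext_eval_letter.
Qed.

Lemma Ext_word_basis :
  is_basis (fun w : {w : word n.+1 | red w} => \prod_(i <- val w) xi i).
Proof.
have [coef [coefP coefW coefE]] := Ext_word_coef conca_x basis_x xi_eval.
set b := fun w => _.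
have ex v : exists c, v = lincomb b c.
  elim: (sum_of_Ext_deg v) => [|m v1 v2 /coefE -> _ [c ->]].
    by exists 0; rewrite raddf0.
  pose c1 := \sum_(t | red (t : m.-tuple 'I_n.+1))
    if insub (t : word n.+1) is Some w then << coef t v1 *g w >> else 0
    : {malg K[{w : word n.+1 | red w}]}.
  exists (c1 + c); rewrite raddfD raddf_sum; congr (_ + _).
  apply: eq_bigr => t rt; rewrite (insubT (fun w : word n.+1 => red w) rt).
  exact: esym (lincombU b (coef t v1) (Sub (t : word n.+1) rt)).
have coef0 w : coef w 0 = 0.
  have := coefP w 1 0 0; rewrite scale1r addr0 mul1r => /esym/eqP.
  by rewrite -subr_eq0 addrK => /eqP.
have coef_comb c w : coef (val w) (lincomb b c) = c@_w.
  rewrite /lincomb.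
  have -> : coef (val w) (\sum_(i <- msupp c) c@_i *: b i) =
      \sum_(i <- msupp c) c@_i * coef (val w) (b i).
    by elim/big_rec2: _ => [|u v1 v2 _ <-]; [exact: coef0 | exact: coefP].
  have bE (i : {w : word n.+1 | red w}) : coef (val w) (b i) = (w == i)%:R.
    by rewrite coefW ?(valP w) ?(valP i).
  case: msuppP => wc.
    rewrite (big_fsetD1 w wc) /= bE eqxx mulr1 big1_seq ?addr0 // => u.
    rewrite in_fsetD1 => /andP[_ /andP[uw _]].
    by rewrite bE eq_sym (negPf uw) mulr0.
  rewrite big1_seq // => u /andP[_ uc]; rewrite bE; case: eqVneq => [wu|_].
    by rewrite wu uc in wc.
  by rewrite mulr0.
move=> v; have [c vE] := ex v; exists c; split=> // c' vE'.
by apply/malgP => w; rewrite -!coef_comb -[lincomb b c]vE -[lincomb b c']vE'.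
Qed.
End Presentation.

(** * Graded modules and kernels *)

Section GradingProjections.
Variables (I : choiceType) (V : zmodType) (P : I -> V -> Prop).
Hypothesis grP : is_grading P.

(** The sum may run over any duplicate-free list containing [s], so decompositions with different
    finite supports can be subtracted over a common list. *)
Definition grading_dec (v : V) (w : I -> V) (s : seq I) :=
  (forall i, P i (w i)) /\
  forall t, uniq t -> {subset s <= t} -> v = \sum_(i <- t) w i.

Lemma grading_dec_homog i v : P i v ->
  grading_dec v (fun j => if j == i then v else 0) [:: i].
Proof.
move=> Pv; have [P0 _ _] := grP; split=> [j|t ut st].
  by case: eqP => [->//|_]; have [] := P0 j.
rewrite -big_mkcond /= -big_filter (_ : [seq j <- t | j == i] = [:: i]) ?big_seq1 //.
by apply: filter_pred1_uniq => //; apply: st; rewrite mem_head.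
Qed.

Lemma grading_decB u v wu wv su sv : grading_dec u wu su -> grading_dec v wv sv ->
  grading_dec (u - v) (fun i => wu i - wv i) (su ++ sv).
Proof.
move=> [Pu Eu] [Pv Ev]; have [P0 _ _] := grP; split=> [i|t ut st].
  by have [_] := P0 i; apply.
rewrite sumrB -Eu -?Ev // => i it; apply: st; rewrite mem_cat it ?orbT //.
Qed.

Lemma grading_dec_uniq v w w' s s' : grading_dec v w s -> grading_dec v w' s' -> w =1 w'.
Proof.
move=> dw dw' i; have [P0 _ Pind] := grP.
have [Pd Ed] := grading_decB dw dw'.
set t := undup (i :: s ++ s').
have ti : i \in t by rewrite mem_undup mem_head.
have st : {subset s ++ s' <= t} by move=> j js; rewrite mem_undup inE js orbT.
have := Ed t (undup_uniq _) st; rewrite subrr => /esym E0.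
by apply/eqP; rewrite -subr_eq0; apply/eqP; exact: (Pind t _ (undup_uniq _) Pd E0 i ti).
Qed.

Lemma grading_dec_ex v : exists w s, grading_dec v w s.
Proof.
have [P0 Psum _] := grP; elim: (Psum v) => [|i u v' Pu _ [w [s dw]]].
  exists (fun=> 0), [::]; split=> [i|t _ _]; first by have [] := P0 i.
  by rewrite big1.
have P00 : grading_dec 0 (fun=> 0) [::].
  by split=> [j|t _ _]; [have [] := P0 j | rewrite big1].
have := grading_decB (grading_dec_homog Pu) (grading_decB P00 dw).
by rewrite sub0r opprK => ?; eexists; eexists; eassumption.
Qed.

Lemma grading_proj : exists p : I -> V -> V, [/\ forall i, zmod_morphism (p i),
  forall i v, P i (p i v), forall i v, P i v -> p i v = v,
  forall i j v, P j v -> j != i -> p i v = 0 &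
  forall v, exists s : seq I, forall t : seq I, uniq t -> {subset s <= t} -> v = \sum_(i <- t) p i v].
Proof.
have [D DP] := choice (fun v => grading_dec_ex v).
exists (fun i v => D v i); split=> [i u v|i v|i v Pv|i j v Pv ji|v].
- have [[su du] [[sv dv] [s ds]]] := (DP u, (DP v, DP (u - v))).
  by rewrite (grading_dec_uniq ds (grading_decB du dv)).
- by have [s []] := DP v.
- have [s ds] := DP v.
  by rewrite (grading_dec_uniq ds (grading_dec_homog Pv)) eqxx.
- have [s ds] := DP v.
  by rewrite (grading_dec_uniq ds (grading_dec_homog Pv)) eq_sym (negPf ji).
by have [s [_ Es]] := DP v; exists s.
Qed.
End GradingProjections.

Section FreeModule.
Variables (A : pzRingType) (I : choiceType).

(* The library's module structure on [{malg A[I]}] needs [1 != 0] in [A]. *)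
Definition free_mod : Type := {malg A[I]}.
HB.instance Definition _ := GRing.Zmodule.on free_mod.
Implicit Types (c : free_mod) (a : A).

Definition free_scale a c : free_mod := [malg i in msupp c => a * c@_i].

Lemma free_scaleE a c i : (free_scale a c)@_i = a * c@_i.
Proof. by rewrite mcoeffE; case: msuppP => // _; rewrite mulr0. Qed.

Fact free_scaleA a a' c : free_scale a (free_scale a' c) = free_scale (a * a') c.
Proof. by apply/malgP => i; rewrite !free_scaleE mulrA. Qed.
Fact free_scale1 : left_id 1 free_scale.
Proof. by move=> c; apply/malgP => i; rewrite free_scaleE mul1r. Qed.
Fact free_scaleDr : right_distributive free_scale +%R.
Proof. by move=> a c c'; apply/malgP => i; rewrite mcoeffD !free_scaleE mcoeffD mulrDr. Qed.
Fact free_scaleDl c : {morph free_scale^~ c : a a' / a + a'}.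
Proof. by move=> a a'; apply/malgP => i; rewrite mcoeffD !free_scaleE mulrDl. Qed.
HB.instance Definition _ := GRing.Zmodule_isLmodule.Build A free_mod
  free_scaleA free_scale1 free_scaleDr free_scaleDl.

Lemma free_coefZ a c i : (a *: c)@_i = a * c@_i.
Proof. exact: free_scaleE. Qed.

Lemma free_modE c : c = \sum_(i <- msupp c) c@_i *: (<< i >> : free_mod).
Proof.
rewrite {1}[c]monalgE; apply: eq_bigr => i _; apply/malgP => j.
by rewrite free_coefZ !mcoeffU; case: eqP; rewrite ?mulr1n ?mulr0n ?mulr1 ?mulr0.
Qed.

Lemma free_mod_basis : is_basis (fun i => << i >> : free_mod).
Proof.
move=> c; exists c; split; first exact: free_modE.
move=> c' ->; apply/malgP => i; rewrite raddf_sum /=.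
have H j : (c'@_j *: (<< j >> : free_mod))@_i = c'@_j *+ (j == i).
  by rewrite free_coefZ mcoeffU mulrnAr mulr1.
under eq_bigr => j _ do rewrite H.
case: msuppP => ic; last first.
  rewrite big1_seq // => j /andP[_ jc]; case: eqP => // ji.
  by rewrite -ji jc in ic.
rewrite (big_fsetD1 i ic) /= eqxx mulr1n big1_seq ?addr0 // => j.
by rewrite in_fsetD1 => /andP[_ /andP[/negPf -> _]].
Qed.

Lemma lincombZ (V : lmodType A) (b : I -> V) a c : lincomb b (a *: c) = a *: lincomb b c.
Proof.
have le : (msupp (a *: c : free_mod) `<=` msupp c)%fset.
  apply/fsubsetP => i; rewrite -!mcoeff_neq0 free_coefZ.
  by apply: contraNneq => ->; rewrite mulr0.
rewrite (lincombEw b le) /lincomb scaler_sumr; apply: eq_bigr => i _.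
by rewrite free_coefZ scalerA.
Qed.

Lemma lincomb_linear (V : lmodType A) (b : I -> V) :
  linear (lincomb b : free_mod -> V).
Proof.
move=> a c c'; apply: etrans (raddfD (lincomb b) _ _) _.
by congr (_ + _); exact: lincombZ.
Qed.

Lemma basis_coord (V : lmodType A) (b : I -> V) : is_basis b ->
  exists co : V -> free_mod, [/\ linear co, forall v, lincomb b (co v) = v &
    forall c, co (lincomb b c) = c].
Proof.
move=> bb; have [co coP] := choice bb; exists co.
have coK v : lincomb b (co v) = v by have [] := coP v.
have coE c : co (lincomb b c) = c by have [_] := coP (lincomb b c); apply.
by split=> // a u v; rewrite -[in LHS](coK u) -[in LHS](coK v) -lincomb_linear coE.
Qed.
End FreeModule.

Section KernelModule.
Variables (A : pzRingType) (M N : lmodType A) (f : {linear M -> N}).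

Definition ker_pred : {pred M} := fun v => `[< f v = 0 >].

Lemma ker_closed : submod_closed ker_pred.
Proof.
split; first by apply/asboolP; rewrite linear0.
move=> a u v /asboolP fu /asboolP fv; apply/asboolP.
by rewrite linearP fu fv scaler0 addr0.
Qed.
HB.instance Definition _ := GRing.isSubmodClosed.Build A M ker_pred ker_closed.

Record ker_mod := KerMod { ker_val :> M; _ : ker_val \in ker_pred }.
HB.instance Definition _ := [isSub for ker_val].
HB.instance Definition _ := [Choice of ker_mod by <:].
HB.instance Definition _ := [SubChoice_isSubLmodule of ker_mod by <:].

Local Notation ker_val_lin := (val : {linear ker_mod -> M}).
Lemma ker_val0 : ker_val 0 = 0. Proof. exact: (linear0 ker_val_lin). Qed.
Lemma ker_valD u v : ker_val (u + v) = ker_val u + ker_val v.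
Proof. exact: (linearD ker_val_lin). Qed.
Lemma ker_valB u v : ker_val (u - v) = ker_val u - ker_val v.
Proof. exact: (linearB ker_val_lin). Qed.
Lemma ker_valZ a v : ker_val (a *: v) = a *: ker_val v.
Proof. exact: (linearZZ ker_val_lin). Qed.
Lemma ker_val_sum (J : Type) (s : seq J) (P : pred J) (F : J -> ker_mod) :
  ker_val (\sum_(j <- s | P j) F j) = \sum_(j <- s | P j) ker_val (F j).
Proof. exact: (linear_sum ker_val_lin). Qed.

Lemma ker_modP (v : ker_mod) : f (ker_val v) = 0.
Proof. by case: v => v /= /asboolP. Qed.

Lemma ker_mod_ex v : f v = 0 -> exists u : ker_mod, ker_val u = v.
Proof. by move=> /asboolP fv; exists (KerMod fv). Qed.
End KernelModule.

Section GradedModules.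
Variables (A : pzRingType) (Adeg : nat -> A -> Prop).
Local Notation gmod := (gmodule Adeg).

Lemma gm_deg0 (M : gmod) i : gm_deg i (0 : M).
Proof. by have [/(_ i)[]] := @gm_grading _ _ M. Qed.
Lemma gm_degB (M : gmod) i (u v : M) : gm_deg i u -> gm_deg i v -> gm_deg i (u - v).
Proof. by move=> iu iv; have [/(_ i)[_ H] _ _] := @gm_grading _ _ M; exact: H. Qed.
Lemma gm_degD (M : gmod) i (u v : M) : gm_deg i u -> gm_deg i v -> gm_deg i (u + v).
Proof.
move=> iu iv; rewrite -[v]opprK -[- v]sub0r; apply: gm_degB => //.
by apply: gm_degB => //; exact: gm_deg0.
Qed.
Lemma gm_deg_sum (M : gmod) i (J : Type) (s : seq J) (P : pred J) (F : J -> M) :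
  (forall j, P j -> gm_deg i (F j)) -> gm_deg i (\sum_(j <- s | P j) F j).
Proof.
move=> iF; elim/big_rec: _ => [|j u Pj iu]; first exact: gm_deg0.
by apply: gm_degD => //; exact: iF.
Qed.

Section Kernel.
Variables (M N : gmod) (f : {linear M -> N}).
Hypothesis f_deg : deg0_hom f.

Definition ker_deg i (v : ker_mod f) := gm_deg i (ker_val v).

(** A map of degree 0 commutes with the homogeneous projections, so the components of an element of
    the kernel stay in the kernel. *)
Lemma ker_grading : is_grading ker_deg.
Proof.
split=> [i|v|s w us iw E0 i is_].
- by split=> [|u v]; [exact: gm_deg0 | rewrite /ker_deg ker_valB; exact: gm_degB].
- have [p [pB pP pE p0 pS]] := grading_proj (gm_grading M).
  have [q [qB qP qE q0 _]] := grading_proj (gm_grading N).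
  have pq i u : f (p i u) = q i (f u).
    have [_ Msum _] := gm_grading M.
    elim: (Msum u) => [|j u1 u2 ju1 _ IH].
      have p00 : p i 0 = 0 by have := pB i 0 0; rewrite !subrr.
      have q00 : q i 0 = 0 by have := qB i 0 0; rewrite !subrr.
      by rewrite p00 !linear0 q00.
    have pD : p i (u1 + u2) = p i u1 + p i u2.
      have p00 : p i 0 = 0 by have := pB i 0 0; rewrite !subrr.
      by rewrite -[u2 in LHS]opprK pB -[- u2]sub0r pB p00 sub0r opprK.
    have qD : q i (f u1 + f u2) = q i (f u1) + q i (f u2).
      have q00 : q i 0 = 0 by have := qB i 0 0; rewrite !subrr.
      by rewrite -[f u2 in LHS]opprK qB -[- f u2]sub0r qB q00 sub0r opprK.
    rewrite pD !linearD qD IH; congr (_ + _).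
    have [ji|ji] := eqVneq j i; last by rewrite (p0 i j) // (q0 i j) ?linear0 //; exact: f_deg.
    by rewrite pE ?qE -?ji //; exact: f_deg.
  have fp i : f (p i (ker_val v)) = 0.
    by rewrite pq ker_modP; have := qB i 0 0; rewrite !subrr.
  have [u uP] := choice (fun i => ker_mod_ex (fp i)).
  have [s Es] := pS (ker_val v).
  have -> : v = \sum_(i <- undup s) u i.
    apply: val_inj.
    rewrite /= ker_val_sum; rewrite {1}(Es (undup s)) ?undup_uniq //.
      by apply: eq_bigr => i _; rewrite uP.
    by move=> i; rewrite mem_undup.
  elim: (undup s) => [|i t IH]; first by rewrite big_nil; exact: sum_of0.
  by rewrite big_cons; apply: sum_ofD IH; rewrite /ker_deg uP; exact: pP.
have [_ _ Mind] := gm_grading M; apply: val_inj => /=.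
apply: (Mind s (fun j => ker_val (w j))) => //.
by rewrite -ker_val_sum E0 ker_val0.
Qed.

Lemma ker_gm_scale i j a (v : ker_mod f) :
  Adeg i a -> ker_deg j v -> ker_deg (i%:Z + j) (a *: v).
Proof. exact: gm_scale. Qed.

Definition ker_gmod : gmod := GModule ker_grading ker_gm_scale.

Definition ker_incl : {linear ker_gmod -> M} := (val : {linear ker_mod f -> M}).

Lemma ker_incl_deg : deg0_hom ker_incl.
Proof. by []. Qed.
Lemma ker_incl_inj : injective ker_incl.
Proof. exact: val_inj. Qed.
Lemma ker_inclP v : f v = 0 <-> exists u, ker_incl u = v.
Proof.
split=> [/ker_mod_ex[u uv]|[u <-]]; first by exists u.
exact: ker_modP.
Qed.
End Kernel.
End GradedModules.

(** * Blocks *)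

Section PrefixCode.
Variables (n r : nat) (le_rn : (r <= n)%N).
Local Notation red := (reduced_word le_rn).
Implicit Types u v w y : word n.+1.

(* Reduced words [ord_max ... ord_max i] with [i != ord_max]: every reduced word
   that is not a power of [ord_max] starts with exactly one of them. *)
Fixpoint is_block w : bool := if w is i :: w' then
  if i == ord_max then is_block w' && ~~ low_head r w' else w' == [::]
  else false.

Definition is_power w : bool := all (pred1 ord_max) w.

(** A block ends with a letter other than [ord_max], so no forbidden pair arises at the junction. *)
Lemma block_cat_reduced y w : is_block y -> red w -> red (y ++ w).
Proof.
elim: y => //= i y IH; case: eqVneq => [ie|ie].
  move=> /andP[by_ ly] rw; rewrite reduced_cons IH //=.
  by case: y {IH} by_ ly => // j y _ /= /negPf ->; rewrite andbF.
by move=> /eqP -> rw; rewrite /= reduced_cons rw (negPf ie).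
Qed.

Lemma block_prefix y y' w w' : is_block y -> is_block y' ->
  y ++ w = y' ++ w' -> y = y' /\ w = w'.
Proof.
elim: y y' => //= i y IH [//|j y'] /=.
case: eqVneq => [ie|ie] => [/andP[by_ _]|/eqP ->].
  move=> H [ij Ew]; move: H; rewrite -ij ie eqxx => /andP[by' _].
  by have [-> ->] := IH _ by_ by' Ew.
by move=> H [ij Ew]; move: H; rewrite -ij (negPf ie) => /eqP y'0; rewrite y'0 in Ew *.
Qed.

Lemma block_not_power y w : is_block y -> ~~ is_power (y ++ w).
Proof.
elim: y => //= i y IH; case: eqVneq => //= ie /andP[by_ _].
exact: IH.
Qed.

Lemma block_size y : is_block y -> (0 < size y)%N.
Proof. by case: y. Qed.

Lemma reduced_block w : red w -> ~~ is_power w ->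
  exists y w', [/\ is_block y, red w' & w = y ++ w'].
Proof.
elim: w => //= i w IH riw; case: eqVneq => [ie|ie] /= pw.
  have rw := reduced_consW riw; have [y [w' [by_ rw' wE]]] := IH rw pw.
  exists (i :: y), w'; split=> //=; last by rewrite wE.
  rewrite ie eqxx by_ /=; move: riw; rewrite reduced_cons ie eqxx wE.
  by case: y by_ {wE} => //= j y _ /andP[].
exists [:: i], w; split=> //=; last exact: reduced_consW riw.
Qed.

Lemma power_reduced d : red (nseq d ord_max).
Proof.
elim: d => [|d IH]; first exact: reduced_nil.
rewrite /= reduced_cons IH /=; case: d {IH} => [|d] /=; first by rewrite andbF.
by rewrite ltnNge le_rn andbF.
Qed.

Lemma powerE w : is_power w -> w = nseq (size w) ord_max.
Proof. by move/all_pred1P. Qed.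
End PrefixCode.

Section MalgSupport.
Variables (K : nzRingType) (n : nat).
Local Notation F := (freealg K n.+1).
Implicit Types (D : pred (word n.+1)) (p q : F) (u v w : word n.+1).

Definition supp_in D q := forall w, q@_w != 0 -> D w.

Lemma supp_in0 D : supp_in D 0.
Proof. by move=> w; rewrite mcoeff0 eqxx. Qed.

Lemma supp_inB D p q : supp_in D p -> supp_in D q -> supp_in D (p - q).
Proof.
move=> Dp Dq w; rewrite mcoeffB; have [->|/Dp //] := eqVneq p@_w 0.
by rewrite sub0r oppr_eq0; exact: Dq.
Qed.

Lemma supp_inD D p q : supp_in D p -> supp_in D q -> supp_in D (p + q).
Proof.
move=> Dp Dq; rewrite -[q]opprK; apply: supp_inB => // w.
by rewrite mcoeffN oppr_eq0; exact: Dq.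
Qed.

Lemma supp_inU D c w : D w -> supp_in D << c *g w >>.
Proof.
move=> Dw v; rewrite mcoeffU; have [<-//|_] := eqVneq w v.
by rewrite mulr0n eqxx.
Qed.

Lemma supp_inW D D' q : subpred D D' -> supp_in D q -> supp_in D' q.
Proof. by move=> DD' Dq w /Dq; exact: DD'. Qed.

Lemma supp_in_sum D (J : Type) (s : seq J) (P : pred J) (q : J -> F) :
  (forall j, P j -> supp_in D (q j)) -> supp_in D (\sum_(j <- s | P j) q j).
Proof.
move=> Dq; elim/big_rec: _ => [|j p Pj Dp]; first exact: supp_in0.
by apply: supp_inD => //; exact: Dq.
Qed.

Definition shift u q : F := \sum_(w <- msupp q) << q@_w *g (u ++ w : word n.+1) >>.

Lemma shift_coef u q w : (shift u q)@_(u ++ w) = q@_w.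
Proof.
rewrite raddf_sum /=.
have E v : (<< q@_v *g (u ++ v : word n.+1) >>)@_(u ++ w) = q@_v *+ (v == w).
  by rewrite mcoeffU eqseq_cat // eqxx.
under eq_bigr => v _ do rewrite E.
case: msuppP => wq; last first.
  rewrite big1_seq // => v /andP[_ vq]; case: eqP => // vw.
  by rewrite -vw vq in wq.
rewrite (big_fsetD1 w wq) /= eqxx mulr1n big1_seq ?addr0 // => v.
by rewrite in_fsetD1 => /andP[_ /andP[/negPf -> _]].
Qed.

Lemma shift_supp u q v : (shift u q)@_v != 0 -> exists2 w, v = u ++ w & q@_w != 0.
Proof.
apply: contra_neqP => nex; rewrite raddf_sum big1_seq //= => w wq.
rewrite mcoeffU; case: eqP => // uwv; case: nex; exists w => //.
by rewrite mcoeff_neq0.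
Qed.
End MalgSupport.

(** * Algebras with the reduced words as normal forms *)

Section ConcaAlgebra.
Variables (K : fieldType) (n r : nat) (le_rn : (r <= n)%N) (A : pzRingType).
Local Notation F := (freealg K n.+1).
Local Notation red := (reduced_word le_rn).
Local Notation block := (@is_block n r).
Local Notation power := (@is_power n).
Variable ev : {rmorphism F -> A}.
Implicit Types (w y : word n.+1) (p q : F) (a b : A).

Definition ev_word w : A := ev << (w : word n.+1) >>.
Definition ev_cst (c : K) : A := ev c%:MP.
Local Notation W := ev_word.
Local Notation cst := ev_cst.
Local Notation t := (W [:: ord_max]).

Lemma ev_wordM u w : W (u ++ w) = W u * W w.
Proof.
rewrite /W -rmorphM; congr (ev _).
by rewrite malgM_def fgmulUU mulr1.
Qed.

Lemma ev_word0 : W [::] = 1.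
Proof. exact: (rmorph1 ev). Qed.

Lemma ev_wordU c w : ev << c *g w >> = cst c * W w.
Proof.
rewrite /cst /W -rmorphM; congr (ev _).
by rewrite malgM_def fgmulUU mulr1 mul1m.
Qed.

Lemma ev_word_def w : ev << (w : word n.+1) >> = W w.
Proof. by []. Qed.
Lemma ev_cst_def c : ev << c *g ([::] : word n.+1) >> = cst c.
Proof. by []. Qed.

Lemma evE q : ev q = \sum_(w <- msupp q) cst q@_w * W w.
Proof.
by rewrite {1}[q]monalgE raddf_sum; apply: eq_bigr => w _; exact: ev_wordU.
Qed.

Lemma ev_shift u q : ev (shift u q) = W u * ev q.
Proof.
rewrite [in RHS](evE q) mulr_sumr raddf_sum; apply: eq_bigr => w _.
rewrite -ev_wordU /W -rmorphM; congr (ev _).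
by rewrite malgM_def fgmulUU mul1r.
Qed.

Lemma ev_ind (Q : A -> Prop) q : Q 0 -> (forall a b, Q a -> Q b -> Q (a + b)) ->
  (forall w, q@_w != 0 -> Q (cst q@_w * W w)) -> Q (ev q).
Proof.
move=> Q0 QD QW; rewrite evE big_seq; elim/big_rec: _ => // w a wq Qa.
by apply: (QD _ _ _ Qa); apply: QW; rewrite mcoeff_neq0.
Qed.

Hypothesis nf_ex : forall a, exists2 q, supp_in red q & ev q = a.
Hypothesis nf_inj : forall q, supp_in red q -> ev q = 0 -> q = 0.
Hypothesis ev_rel : forall h : 'I_r, exists b : 'I_n.+1 -> A,
  t * W [:: Defs.sub_ord le_rn h] = \sum_(i < n.+1 | (i < n)%N) W [:: i] * b i.

Lemma nf_uniq p q : supp_in red p -> supp_in red q -> ev p = ev q -> p = q.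
Proof.
move=> rp rq E; apply/eqP; rewrite -subr_eq0; apply/eqP; apply: nf_inj.
  exact: supp_inB.
by rewrite raddfB /= E subrr.
Qed.

Lemma cst_comm c a : cst c * a = a * cst c.
Proof.
have [q _ <-] := nf_ex a; rewrite /cst -!rmorphM; congr (ev _).
rewrite !malgM_def fgmulUg fgmulgU; apply: eq_bigr => w _.
by rewrite mulrC mul1m mulm1.
Qed.

Lemma cst0 : cst 0 = 0.
Proof. by rewrite /cst malgC0E rmorph0. Qed.
Lemma cst1 : cst 1 = 1.
Proof. exact: rmorph1. Qed.
Lemma cstM c c' : cst (c * c') = cst c * cst c'.
Proof. by rewrite /cst -rmorphM; congr (ev _); rewrite rmorphM. Qed.
Lemma cstD c c' : cst (c + c') = cst c + cst c'.
Proof. by rewrite /cst !raddfD. Qed.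

Lemma cstN c : cst (- c) = - cst c.
Proof. by rewrite /cst !raddfN. Qed.

Section Blocks.
Variables (N : lmodType A) (P : N -> Prop).
Hypothesis P0 : P 0.
Hypothesis PD : forall u v, P u -> P v -> P (u + v).

(* For [J] the kernel of the map sending [xi_e] to a variable and the other
   [xi_i] to 0, and [P] a submodule of [N], this is [J P]. *)
Definition in_blocks : N -> Prop :=
  sum_of (fun y v => is_true (block y) /\ exists2 u, P u & v = W y *: u).

(** Terms with the same block are merged, for which [P] must be closed under addition; one family
    [u] then serves for every list containing [s]. *)
Lemma in_blocksP v : in_blocks v -> exists s (u : word n.+1 -> N),
  [/\ uniq s, all block s, forall y, P (u y) &
      forall t : seq (word n.+1), uniq t -> {subset s <= t} ->
        v = \sum_(y <- t) W y *: u y].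
Proof.
elim=> [|y v1 v2 [by_ [u1 Pu1 ->]] _ [s [u [us bs Pu Es]]]].
  by exists [::], (fun=> 0); split=> // t _ _; rewrite big1 // => y _; rewrite scaler0.
exists (undup (y :: s)), (fun z => (if z == y then u1 else 0) + u z); split.
- exact: undup_uniq.
- by apply/allP => z; rewrite mem_undup inE => /predU1P[->//|/(allP bs)].
- by move=> z; apply: PD => //; case: eqP.
move=> t ut st; have yt : y \in t by apply: st; rewrite mem_undup mem_head.
under eq_bigr => z _ do rewrite scalerDr.
rewrite big_split /= -Es //; last by move=> z zs; apply: st; rewrite mem_undup inE zs orbT.
congr (_ + _); rewrite (bigD1_seq y) //= eqxx big1 ?addr0 // => z /negPf ->.
by rewrite scaler0.
Qed.
End Blocks.

Lemma in_blocksD (N : lmodType A) (P : N -> Prop) u v :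
  in_blocks P u -> in_blocks P v -> in_blocks P (u + v).
Proof. exact: sum_of_add. Qed.

Lemma in_blocksN (N : lmodType A) (P : N -> Prop) : (forall u, P u -> P (- u)) ->
  forall u, in_blocks P u -> in_blocks P (- u).
Proof.
move=> PN; apply: sum_of_opp => y u [by_ [v Pv ->]]; split=> //.
by exists (- v); [exact: PN | rewrite scalerN].
Qed.

Definition blocks_free (N : lmodType A) := forall s (u : word n.+1 -> N),
  uniq s -> all block s -> \sum_(y <- s) W y *: u y = 0 -> {in s, forall y, u y = 0}.

Definition in_J (N : lmodType A) (v : N) := in_blocks (fun=> True) v.

Definition in_JA (a : A) := in_J (a : A^o).

(** Blocks form a prefix code: normal forms multiplied on the left by distinct blocks are supported
    on disjoint sets of reduced words, so a relation is read off coefficient by coefficient. *)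
Lemma blocks_free_alg : blocks_free A^o.
Proof.
move=> s u us bs E0 y ys.
have [q qP] := choice (fun y => (fun H => let: ex_intro2 q p1 p2 := H in
  ex_intro (fun q => supp_in red q /\ ev q = u y) q (conj p1 p2)) (nf_ex (u y))).
have Q0 : \sum_(y <- s) shift y (q y) = 0.
  apply: nf_inj; last first.
    rewrite raddf_sum -[RHS]E0; apply: eq_bigr => z _ /=.
    by rewrite ev_shift; have [_ ->] := qP z.
  rewrite big_seq; apply: supp_in_sum => z zs w /shift_supp[w' -> nz].
  by apply: block_cat_reduced; [exact: (allP bs) | have [+ _] := qP z; apply].
have [_ <-] := qP y; suff -> : q y = 0 by rewrite raddf0.
apply/malgP => w; rewrite mcoeff0.
have := congr1 (mcoeff (y ++ w : word n.+1)) Q0; rewrite mcoeff0 raddf_sum /=.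
rewrite (bigD1_seq y) //= shift_coef big1_seq ?addr0 // => z /andP[zy zs].
apply/eqP; apply: contraT => /shift_supp[w' E _].
have [yz _] := block_prefix (allP bs _ ys) (allP bs _ zs) E.
by rewrite yz eqxx in zy.
Qed.

Lemma in_JA_word y a : block y -> in_JA (W y * a).
Proof.
move=> by_; apply: (sum_of_incl (i := y)); split=> //.
by exists (a : A^o).
Qed.

Lemma in_JA_nf a : in_JA a <->
  exists2 q, supp_in (fun w => red w && ~~ power w) q & ev q = a.
Proof.
split=> [|[q qP <-]].
  elim=> [|y v1 v2 [by_ [u _ ->]] _ [q2 q2P <-]].
    by exists 0; [exact: supp_in0 | rewrite raddf0].
  have [q1 q1P q1E] := nf_ex u; exists (shift y q1 + q2).
    apply: supp_inD => // w /shift_supp[w' -> /q1P rw'].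
    by rewrite block_cat_reduced // (block_not_power _ by_).
  by rewrite raddfD /= ev_shift q1E.
apply: (ev_ind (Q := in_JA)) => [|b c|w /qP/andP[rw pw]].
- exact: sum_of0.
- exact: (in_blocksD (N := A^o)).
have [y [w' [by_ _ ->]]] := reduced_block rw pw.
by rewrite ev_wordM mulrA cst_comm -mulrA; exact: in_JA_word.
Qed.

Lemma in_JA_power c d : in_JA (cst c * W (nseq d ord_max)) -> c = 0.
Proof.
move=> /in_JA_nf[q qP]; rewrite -ev_wordU => /nf_uniq qE.
have {}qE : q = << c *g (nseq d ord_max : word n.+1) >>.
  apply: qE; first by apply: supp_inW qP => w /andP[].
  by apply: supp_inU; exact: power_reduced.
apply/eqP; apply: contraT => c0.
have nz : q@_(nseq d ord_max : word n.+1) != 0 by rewrite qE mcoeffUU.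
by have /andP[_] := qP _ nz; rewrite /is_power all_pred1_nseq.
Qed.

Lemma in_JA_mulr a b : in_JA a -> in_JA (a * b).
Proof.
elim=> [|y v1 v2 [by_ [u _ ->]] _ IH]; first by rewrite mul0r; exact: sum_of0.
rewrite mulrDl; apply: (in_blocksD (N := A^o)) => //.
by rewrite -mulrA; exact: in_JA_word.
Qed.

(** A block that does not start low stays a block when t is put in front. One that starts low is a
    single letter xi_h, and [ev_rel] moves t xi_h into the right ideal of the letters other than
    xi_e, which are blocks. *)
Lemma in_JA_shift a : in_JA a -> in_JA (t * a).
Proof.
elim=> [|y v1 v2 [by_ [u _ ->]] _ IH]; first by rewrite mulr0; exact: sum_of0.
rewrite mulrDr; apply: (in_blocksD (N := A^o)) => //.
rewrite /= mulrA; apply: in_JA_mulr.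
have [ly|ly] := boolP (low_head r y); last first.
  rewrite -ev_wordM -[W _]mulr1; apply: in_JA_word => /=.
  by rewrite eqxx by_.
case: y by_ ly => // i y /= by_ lt_ir.
have lt_in : (i < n)%N by exact: leq_trans lt_ir le_rn.
have ie : i == ord_max = false by apply/eqP => ie; move: lt_in; rewrite ie ltnn.
move: by_; rewrite ie => /eqP ->.
have iE : Defs.sub_ord le_rn (Ordinal lt_ir) = i by exact: val_inj.
have [b] := ev_rel (Ordinal lt_ir); rewrite iE => ->.
elim/big_rec: _ => [|j v lt_jn IHj]; first exact: sum_of0.
apply: (in_blocksD (N := A^o)) => //; apply: in_JA_word => /=.
by case: eqP => // je; move: lt_jn; rewrite je ltnn.
Qed.

Definition malg_filter (D : pred (word n.+1)) q : F :=
  [malg w in msupp q => if D w then q@_w else 0].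

Lemma malg_filterE D q w : (malg_filter D q)@_w = if D w then q@_w else 0.
Proof. by rewrite mcoeffE; case: msuppP => // _; rewrite if_same. Qed.

Lemma malg_filter_split D q : q = malg_filter D q + malg_filter (predC D) q.
Proof.
apply/malgP => w; rewrite mcoeffD !malg_filterE /=.
by case: (D w); rewrite ?addr0 ?add0r.
Qed.

(** By [in_JA_shift] only the powers of t in the normal form matter modulo J. Multiplication by t
    maps distinct powers to distinct powers, none of which occurs in J. *)
Lemma in_JA_unshift a : in_JA (t * a) -> in_JA a.
Proof.
have [q rq <-] := nf_ex a.
pose qE := malg_filter power q; pose qB := malg_filter (predC power) q.
have qS : q = qE + qB := malg_filter_split power q.
have JB : in_JA (ev qB).
  apply/in_JA_nf; exists qB => // w; rewrite malg_filterE /=.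
  by case: (boolP (power w)) => [_|_ /rq ->]; rewrite ?eqxx.
move=> Jt; have /in_JA_nf[q' q'P q'E] : in_JA (ev (shift [:: ord_max] qE)).
  have -> : ev (shift [:: ord_max] qE) = t * ev q - t * ev qB.
    by rewrite qS raddfD /= mulrDr addrK ev_shift.
  apply: (in_blocksD (N := A^o)) => //; apply: (in_blocksN (N := A^o)) => //.
  exact: in_JA_shift.
have EP w : qE@_w != 0 -> power w by rewrite malg_filterE; case: ifP; rewrite ?eqxx.
have EQ : q' = shift [:: ord_max] qE.
  apply: nf_uniq => //; first by apply: supp_inW q'P => w /andP[].
  move=> w /shift_supp[w' -> /EP/powerE ->].
  exact: (power_reduced le_rn (size w').+1).
suff qE0 : qE = 0 by rewrite qS qE0 add0r.
apply/malgP => w; rewrite mcoeff0; apply/eqP; apply: contraT => nz.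
have := q'P (ord_max :: w); rewrite EQ (shift_coef [:: ord_max]) => /(_ nz).
by rewrite /= /is_power /= eqxx [all _ _](EP w nz) andbF.
Qed.

(** The length filtration on normal forms, used as the measure in the inductions on relations. *)
Definition len_lt l a :=
  exists2 q, supp_in (fun w => red w && (size w < l)%N) q & ev q = a.

Lemma len_lt0 l : len_lt l 0.
Proof. by exists 0; [exact: supp_in0 | rewrite raddf0]. Qed.

Lemma len_ltD l a b : len_lt l a -> len_lt l b -> len_lt l (a + b).
Proof.
by move=> [p pl <-] [q ql <-]; exists (p + q); [exact: supp_inD | rewrite raddfD].
Qed.

Lemma len_ltU l c w : red w -> (size w < l)%N -> len_lt l (cst c * W w).
Proof.
move=> rw wl; exists << c *g w >>; last exact: ev_wordU.
by apply: supp_inU; rewrite rw.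
Qed.

Lemma len_ltW l l' a : (l <= l')%N -> len_lt l a -> len_lt l' a.
Proof.
move=> ll' [q ql <-]; exists q => //; apply: supp_inW ql => w /andP[-> wl].
exact: leq_trans wl ll'.
Qed.

Lemma len_lt_at0 a : len_lt 0 a -> a = 0.
Proof.
move=> [q q0 <-]; suff -> : q = 0 by rewrite raddf0.
apply/malgP => w; rewrite mcoeff0; apply/eqP; apply: contraT => /q0.
by rewrite andbF.
Qed.

Lemma len_lt_ex a : exists l, len_lt l a.
Proof.
have [q rq <-] := nf_ex a.
exists (\max_(w <- msupp q) (size w).+1)%N; exists q => // w nz; rewrite rq //=.
have wq : w \in msupp q by rewrite -mcoeff_neq0.
by rewrite (big_fsetD1 w wq) /= leq_max ltnSn.
Qed.

(** In the normal form the empty word gives [c], the positive powers of t give [t * a'], and all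
    other words lie in J. *)
Lemma len_ltS_split l a : len_lt l.+1 a -> exists c a' j,
  [/\ a = cst c + t * a' + j, len_lt l a' & in_JA j].
Proof.
have J0 : in_JA 0 by exact: sum_of0.
have E1 (s z : A) : z = 0 + s * 0 + z by rewrite mulr0 !add0r.
have E2 (s z u : A) : u = 1 -> z * u = z + s * 0 + 0.
  by move=> ->; rewrite mulr1 mulr0 !addr0.
have E3 (s c z u : A) : c * s = s * c -> u = s * z -> c * u = 0 + s * (c * z) + 0.
  by move=> cs ->; rewrite add0r addr0 !mulrA cs.
move=> [q ql <-]; apply: (ev_ind (Q := fun a => exists c a' j,
    [/\ a = cst c + t * a' + j, len_lt l a' & in_JA j])) => [|b1 b2|w /ql/andP[rw wl]].
- by exists 0, 0, 0; split=> //; [rewrite cst0; exact: E1 | exact: len_lt0].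
- move=> [c1 [a1 [j1 [-> l1 J1]]]] [c2 [a2 [j2 [-> l2 J2]]]].
  exists (c1 + c2), (a1 + a2), (j1 + j2); split; last exact: (in_blocksD (N := A^o)).
    by rewrite cstD mulrDr addrACA; congr (_ + _); rewrite addrACA.
  exact: len_ltD.
have [pw|pw] := boolP (power w); last first.
  exists 0, 0, (cst q@_w * W w); split; [rewrite cst0; exact: E1 | exact: len_lt0 |].
  have [y [w' [by_ _ ->]]] := reduced_block rw pw.
  by rewrite ev_wordM mulrA cst_comm -mulrA; exact: in_JA_word.
case: w wl rw pw => [|i w] wl rw pw.
  exists q@_[::], 0, 0; split=> //; last exact: len_lt0.
  exact: (E2 _ _ _ ev_word0).
exists 0, (cst q@_(i :: w) * W w), 0; split=> //.
  have /= /andP[/eqP -> _] := pw.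
  by rewrite cst0; apply: E3 (cst_comm _ _) (ev_wordM [:: ord_max] w).
by apply: len_ltU => //; exact: reduced_consW rw.
Qed.

(** Blocks are nonempty, so splitting one off shortens every word. *)
Lemma len_ltS_blocks l a : len_lt l.+1 a -> in_JA a ->
  in_blocks (len_lt l : A^o -> Prop) a.
Proof.
move=> [q ql qE] /in_JA_nf[q' q'P q'E].
have EQ : q = q'.
  apply: nf_uniq; last by rewrite qE.
    by apply: supp_inW ql => w /andP[].
  by apply: supp_inW q'P => w /andP[].
rewrite -qE.
apply: (ev_ind (Q := in_blocks (len_lt l : A^o -> Prop))) => [|b c|w qw].
- exact: sum_of0.
- exact: (in_blocksD (N := A^o)).
have /andP[rw wl] := ql w qw; have /andP[_ pw] : red w && ~~ power w.
  by apply: q'P; rewrite -EQ.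
have [y [w' [by_ rw' wE]]] := reduced_block rw pw.
apply: (sum_of_incl (i := y)); split=> //; exists (cst q@_w * W w').
  apply: len_ltU => //; move: wl; rewrite wE size_cat.
  by have := block_size by_; lia.
by rewrite wE ev_wordM mulrA cst_comm -mulrA.
Qed.
End ConcaAlgebra.

Opaque ev_word ev_cst.

(** * Block freeness and cancellation of t modulo J, for free modules and kernels *)

Section ConcaModules.
Variables (K : fieldType) (n r : nat) (le_rn : (r <= n)%N) (A : pzRingType).
Local Notation F := (freealg K n.+1).
Local Notation red := (reduced_word le_rn).
Local Notation block := (@is_block n r).
Variable ev : {rmorphism F -> A}.
Hypothesis nf_ex : forall a, exists2 q, supp_in red q & ev q = a.
Hypothesis nf_inj : forall q, supp_in red q -> ev q = 0 -> q = 0.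
Local Notation W := (ev_word ev).
Local Notation cst := (ev_cst ev).
Local Notation t := (W [:: ord_max]).
Hypothesis ev_rel : forall h : 'I_r, exists b : 'I_n.+1 -> A,
  t * W [:: Defs.sub_ord le_rn h] = \sum_(i < n.+1 | (i < n)%N) W [:: i] * b i.
Local Notation in_JA := (in_JA r ev).

Section Submodule.
Variable V : lmodType A.
Implicit Types v : V.
Local Notation in_J := (@in_J K n r A ev V).

Lemma in_J0 : in_J 0. Proof. exact: sum_of0. Qed.

Lemma in_JD u v : in_J u -> in_J v -> in_J (u + v).
Proof. exact: in_blocksD. Qed.

Lemma in_JN v : in_J v -> in_J (- v).
Proof. exact: in_blocksN. Qed.

Lemma in_JB u v : in_J u -> in_J v -> in_J (u - v).
Proof. by move=> Ju Jv; apply: in_JD Ju (in_JN Jv). Qed.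

Lemma in_J_sum (I : Type) (s : seq I) (P : pred I) (F : I -> V) :
  (forall i, P i -> in_J (F i)) -> in_J (\sum_(i <- s | P i) F i).
Proof.
move=> JF; elim/big_rec: _ => [|i v Pi Jv]; first exact: in_J0.
by apply: in_JD => //; exact: JF.
Qed.

Lemma in_J_block y v : block y -> in_J (W y *: v).
Proof. by move=> by_; apply: (sum_of_incl (i := y)); split=> //; exists v. Qed.

Lemma in_J_scale a v : in_JA a -> in_J (a *: v).
Proof.
elim=> [|y a1 a2 [by_ [u _ ->]] _ IH]; first by rewrite scale0r; exact: in_J0.
by rewrite scalerDl; apply: in_JD => //; rewrite -scalerA; exact: in_J_block.
Qed.
End Submodule.

Lemma ev_word_scale (V : lmodType A) i y (v : V) : W (i :: y) *: v = W [:: i] *: (W y *: v).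
Proof. by rewrite scalerA -(ev_wordM ev [:: i] y). Qed.

Lemma cst_scale_comm (V : lmodType A) c a (v : V) : cst c *: (a *: v) = a *: (cst c *: v).
Proof. by rewrite !scalerA (cst_comm nf_ex). Qed.

Lemma sum_scale_split (V : lmodType A) (I : Type) (s : seq I) (v : I -> V)
    (a c b j : I -> A) (e : A) : (forall i, a i = c i + e * b i + j i) ->
  \sum_(i <- s) a i *: v i =
  \sum_(i <- s) c i *: v i + e *: (\sum_(i <- s) b i *: v i) + \sum_(i <- s) j i *: v i.
Proof.
move=> aE; rewrite scaler_sumr -!big_split; apply: eq_bigr => i _ /=.
by rewrite aE !scalerDl scalerA.
Qed.

Section Bases.
Variables (I : choiceType) (V : lmodType A) (b : I -> V).
Hypothesis bb : is_basis b.

Lemma basis_blocks_free : blocks_free r ev V.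
Proof.
have [co [co_lin coK coE]] := basis_coord bb.
pose coL : {linear V -> free_mod A I} := HB.pack co (GRing.isLinear.Build _ _ _ _ co co_lin).
move=> s u us bs E0 y ys; rewrite -(coK (u y)).
suff -> : co (u y) = 0 by exact: raddf0.
apply/malgP => i; rewrite mcoeff0.
apply: (blocks_free_alg nf_ex nf_inj (s := s) (u := fun z => (co (u z))@_i) us bs) => //.
have := congr1 (fun v => (coL v)@_i) E0.
rewrite linear_sum linear0 mcoeff0 raddf_sum /= => E1; rewrite -[RHS]E1.
apply: eq_bigr => z _; rewrite -[LHS]/(W z * _) -free_coefZ.
by congr (mcoeff i _); exact: esym (linearZZ coL _ _).
Qed.

Lemma basis_in_J_unshift (v : V) : in_J r ev (t *: v) -> in_J r ev v.
Proof.
have [co [co_lin coK coE]] := basis_coord bb.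
pose coL : {linear V -> free_mod A I} := HB.pack co (GRing.isLinear.Build _ _ _ _ co co_lin).
have coZ a u i : (co (a *: u))@_i = a * (co u)@_i.
  by rewrite -free_coefZ; congr (mcoeff i _); exact: (linearZZ coL).
have Jco u i : in_J r ev u -> in_JA (co u)@_i.
  elim=> [|y u1 u2 [by_ [w _ ->]] _ IH].
    by rewrite (_ : co 0 = 0) ?mcoeff0; [exact: sum_of0 | exact: (linear0 coL)].
  rewrite [co _](linearD coL) mcoeffD; apply: (in_blocksD (N := A^o)) => //.
  by rewrite [(_ : free_mod A I)@_i]coZ; exact: in_JA_word.
move=> Jtv; rewrite -(coK v); apply: in_J_sum => i _; apply: in_J_scale.
by apply: (in_JA_unshift nf_ex nf_inj ev_rel); rewrite -coZ; exact: Jco.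
Qed.
End Bases.

Section Kernels.
Variables (M N : lmodType A) (f : {linear M -> N}).
Hypothesis free_N : blocks_free r ev N.

Lemma ker_blocks_free : blocks_free r ev M -> blocks_free r ev (ker_mod f).
Proof.
move=> free_M s u us bs E0 y ys; apply: val_inj.
apply: (free_M s (fun z => val (u z)) us bs) => //.
rewrite -[RHS](congr1 (@ker_val _ _ _ f) E0) ker_val_sum.
by apply: eq_bigr => z _; rewrite ker_valZ.
Qed.

(* [J M] meets the kernel [Z] of [f] in [J Z], because blocks are left
   cancellable in the target of [f]. *)
Lemma ker_in_J (v : ker_mod f) : in_J r ev (ker_val v) -> in_J r ev v.
Proof.
move=> Jv; have [s [u [us bs _ Es]]] := in_blocksP I (fun _ _ _ _ => I) Jv.
have {}Es := Es s us (fun=> id).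
have f0 : {in s, forall y, f (u y) = 0}.
  apply: (free_N (u := fun y => f (u y)) us bs).
  rewrite -[RHS](ker_modP v) Es linear_sum; apply: eq_bigr => y _.
  by rewrite linearZ.
have /choice[w wP] : forall y, exists w : ker_mod f, y \in s -> ker_val w = u y.
  move=> y; have [ys|ys] := boolP (y \in s); last by exists 0.
  by have [w wE] := ker_mod_ex (f0 y ys); exists w.
have -> : v = \sum_(y <- s) W y *: w y.
  apply: val_inj; rewrite [LHS]Es /= ker_val_sum.
  rewrite big_seq [RHS]big_seq; apply: eq_bigr => y ys.
  by rewrite -(wP y ys) ker_valZ.
rewrite big_seq; apply: in_J_sum => y ys; apply: in_J_block.
exact: (allP bs).
Qed.

(** If t v lies in J Z, it lies in J M, so v lies in J M by cancellation there; [ker_in_J] brings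
    this back to J Z. *)
Lemma ker_in_J_unshift : (forall v : M, in_J r ev (t *: v) -> in_J r ev v) ->
  forall v : ker_mod f, in_J r ev (t *: v) -> in_J r ev v.
Proof.
move=> tM v Jtv; apply: ker_in_J; apply: tM.
have : in_J r ev (ker_val (t *: v)).
  elim: Jtv => [|y v1 v2 [by_ [u _ ->]] _ IH].
    by rewrite ker_val0; exact: in_J0.
  by rewrite ker_valD ker_valZ; apply: in_JD => //; exact: in_J_block.
by rewrite ker_valZ.
Qed.
End Kernels.
End ConcaModules.

(** * Minimal generators *)

Section GradedConcaModules.
Variables (K : fieldType) (n r : nat) (le_rn : (r <= n)%N) (A : pzRingType).
Local Notation F := (freealg K n.+1).
Local Notation red := (reduced_word le_rn).
Local Notation block := (@is_block n r).
Variable ev : {rmorphism F -> A}.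
Hypothesis nf_ex : forall a, exists2 q, supp_in red q & ev q = a.
Hypothesis nf_inj : forall q, supp_in red q -> ev q = 0 -> q = 0.
Local Notation W := (ev_word ev).
Local Notation cst := (ev_cst ev).
Local Notation t := (W [:: ord_max]).
Hypothesis ev_rel : forall h : 'I_r, exists b : 'I_n.+1 -> A,
  t * W [:: Defs.sub_ord le_rn h] = \sum_(i < n.+1 | (i < n)%N) W [:: i] * b i.
Local Notation in_JA := (in_JA r ev).
Variable Adeg : nat -> A -> Prop.
Hypothesis AdegE : forall d a, Adeg d a <->
  exists2 q, supp_in (fun w => red w && (size w == d)) q & ev q = a.
Hypothesis AdegM : forall i j a b, Adeg i a -> Adeg j b -> Adeg (i + j) (a * b).
Local Notation gmod := (gmodule Adeg).

(** Integer degrees accommodate the shifts [d - dg i] in graded free modules; the negative ones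
    contain only 0. *)
Definition Adegz (z : int) (a : A) :=
  exists2 q, supp_in (fun w => red w && ((size w)%:Z == z)) q & ev q = a.

Lemma Adegz_nat d a : Adegz d%:Z a <-> Adeg d a.
Proof. by rewrite AdegE. Qed.

Lemma Adegz_lt0 z a : z < 0 -> Adegz z a -> a = 0.
Proof.
move=> z0 [q qP <-]; suff -> : q = 0 by rewrite raddf0.
apply/malgP => w; rewrite mcoeff0; apply/eqP; apply: contraT => /qP.
by move=> /andP[_ /eqP wz]; move: z0; rewrite -wz.
Qed.

Lemma Adegz0 z : Adegz z 0.
Proof. by exists 0; [exact: supp_in0 | rewrite raddf0]. Qed.

Lemma Adegz_grading : is_grading Adegz.
Proof.
split=> [z|a|s w us wz E0 z zs].
- split; first exact: Adegz0.
  move=> a b [p pz <-] [q qz <-]; exists (p - q); last by rewrite raddfB.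
  exact: supp_inB.
- have [q rq <-] := nf_ex a; apply: (ev_ind (Q := sum_of Adegz)).
  + exact: sum_of0.
  + by move=> a1 a2; exact: sum_of_add.
  move=> w /rq rw; apply: (sum_of_incl (i := (size w)%:Z)).
  exists << q@_w *g w >>; last exact: ev_wordU.
  by apply: supp_inU; rewrite rw eqxx.
have [q qP] := choice (fun z => (fun H => let: ex_intro2 q p1 p2 := H in
  ex_intro (fun q => supp_in (fun w => red w && ((size w)%:Z == z)) q /\ ev q = w z)
    q (conj p1 p2)) (wz z)).
have Q0 : \sum_(z <- s) q z = 0.
  apply: nf_inj; last by rewrite raddf_sum -[RHS]E0; apply: eq_bigr => y _; case: (qP y).
  apply: supp_in_sum => y _; have [qy _] := qP y.
  by apply: supp_inW qy => v /andP[].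
have [qz <-] := qP z; suff -> : q z = 0 by rewrite raddf0.
apply/malgP => v; rewrite mcoeff0; apply/eqP; apply: contraT => nz.
have := congr1 (mcoeff v) Q0; rewrite mcoeff0 raddf_sum /= (bigD1_seq z) //=.
have /andP[_ /eqP vz] := qz v nz.
rewrite big1_seq ?addr0 => [|y /andP[yz ys]]; first by move/eqP; rewrite (negPf nz).
apply/eqP; apply: contraNT yz => nzy; have [qy _] := qP y.
by have /andP[_ /eqP <-] := qy v nzy; rewrite vz.
Qed.

Lemma Adegz_scale (M : gmod) z j a (v : M) : Adegz z a -> gm_deg j v -> gm_deg (z + j) (a *: v).
Proof.
case: z => [d|d] az jv; first by apply: gm_scale => //; exact/Adegz_nat.
by rewrite (Adegz_lt0 _ az) // scale0r; exact: gm_deg0.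
Qed.

Lemma AdegzM i z a b : Adeg i a -> Adegz z b -> Adegz (i%:Z + z) (a * b).
Proof.
case: z => [d|d] ia zb; first by rewrite -PoszD; apply/Adegz_nat/AdegM => //; exact/Adegz_nat.
by rewrite (Adegz_lt0 _ zb) // mulr0; exact: Adegz0.
Qed.

Lemma reduced1 i : red [:: i].
Proof. by rewrite reduced_cons reduced_nil andbF. Qed.

Lemma Adeg_word w : red w -> Adeg (size w) (W w).
Proof.
move=> rw; apply/AdegE; exists << (w : word n.+1) >>; last exact: ev_word_def.
by apply: supp_inU; rewrite rw eqxx.
Qed.

Lemma Adegz_cst c : Adegz 0 (cst c).
Proof.
exists << c *g ([::] : word n.+1) >>; last exact: ev_cst_def.
by apply: supp_inU; rewrite reduced_nil.
Qed.

Section FreeGraded.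
Variables (I : choiceType) (dg : I -> int).
Local Notation FM := (free_mod A I).

Definition free_deg (d : int) (c : FM) := forall i, Adegz (d - dg i) c@_i.

Lemma free_deg_closed d : free_deg d 0 /\
  (forall u v, free_deg d u -> free_deg d v -> free_deg d (u - v)).
Proof.
split=> [i|u v du dv i]; first by rewrite mcoeff0; exact: Adegz0.
have [P0 _ _] := Adegz_grading; have [_ PB] := P0 (d - dg i).
by rewrite mcoeffB; apply: PB.
Qed.

Lemma free_degU d i a : Adegz d a -> free_deg (d + dg i) << a *g i >>.
Proof.
move=> da j; rewrite mcoeffU; case: eqVneq => [<-|_]; last exact: Adegz0.
by rewrite addrK.
Qed.

Lemma free_grading : is_grading free_deg.
Proof.
split=> [|c|s w us wd E0 d ds]; first exact: free_deg_closed.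
- rewrite [c]monalgE; elim/big_rec: _ => [|i c' _ IH]; first exact: sum_of0.
  apply: sum_of_add IH; have [_ Asum _] := Adegz_grading.
  elim: (Asum c@_i) => [|d a b da _ IH]; first by rewrite monalgU0; exact: sum_of0.
  by rewrite monalgUD; apply: sum_ofD IH; exact: free_degU da.
apply/malgP => i; rewrite mcoeff0; have [_ _ Aind] := Adegz_grading.
have di : injective (fun d : int => d - dg i) by exact: addIr.
(* Independence is checked in coordinate [i], where degree [d] becomes [d - dg i]. *)
have := Aind [seq d - dg i | d <- s] (fun z => (w (z + dg i))@_i).
rewrite map_inj_uniq // => /(_ us) H.
have := H _ _ (d - dg i); rewrite subrK; apply; last exact: map_f.
  by move=> z; have := wd (z + dg i) i; rewrite addrK.
rewrite big_map; have := congr1 (mcoeff i) E0; rewrite raddf_sum mcoeff0 /= => E1.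
by rewrite -[RHS]E1; apply: eq_bigr => z _; rewrite subrK.
Qed.

Lemma free_gm_scale i j a (v : FM) : Adeg i a -> free_deg j v -> free_deg (i%:Z + j) (a *: v).
Proof.
move=> ia jv k; rewrite free_coefZ -addrA; exact: AdegzM.
Qed.

Definition free_gmod : gmod := GModule free_grading free_gm_scale.

Lemma free_gmod_free : graded_free free_gmod.
Proof.
exists I, (fun i => << i >> : FM); split; last exact: free_mod_basis.
move=> i; exists (dg i); rewrite -[dg i]add0r; apply: free_degU.
by rewrite -(cst1 ev); exact: Adegz_cst.
Qed.

Lemma free_gmod_bounded (N : int) : (forall i, N <= dg i) -> bounded_below free_gmod.
Proof.
move=> Ndg; exists N => d v dN dv; apply/malgP => i; rewrite mcoeff0.
by apply: (@Adegz_lt0 (d - dg i)) => //; have := Ndg i; lia.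
Qed.
End FreeGraded.

Section Cover.
Variable M : gmod.
Hypothesis M_bd : bounded_below M.

(** Zero is homogeneous of every degree; excluding it keeps the free cover bounded below. *)
Definition cover_index := {p : int * M | `[< gm_deg p.1 p.2 >] && (p.2 != 0)}.
HB.instance Definition _ := Choice.on cover_index.

Lemma free_cover : exists (P : gmod) (f : {linear P -> M}),
  [/\ bounded_below_free P, deg0_hom f & forall v, exists u, f u = v].
Proof.
pose dg (i : cover_index) := (val i).1; pose b (i : cover_index) := (val i).2.
have bd i : gm_deg (dg i) (b i) by have /andP[/asboolP] := valP i.
exists (free_gmod dg).
pose f : {linear free_gmod dg -> M} := HB.pack (lincomb b : free_mod A cover_index -> M)
  (GRing.isLinear.Build _ _ _ _ _ (lincomb_linear b)).
exists f; split.
- split; first exact: free_gmod_free.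
  have [N NP] := M_bd; apply: (@free_gmod_bounded _ _ N) => i.
  rewrite leNgt; apply/negP => lt_iN; have /andP[_ /eqP] := valP i; apply.
  exact: NP lt_iN (bd i).
- move=> d c dc; apply: gm_deg_sum => i _.
  by rewrite -[d](subrK (dg i)); apply: Adegz_scale.
move=> v; have [_ Msum _] := gm_grading M.
elim: (Msum v) => [|d v1 v2 dv1 _ [c <-]]; first by exists 0; exact: linear0.
have [->|nz] := eqVneq v1 0; first by exists c; rewrite add0r.
have iP : `[< gm_deg (d, v1).1 (d, v1).2 >] && ((d, v1).2 != 0) by rewrite nz andbT; exact/asboolP.
exists ((<< (Sub (d, v1) iP : cover_index) >> : free_mod A cover_index) + c).
rewrite linearD; congr (_ + _); rewrite [LHS](lincombU b) scale1r.
by rewrite /b SubK.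
Qed.
End Cover.

Section Generators.
Variable Q : gmod.
Hypothesis free_Q : blocks_free r ev Q.
Hypothesis unshift_Q : forall v : Q, in_J r ev (t *: v) -> in_J r ev v.
Hypothesis Q_bd : bounded_below Q.
Local Notation in_J := (@in_J K n r A ev Q).
Implicit Types (v : Q) (s : seq Q).

(** The augmentation ideal times [Q], modulo which minimal generators form a basis. *)
Definition in_letters : Q -> Prop :=
  sum_of (fun (i : 'I_n.+1) v => exists u : Q, v = W [:: i] *: u).

Lemma in_J_letters v : in_J v -> in_letters v.
Proof.
elim=> [|y v1 v2 [by_ [u _ ->]] _ IH]; first exact: sum_of0.
case: y by_ => // i y _; apply: (sum_ofD (i := i)) IH.
by exists (W y *: u); exact: ev_word_scale.
Qed.

Lemma in_lettersD u v : in_letters u -> in_letters v -> in_letters (u + v).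
Proof. exact: sum_of_add. Qed.

Lemma in_lettersN v : in_letters v -> in_letters (- v).
Proof. by apply: sum_of_opp => i u [w ->]; exists (- w); rewrite scalerN. Qed.

Lemma in_letters_scale c v : in_letters v -> in_letters (cst c *: v).
Proof.
elim=> [|i v1 v2 [w ->] _ IH]; first by rewrite scaler0; exact: sum_of0.
rewrite scalerDr; apply: (sum_ofD (i := i)) IH; exists (cst c *: w).
exact: (cst_scale_comm nf_ex).
Qed.

Definition cst_comb (c : Q -> K) s : Q := \sum_(v <- s) cst (c v) *: v.

(* A maximal family of homogeneous elements that are linearly independent over
   [K] modulo the letters, i.e. a minimal set of generators. *)
Lemma minimal_generators : exists X : Q -> Prop,
  [/\ forall v, X v -> exists d, gm_deg d v,
      forall s c, uniq s -> (forall v, v \in s -> X v) -> in_letters (cst_comb c s) ->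
        {in s, forall v, c v = 0} &
      forall v d, gm_deg d v -> exists s c, (forall w, w \in s -> X w) /\
        in_letters (v - cst_comb c s)].
Proof.
pose ind s := (forall v, v \in s -> exists d, gm_deg d v) /\
  forall c, in_letters (cst_comb c (undup s)) -> {in s, forall v, c v = 0}.
have [| |X [Xind Xmax]] := @tukey Q ind.
- by split.
- move=> s s' ss' [hs' is']; split=> [v /ss'/hs'//|c lc v vs].
  have := is' (fun w => if w \in s then c w else 0); rewrite /cst_comb.
  have -> : \sum_(w <- undup s') cst (if w \in s then c w else 0) *: w =
      \sum_(w <- undup s) cst (c w) *: w.
    transitivity (\sum_(w <- undup s' | w \in s) cst (c w) *: w).
      rewrite [RHS]big_mkcond; apply: eq_bigr => w _.
      by case: ifP => // _; rewrite cst0 scale0r.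
    rewrite -big_filter; apply: perm_big; apply: uniq_perm.
    + by rewrite filter_uniq ?undup_uniq.
    + exact: undup_uniq.
    move=> w; rewrite mem_filter !mem_undup.
    by have [/ss' ->|] := boolP (w \in s).
  by move=> /(_ lc v (ss' v vs)); rewrite vs.
exists X; split=> [v Xv|s c us sX lc v vs|v d dv].
- have [|h _] := Xind [:: v]; first by move=> w; rewrite inE => /eqP ->.
  by apply: h; rewrite mem_head.
- have [_ i] := Xind s sX; apply: i => //; by rewrite undup_id.
have [Xv|[s sX ns]] := Xmax v.
  exists [:: v], (fun=> 1); split=> [w|]; first by rewrite inE => /eqP ->.
  by rewrite /cst_comb big_seq1 cst1 scale1r subrr; exact: sum_of0.
have [hs is_] := Xind s sX.
have [c [lc [w ws cw]]] : exists c, in_letters (cst_comb c (undup (v :: s))) /\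
    exists2 w, w \in v :: s & c w != 0.
  apply: contrapT => nex; apply: ns; split=> [w|c lc w ws].
    by rewrite inE => /predU1P[->|/hs//]; exists d.
  by apply/eqP; apply: contraT => cw; case: nex; exists c; split=> //; exists w.
have [vs|vs] := boolP (v \in s).
  case/eqP: cw; move: lc; rewrite /= vs => /is_; apply.
  by move: ws; rewrite inE => /predU1P[->|].
move: lc; rewrite /= (negPf vs) /cst_comb big_cons => lc.
(* Independence of the elements of [X] forces [v] to occur in the nontrivial relation, which can
   thus be solved for [v]. *)
have cv : c v != 0.
  apply/eqP => cv; case/eqP: cw; move: lc; rewrite cv cst0 scale0r add0r => lc.
  by move: ws; rewrite inE => /predU1P[->//|]; exact: is_ lc w.
exists (undup s), (fun w => - (c v)^-1 * c w); split=> [u|]; first by rewrite mem_undup => /sX.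
have -> : v - cst_comb (fun w => - (c v)^-1 * c w) (undup s) =
    cst (c v)^-1 *: (cst (c v) *: v + \sum_(j <- undup s) cst (c j) *: j).
  rewrite scalerDr scalerA -cstM mulVf // cst1 scale1r; congr (_ + _).
  rewrite /cst_comb -sumrN scaler_sumr; apply: eq_bigr => u _.
  by rewrite scalerA -cstM -scaleNr; congr (_ *: _); rewrite mulNr cstN opprK.
exact: in_letters_scale.
Qed.

Variable X : Q -> Prop.
Hypothesis X_homog : forall v, X v -> exists d, gm_deg d v.
Hypothesis X_indep : forall s c, uniq s -> (forall v, v \in s -> X v) ->
  in_letters (cst_comb c s) -> {in s, forall v, c v = 0}.
Hypothesis X_span : forall v d, gm_deg d v -> exists s c,
  (forall w, w \in s -> X w) /\ in_letters (v - cst_comb c s).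

Definition X_gen : Q -> Prop := sum_of (fun w v => X w /\ exists a : A, v = a *: w).

Lemma X_genD u v : X_gen u -> X_gen v -> X_gen (u + v).
Proof. exact: sum_of_add. Qed.

Lemma X_genZ a v : X_gen v -> X_gen (a *: v).
Proof.
elim=> [|w v1 v2 [Xw [b ->]] _ IH]; first by rewrite scaler0; exact: sum_of0.
rewrite scalerDr scalerA; apply: (sum_ofD (i := w)) IH.
by split=> //; exists (a * b).
Qed.

(* Nakayama's lemma for bounded below graded modules *)
Lemma X_generates v : X_gen v.
Proof.
have [p [pB pP pE p0 pS]] := grading_proj (gm_grading Q).
have p00 i : p i 0 = 0 by have := pB i 0 0; rewrite !subrr.
have pD i u w : p i (u + w) = p i u + p i w.
  by rewrite -[w in LHS]opprK pB -[- w]sub0r pB p00 sub0r opprK.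
have [N NP] := Q_bd.
(* Induction on the distance [m] from the lower bound [N] of the degrees. *)
suff H m d u : d < N + m%:Z -> gm_deg d u -> X_gen u.
  have [_ Qsum _] := gm_grading Q.
  elim: (Qsum v) => [|d v1 v2 dv1 _ IH]; first exact: sum_of0.
  by apply: X_genD => //; apply: (H (`|d - N|.+1)%N d) => //; lia.
elim: m d u => [|m IH] d u ud du.
  by rewrite (NP d u) //; [exact: sum_of0 | move: ud; rewrite addr0].
have [s [c [sX lu]]] := X_span du.
have pl w : in_letters w -> X_gen (p d w).
  elim=> [|i v1 v2 [z ->] _ IHl]; first by rewrite p00; exact: sum_of0.
  rewrite pD; apply: X_genD => //.
  (* Letters have degree 1, so the part of degree [d] only involves elements of degree [d - 1], to
     which the induction hypothesis applies. *)
  have -> : p d (W [:: i] *: z) = W [:: i] *: p (d - 1) z.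
    have [_ Qsum _] := gm_grading Q.
    elim: (Qsum z) => [|e z1 z2 ez1 _ IHz]; first by rewrite scaler0 !p00 scaler0.
    rewrite scalerDr !pD IHz scalerDr; congr (_ + _).
    have ez : gm_deg (1%:Z + e) (W [:: i] *: z1).
      by apply: gm_scale => //; exact: (Adeg_word (reduced1 i)).
    have [ed|ed] := eqVneq (1 + e) d; last first.
      by rewrite (p0 _ _ _ ez) // (p0 _ _ _ ez1) ?scaler0 //; apply: contra_neq ed => ->; lia.
    by rewrite -ed in ez *; rewrite (pE _ _ ez) (_ : 1 + e - 1 = e) ?pE //; lia.
  by apply: X_genZ; apply: (IH (d - 1)); [lia | exact: pP].
have -> : u = p d (u - cst_comb c s) + p d (cst_comb c s) by rewrite -pD subrK pE.
apply: X_genD; first exact: pl.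
rewrite /cst_comb; elim: s sX {lu} => [|w s IHs] sX.
  by rewrite big_nil p00; exact: sum_of0.
rewrite big_cons pD; apply: X_genD; last first.
  by apply: IHs => z zs; apply: sX; rewrite inE zs orbT.
have Xw : X w by apply: sX; rewrite mem_head.
have [e ew] := X_homog Xw.
have ecw : gm_deg e (cst (c w) *: w) by rewrite -[e]add0r; apply: Adegz_scale => //; exact: Adegz_cst.
have [ed|ed] := eqVneq e d; last by rewrite (p0 _ _ _ ecw) //; exact: sum_of0.
rewrite -ed pE //; apply: (sum_of_incl (i := w)); split=> //.
by exists (cst (c w)).
Qed.

(* Write [a v = c v + t a' v + j v] with [c v] in [K] and [j v] in [J]: the [c v]
   vanish by independence modulo the letters, and [t] can be cancelled modulo [J]. *)
Lemma X_in_JA l s (a : Q -> A) : uniq s -> (forall v, v \in s -> X v) ->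
  (forall v, len_lt le_rn ev l (a v)) -> in_J (\sum_(v <- s) a v *: v) ->
  {in s, forall v, in_JA (a v)}.
Proof.
move=> us sX; elim: l a => [|l IH] a la Ja.
  by move=> v _; rewrite (len_lt_at0 (la v)); exact: sum_of0.
have /choice[f fP] : forall v, exists z : K * A * A,
    [/\ a v = cst z.1.1 + t * z.1.2 + z.2, len_lt le_rn ev l z.1.2 & in_JA z.2].
  by move=> v; have [c [a' [j H]]] := len_ltS_split nf_ex (la v); exists (c, a', j).
pose c v := (f v).1.1; pose a' v := (f v).1.2; pose j v := (f v).2.
have aE v : a v = cst (c v) + t * a' v + j v by have [] := fP v.
have sumE : \sum_(v <- s) a v *: v =
    cst_comb c s + t *: (\sum_(v <- s) a' v *: v) + \sum_(v <- s) j v *: v.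
  exact: sum_scale_split aE.
have Jj : in_J (\sum_(v <- s) j v *: v).
  by apply: in_J_sum => v _; apply: in_J_scale; have [] := fP v.
have Jct : in_J (cst_comb c s + t *: (\sum_(v <- s) a' v *: v)).
  by rewrite -[_ + _](addrK (\sum_(v <- s) j v *: v)) -sumE; exact: in_JB.
have c0 : {in s, forall v, c v = 0}.
  apply: X_indep => //.
  rewrite -[cst_comb _ _](addrK (t *: (\sum_(v <- s) a' v *: v))).
  apply: in_lettersD; first exact: in_J_letters.
  apply: in_lettersN; apply: (sum_of_incl (i := ord_max)).
  by exists (\sum_(v <- s) a' v *: v).
have Ja' : {in s, forall v, in_JA (a' v)}.
  apply: IH => [v|]; first by have [] := fP v.
  apply: unshift_Q; move: Jct; rewrite /cst_comb big_seq big1 ?add0r // => v vs.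
  by rewrite c0 // cst0 scale0r.
move=> v vs; rewrite aE c0 // cst0 add0r.
apply: (in_blocksD (N := A^o)); last by have [] := fP v.
by apply: (in_JA_shift ev_rel); exact: Ja'.
Qed.

(* By [X_in_JA] the coefficients of a relation are sums [sum_y y b_y] over blocks;
   since blocks are independent, the [b_y] are shorter relations. *)
Lemma X_free l s (a : Q -> A) : uniq s -> (forall v, v \in s -> X v) ->
  (forall v, len_lt le_rn ev l (a v)) -> \sum_(v <- s) a v *: v = 0 ->
  {in s, forall v, a v = 0}.
Proof.
move=> us sX; elim: l a => [|l IH] a la E0.
  by move=> v _; exact: len_lt_at0 (la v).
have Ja : {in s, forall v, in_JA (a v)}.
  by apply: (X_in_JA us sX la); rewrite E0; exact: in_J0.
have /choice[f fP] : forall v, exists z : seq (word n.+1) * (word n.+1 -> A), v \in s ->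
    [/\ all block z.1, forall y, len_lt le_rn ev l (z.2 y) &
        forall d : seq (word n.+1), uniq d -> {subset z.1 <= d} ->
          a v = \sum_(y <- d) W y * z.2 y].
  move=> v; have [vs|vs] := boolP (v \in s); last by exists ([::], fun=> 0).
  have lD (u w : A^o) : len_lt le_rn ev l u -> len_lt le_rn ev l w -> len_lt le_rn ev l (u + w).
    exact: len_ltD.
  have [z [u [uz bz lu Ez]]] := in_blocksP (len_lt0 le_rn ev l) lD
    (len_ltS_blocks nf_ex nf_inj (la v) (Ja v vs)).
  by exists (z, u).
pose d := undup (flatten [seq (f v).1 | v <- s]).
have fd v : v \in s -> {subset (f v).1 <= d}.
  move=> vs y yf; rewrite mem_undup; apply/flattenP.
  by exists (f v).1 => //; exact: map_f.
have bd : all block d.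
  apply/allP => y; rewrite mem_undup => /flattenP[z /mapP[v vs ->] yz].
  by have [/allP + _ _] := fP v vs; apply.
have aE v : v \in s -> a v = \sum_(y <- d) W y * (f v).2 y.
  by move=> vs; have [_ _] := fP v vs; apply; [exact: undup_uniq | exact: fd].
have E1 : \sum_(y <- d) W y *: (\sum_(v <- s) (f v).2 y *: v) = 0.
  rewrite -[RHS]E0; under eq_bigr => y _ do rewrite scaler_sumr.
  rewrite exchange_big big_seq [RHS]big_seq; apply: eq_bigr => v vs.
  by rewrite aE // scaler_suml; apply: eq_bigr => y _; rewrite scalerA.
have E2 := free_Q (undup_uniq _) bd E1.
move=> v vs; rewrite aE // big_seq big1 // => y yd.
have -> : (f v).2 y = (if v \in s then (f v).2 y else 0) by rewrite vs.
rewrite (IH (fun v => if v \in s then (f v).2 y else 0)) ?mulr0 // => [w|].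
  by case: ifP => [ws|_]; [have [_ + _] := fP w ws; apply | exact: len_lt0].
by rewrite -[RHS](E2 y yd) big_seq [RHS]big_seq; apply: eq_bigr => w ->.
Qed.

Definition X_index := {v : Q | `[< X v >]}.
HB.instance Definition _ := Choice.on X_index.

Lemma X_indexP (i : X_index) : X (val i).
Proof. exact/asboolP/(valP i). Qed.

Lemma X_basis : is_basis (fun i : X_index => val i).
Proof.
have ex v : exists c, v = lincomb (fun i : X_index => val i) c.
  elim: (X_generates v) => [|w v1 v2 [Xw [a ->]] _ [c ->]].
    by exists 0; rewrite raddf0.
  have iw : `[< X w >] by exact/asboolP.
  exists (<< a *g (Sub w iw : X_index) >> + c); rewrite raddfD /=; congr (_ + _).
  by rewrite lincombU SubK.
move=> v; have [c vE] := ex v; exists c; split=> // c' vE'.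
apply/eqP; rewrite -subr_eq0; apply/eqP/malgP => i; rewrite mcoeff0.
set e := c - c'.
have e0 : lincomb (fun i : X_index => val i) e = 0.
  by rewrite raddfB /= -vE [X in _ - X](_ : _ = v) ?subrr // vE'.
case: msuppP => // ie.
(* [X_free] takes coefficients on all of [Q], so [e] is extended by 0; its finite support provides a
   common length bound. *)
pose a (v : Q) := if insub v is Some j then e@_(j : X_index) else 0.
have aE (j : X_index) : a (val j) = e@_j by rewrite /a valK.
have [l lP] : exists l, forall v, len_lt le_rn ev l (a v).
  have [h hP] := choice (fun j : X_index => len_lt_ex nf_ex e@_j).
  exists (\max_(j <- msupp e) h j)%N => w; rewrite /a; case: insub => [j|]; last exact: len_lt0.
  case: msuppP => je; last exact: len_lt0.
  by apply: len_ltW (hP j); rewrite (big_fsetD1 j je) /= leq_maxl.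
have := @X_free l [seq val j | j <- msupp e] a _ _ lP _ (val i).
rewrite aE; apply; last exact: map_f.
- by rewrite map_inj_uniq ?fset_uniq //; exact: val_inj.
- by move=> w /mapP[j _ ->]; exact: X_indexP.
by rewrite big_map -[RHS]e0; apply: eq_bigr => j _; rewrite aE.
Qed.
End Generators.
End GradedConcaModules.

(** * Resolutions of length two *)

Lemma row_dependent (K : fieldType) (k p : nat) (M : 'M[K]_(k, p)) : (p < k)%N ->
  exists c : 'I_k -> K, (exists i, c i != 0) /\ forall j, \sum_i c i * M i j = 0.
Proof.
move=> lt_pk; have : kermx M != 0.
  by rewrite kermx_eq0 -row_leq_rank -ltnNge (leq_ltn_trans (rank_leq_col M)).
case/rowV0Pn => u /sub_kermxP uM u0; exists (fun i => u 0 i); split.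
  by case/rV0Pn: u0 => i ui; exists i.
by move=> j; have := congr1 (fun N : 'M_(1, p) => N 0 j) uM; rewrite !mxE.
Qed.

Lemma bounded_uniq_max (T : eqType) (X : T -> Prop) p :
    (forall s : seq T, uniq s -> (forall v, v \in s -> X v) -> (size s <= p)%N) ->
  exists s : seq T, (forall v, v \in s -> X v) /\ forall v, X v -> v \in s.
Proof.
move=> bound; apply: contrapT => nex.
have H k : exists s, [/\ uniq s, forall v, v \in s -> X v & size s = k].
  elim: k => [|k [s [us sX sk]]]; first by exists [::].
  have [v [Xv vs]] : exists v, X v /\ v \notin s.
    apply: contrapT => nv; apply: nex; exists s; split=> // v Xv.
    by apply: contraT => vs; case: nv; exists v.
  exists (v :: s); split; rewrite /= ?vs ?sk // => w.
  by rewrite inE => /predU1P[->|/sX].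
have [s [us sX sp]] := H p.+1.
by have := bound s us sX; rewrite sp ltnn.
Qed.

Section Resolutions.
Variables (K : fieldType) (n r : nat) (le_rn : (r <= n)%N) (A : pzRingType).
Local Notation F := (freealg K n.+1).
Local Notation red := (reduced_word le_rn).
Variable ev : {rmorphism F -> A}.
Hypothesis nf_ex : forall a, exists2 q, supp_in red q & ev q = a.
Hypothesis nf_inj : forall q, supp_in red q -> ev q = 0 -> q = 0.
Local Notation W := (ev_word ev).
Local Notation cst := (ev_cst ev).
Local Notation t := (W [:: ord_max]).
Hypothesis ev_rel : forall h : 'I_r, exists b : 'I_n.+1 -> A,
  t * W [:: Defs.sub_ord le_rn h] = \sum_(i < n.+1 | (i < n)%N) W [:: i] * b i.
Local Notation in_JA := (in_JA r ev).
Variable Adeg : nat -> A -> Prop.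
Hypothesis AdegE : forall d a, Adeg d a <->
  exists2 q, supp_in (fun w => red w && (size w == d)) q & ev q = a.
Hypothesis AdegM : forall i j a b, Adeg i a -> Adeg j b -> Adeg (i + j) (a * b).
Local Notation gmod := (gmodule Adeg).
Local Notation Az := (Adegz le_rn ev).
Local Notation pow d := (nseq d ord_max : word n.+1).

(** Modulo J only a multiple of one power of t is left in each degree. For negative [z] the element
    is 0, so the absolute value is harmless. *)
Lemma Adegz_power z a : Az z a -> exists c, in_JA (a - cst c * W (pow `|z|%N)).
Proof.
move=> [q qz <-]; exists q@_(pow `|z|%N); rewrite -ev_wordU -raddfB.
apply/(in_JA_nf nf_ex); eexists; last by [].
move=> w; rewrite mcoeffB mcoeffU; have [wE|wE] := eqVneq (pow `|z|%N) w.
  by rewrite -wE mulr1n subrr eqxx.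
rewrite mulr0n subr0 => /qz /andP[-> /eqP wz] /=.
by apply: contra_neqN wE => /powerE ->; rewrite -wz.
Qed.

(** Every homogeneous component of Q / J Q has dimension at most [p] over [K]. *)
Definition finite_rank (p : nat) (Q : gmod) := forall d k (v : 'I_k -> Q),
  (p < k)%N -> (forall i, gm_deg d (v i)) ->
  exists c : 'I_k -> K, (exists i, c i != 0) /\ in_J r ev (\sum_i cst (c i) *: v i).

Section Basis.
Variables (M : gmod) (I : choiceType) (b : I -> M) (dg : I -> int).
Hypothesis b_deg : forall i, gm_deg (dg i) (b i).
Variable co : {linear M -> free_mod A I}.
Hypothesis coK : forall v, lincomb b (co v) = v.
Hypothesis coE : forall c, co (lincomb b c) = c.

(** Truncating each coordinate of [v] to its expected degree gives the coordinates of the part of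
    degree [d], which is [v] itself. *)
Lemma coord_deg d v i : gm_deg d v -> Az (d - dg i) (co v)@_i.
Proof.
move=> dv; have [p [pB pP pE p0 _]] := grading_proj (gm_grading M).
have [q [qB qP qE q0 _]] := grading_proj (Adegz_grading nf_ex nf_inj).
have p00 e : p e 0 = 0 by have := pB e 0 0; rewrite !subrr.
have q00 e : q e 0 = 0 by have := qB e 0 0; rewrite !subrr.
have pD e u w : p e (u + w) = p e u + p e w.
  by rewrite -[w in LHS]opprK pB -[- w]sub0r pB p00 sub0r opprK.
have qD e u w : q e (u + w) = q e u + q e w.
  by rewrite -[w in LHS]opprK qB -[- w]sub0r qB q00 sub0r opprK.
have pq a j : p d (a *: b j) = q (d - dg j) a *: b j.
  have [_ Asum _] := Adegz_grading nf_ex nf_inj.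
  elim: (Asum a) => [|z a1 a2 za1 _ IH]; first by rewrite q00 !scale0r p00.
  rewrite scalerDl pD qD scalerDl IH; congr (_ + _).
  have zj : gm_deg (z + dg j) (a1 *: b j) by apply: (Adegz_scale AdegE).
  have [zd|zd] := eqVneq (z + dg j) d.
    by rewrite -zd addrK in zj *; rewrite pE // qE.
  rewrite (p0 _ _ _ zj) // (q0 _ _ _ za1) ?scale0r //.
  by apply: contra_neq zd => ->; rewrite subrK.
pose c : free_mod A I := [malg j in msupp (co v) => q (d - dg j) (co v)@_j].
have cE j : c@_j = q (d - dg j) (co v)@_j.
  by rewrite mcoeffE; case: msuppP => // _; rewrite q00.
suff -> : co v = c by rewrite cE.
rewrite -[LHS]/(co v) -[in LHS](pE d v dv) -[in LHS](coK v) /lincomb.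
have -> : p d (\sum_(j <- msupp (co v)) (co v)@_j *: b j) =
    \sum_(j <- msupp (co v)) c@_j *: b j.
  rewrite (big_morph (p d) (pD d) (p00 d)); apply: eq_bigr => j _.
  by rewrite pq cE.
rewrite -[RHS](coE c) (@lincombEw _ _ _ b (msupp (co v))) //.
apply/fsubsetP => j; rewrite -!mcoeff_neq0 cE.
by apply: contraNneq => ->; rewrite q00.
Qed.

Variable D : seq I.
Hypothesis DP : forall v i, (co v)@_i != 0 -> i \in D.

(** Modulo J each basis element contributes one power of t in a given degree, so more than [size D]
    elements of that degree are dependent. *)
Lemma basis_finite_rank : finite_rank (size D) M.
Proof.
move=> d k v lt_Dk dv.
have /choice[l lP] : forall ij : 'I_k * I, exists c,
    in_JA ((co (v ij.1))@_ij.2 - cst c * W (pow `|d - dg ij.2|%N)).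
  by move=> [i j] /=; apply: Adegz_power; apply: coord_deg.
have [c [cn0 c0]] := row_dependent (\matrix_(i < k, j < size D) l (i, tnth (in_tuple D) j)) lt_Dk.
exists c; split=> //; rewrite -[X in in_J _ _ X]coK.
apply: in_J_sum => j _; apply: in_J_scale.
have [jD|jD] := boolP (j \in D); last first.
  rewrite (_ : _@_j = 0); first exact: sum_of0.
  by apply/eqP; apply: contraNT jD => /DP.
have [m mE] : exists m : 'I_(size D), tnth (in_tuple D) m = j.
  by have /tnthP[m ->] : j \in in_tuple D by []; exists m.
have -> : (co (\sum_i cst (c i) *: v i))@_j =
    \sum_i ((co (v i))@_j - cst (l (i, j)) * W (pow `|d - dg j|%N)) * cst (c i).
  transitivity (\sum_i (co (v i))@_j * cst (c i) -
      cst (\sum_i c i * l (i, j)) * W (pow `|d - dg j|%N)).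
    have -> : \sum_i c i * l (i, j) = 0.
      by have := c0 m; under eq_bigr => i _ do rewrite mxE mE.
    rewrite cst0 mul0r subr0 linear_sum raddf_sum; apply: eq_bigr => i _.
    by rewrite linearZ /= free_coefZ (cst_comm nf_ex).
  rewrite (big_morph cst (@cstD _ _ _ ev) (cst0 ev)) mulr_suml -sumrB.
  apply: eq_bigr => i _; rewrite mulrBl; congr (_ - _).
  by rewrite cstM -mulrA (cst_comm nf_ex).
elim/big_rec: _ => [|i a _ IH]; first exact: sum_of0.
apply: (in_blocksD (N := A^o)) => //; apply: in_JA_mulr.
exact: (lP (i, j)).
Qed.
End Basis.

(** By [ker_in_J], a combination of elements of Z that lies in J M lies in J Z. *)
Lemma ker_finite_rank (M N : gmod) (f : {linear M -> N}) (f_deg : deg0_hom f) p :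
  blocks_free r ev N -> finite_rank p M -> finite_rank p (ker_gmod f_deg).
Proof.
move=> free_N fM d k v lt_pk dv.
have [c [cn0 Jc]] := fM d k (fun i => ker_val (v i)) lt_pk dv.
exists c; split=> //; apply: (ker_in_J free_N).
by rewrite ker_val_sum; congr (in_J _ _ _): Jc.
Qed.

Section Generators.
Variable Q : gmod.
Hypothesis free_Q : blocks_free r ev Q.
Hypothesis unshift_Q : forall v : Q, in_J r ev (t *: v) -> in_J r ev v.
Hypothesis Q_bd : bounded_below Q.

Lemma Q_graded_free : graded_free Q.
Proof.
have [X [X1 X2 X3]] := minimal_generators nf_ex Q.
exists (X_index X), (fun i => val i); split=> [i|]; first exact: X1 (X_indexP i).
exact: (X_basis nf_ex nf_inj ev_rel AdegE free_Q unshift_Q Q_bd X1 X2 X3).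
Qed.

(* Multiplying generators of degree at most [m] by powers of [t] brings them all to
   degree [m] without creating relations modulo [J]. *)
Lemma Q_finitely_generated p : finite_rank p Q -> finitely_generated Q.
Proof.
move=> fQ; have [X [X1 X2 X3]] := minimal_generators nf_ex Q.
have [|s [sX Xs]] := @bounded_uniq_max Q X p.
  move=> s us sX; rewrite leqNgt; apply/negP => lt_ps.
  have /choice[dg dgP] : forall v : Q, exists d, X v -> gm_deg d v.
    move=> v; have [Xv|nX] := pselect (X v); last by exists 0.
    by have [d dv] := X1 v Xv; exists d.
  have [m mP] : exists m : int, forall v, v \in s -> dg v <= m.
    elim: s {us sX lt_ps} => [|v s [m mP]]; first by exists 0.
    exists (`|dg v| + `|m|) => w; rewrite inE => /predU1P[->|/mP]; lia.
  pose e v := pow `|m - dg v|%N.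
  have [i|c [[i ci] Jc]] := fQ m (size s) (fun i => W (e s`_i) *: s`_i) lt_ps.
    move: s`_i (mem_nth 0 (ltn_ord i)) => v vs.
    have := gm_scale (Adeg_word AdegE (power_reduced le_rn `|m - dg v|%N)) (dgP _ (sX _ vs)).
    by rewrite size_nseq; congr gm_deg; have := mP _ vs; lia.
  pose c' v := oapp c 0 (insub (index v s)).
  have c'E (j : 'I_(size s)) : c' s`_j = c j.
    by rewrite /c' index_uniq // valK.
  pose a v := if v \in s then cst (c' v) * W (e v) else 0.
  have [l lP] : exists l, forall v, len_lt le_rn ev l (a v).
    exists (\max_(v <- s) `|m - dg v|.+1)%N => v; rewrite /a; case: ifP => vs; last exact: len_lt0.
    apply: len_ltU; first exact: power_reduced.
    rewrite size_nseq (leq_trans (ltnSn _)) //.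
    by rewrite (big_rem v vs) /= leq_maxl.
  have Ja := X_in_JA nf_ex ev_rel unshift_Q X2 us sX lP.
  have is_ : nth 0 s i \in s by exact: mem_nth.
  (* A scalar multiple of a power of t that lies in J is 0, which contradicts the choice of [i]. *)
  suff /Ja/(_ _ is_) : in_J r ev (\sum_(v <- s) a v *: v).
    rewrite /a is_ c'E => /(in_JA_power nf_ex nf_inj) c0.
    by rewrite c0 eqxx in ci.
  congr (in_J _ _ _): Jc; rewrite (big_nth 0) big_mkord; apply: eq_bigr => j _.
  by rewrite /a mem_nth // c'E scalerA.
exists s => v; elim: (X_generates AdegE Q_bd X1 X3 v) => [|w v1 v2 [Xw [a ->]] _ [c ->]].
  by exists (fun=> 0); rewrite big1 // => i _; rewrite scale0r.
have ws := Xs w Xw; have lt_ws : (index w s < size s)%N by rewrite index_mem.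
exists (fun i => (if i == Ordinal lt_ws then a else 0) + c i).
under [RHS]eq_bigr => i _ do rewrite scalerDl.
rewrite big_split /=; congr (_ + _); rewrite (bigD1 (Ordinal lt_ws)) //= eqxx nth_index //.
by rewrite big1 ?addr0 // => i /negPf ->; rewrite scale0r.
Qed.
End Generators.

Lemma graded_free_blocks (M : gmod) : graded_free M -> blocks_free r ev M.
Proof. by move=> [I [b [_ bb]]]; exact: (basis_blocks_free nf_ex nf_inj bb). Qed.

Lemma graded_free_unshift (M : gmod) : graded_free M ->
  forall v : M, in_J r ev (t *: v) -> in_J r ev v.
Proof. by move=> [I [b [_ bb]]]; exact: (basis_in_J_unshift nf_ex nf_inj ev_rel bb). Qed.

Section Kernel.
Variables (M N : gmod) (f : {linear M -> N}).
Hypothesis f_deg : deg0_hom f.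

Lemma ker_bounded_below : bounded_below M -> bounded_below (ker_gmod f_deg).
Proof. by move=> [d dP]; exists d => e v ed ev_; apply: val_inj; exact: (dP e). Qed.

Lemma ker_graded_free : bounded_below_free M -> graded_free N ->
  bounded_below_free (ker_gmod f_deg).
Proof.
move=> [Mf Mb] Nf; split; last exact: ker_bounded_below.
apply: Q_graded_free; last exact: ker_bounded_below.
  exact: ker_blocks_free (graded_free_blocks Mf).
apply: (ker_in_J_unshift (graded_free_blocks Nf)).
exact: graded_free_unshift.
Qed.

(** The coordinates of finitely many generators involve only the finitely many basis elements in
    [D]. This bounds the degrees of [M] from below and bounds the rank modulo J, which passes to the
    kernel. *)
Lemma ker_finite_free : finite_free M -> finite_free N -> finite_free (ker_gmod f_deg).
Proof.
move=> [Mf [s0 s0P]] [Nf _]; have [I [b [b_deg bb]]] := Mf.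
have [co0 [co_lin coK coE]] := basis_coord bb.
pose co : {linear M -> free_mod A I} := HB.pack co0 (GRing.isLinear.Build _ _ _ _ co0 co_lin).
have [dg dgP] := choice b_deg.
pose D := undup (flatten [seq enum_fset (msupp (co v)) | v <- s0]).
have DP v i : (co v)@_i != 0 -> i \in D.
  have [c ->] := s0P v; rewrite linear_sum raddf_sum /=.
  apply: contra_neqT => iD; rewrite big1 // => k _.
  have -> : (co0 (c k *: s0`_k))@_i = c k * (co s0`_k)@_i.
    by rewrite -free_coefZ; congr (mcoeff i _); exact: (linearZZ co).
  suff -> : (co s0`_k)@_i = 0 by rewrite mulr0.
  apply/eqP; apply: contraNT iD; rewrite mcoeff_neq0 => ik.
  rewrite mem_undup; apply/flattenP; exists (enum_fset (msupp (co s0`_k))) => //.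
  by apply: map_f; exact: mem_nth.
have Mb : bounded_below M.
  have [m mP] : exists m : int, forall i, i \in D -> m <= dg i.
    elim: D {DP} => [|i D [m mP]]; first by exists 0.
    exists (- `|dg i| - `|m|) => j; rewrite inE => /predU1P[->|/mP]; lia.
  exists m => d v dm dv; rewrite -(coK v) (_ : co0 v = 0) ?raddf0 //.
  apply/malgP => i; rewrite mcoeff0; apply/eqP; apply: contraT => nz.
  have /mP im := DP v i nz.
  have := coord_deg (co := co) dgP coK coE i dv; move/Adegz_lt0 => H.
  by move: nz; rewrite [X in X != 0]H ?eqxx //; lia.
have [Kf Kb] := ker_graded_free (conj Mf Mb) Nf; split=> //.
apply: (Q_finitely_generated _ Kb (p := size D)).
  apply: (ker_in_J_unshift (graded_free_blocks Nf)); exact: graded_free_unshift.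
apply: ker_finite_rank; first exact: graded_free_blocks.
exact: (basis_finite_rank (co := co) dgP coK coE DP).
Qed.
End Kernel.

(** Once [F0] covers [M] and [F1] covers the kernel of [d0], the kernel of [d1] is free as the
    kernel of a map between free modules, so the resolution stops there. *)
Lemma resolution_bounded_below (M : gmod) : bounded_below M ->
  has_resolution2 (@bounded_below_free _ Adeg) M.
Proof.
move=> Mb; have [F0 [d0 [F0f d0_deg d0_surj]]] := free_cover nf_ex nf_inj AdegE AdegM Mb.
have Zb : bounded_below (ker_gmod d0_deg) by apply: ker_bounded_below; case: F0f.
have [F1 [e1 [F1f e1_deg e1_surj]]] := free_cover nf_ex nf_inj AdegE AdegM Zb.
pose d1 : {linear F1 -> F0} := ker_incl d0_deg \o e1.
have d1_deg : deg0_hom d1 by move=> d v dv; exact: e1_deg.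
exists (ker_gmod d1_deg), F1, F0, (ker_incl d1_deg), d1, d0; split=> //.
- by split=> //; apply: ker_graded_free => //; case: F0f.
- by split=> //; exact: ker_incl_deg.
- exact: ker_incl_inj.
split; first exact: ker_inclP.
move=> v; split=> [/(ker_inclP d0_deg)[u <-]|[u <-]].
  by have [w <-] := e1_surj u; exists w.
by apply/(ker_inclP d0_deg); exists (e1 u).
Qed.

(** The presentation already supplies [F1] and [F0]; the kernel of [d1] is finite free and completes
    the resolution. *)
Lemma resolution_finite (M : gmod) : finitely_presented M ->
  has_resolution2 (@finite_free _ Adeg) M.
Proof.
move=> [F1 [F0 [d1 [d0 [[F1f F0f] [d1_deg d0_deg] ex d0_surj]]]]].
exists (ker_gmod d1_deg), F1, F0, (ker_incl d1_deg), d1, d0; split=> //.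
- by split=> //; exact: ker_finite_free.
- by split=> //; exact: ker_incl_deg.
- exact: ker_incl_inj.
by split=> //; exact: ker_inclP.
Qed.
End Resolutions.

(** * The Ext algebra satisfies the normal form hypotheses *)

Section ExtModules.
Variables (L : localRing) (G : free_resolution L).
Variables (n r : nat) (le_rn : (r <= n)%N) (x : 'I_n.+1 -> L).
Variable (a : 'I_n.+1 -> 'I_n.+1 -> 'I_r -> residue L).
Hypothesis conca_x : conca_generator (x ord_max) (@maxid L).
Hypothesis basis_x : conca_basis le_rn x.
Hypothesis a_str : structure_constants le_rn x a.
Variable xi : 'I_n.+1 -> Ext G.
Hypothesis xi_eval : forall i j, Ext1_eval (xi i) (x j) (i == j)%:R.
Local Notation red := (reduced_word le_rn).
Local Notation K := (residue L).
Local Notation F := (freealg K n.+1).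

Definition Ext_ev : {rmorphism F -> Ext G} := HB.pack (Ext_eval xi)
  (GRing.isZmodMorphism.Build _ _ (Ext_eval xi) (Ext_evalB xi))
  (GRing.isMonoidMorphism.Build _ _ (Ext_eval xi) (Ext_eval1 xi, Ext_evalM xi)).
Local Notation W := (ev_word Ext_ev).

Lemma Ext_ev_letter i : W [:: i] = xi i.
Proof. exact: Ext_eval_letter. Qed.

Lemma Ext_nf_deg d v : Ext_deg d v <->
  exists2 q, supp_in (fun w => red w && (size w == d)) q & Ext_ev q = v.
Proof.
split=> [|[q qd <-]]; last first.
  by apply: (Ext_eval_deg basis_x xi_eval) => w /qd/andP[_ /eqP].
move=> /(Ext_eval_surj conca_x basis_x xi_eval)[p pd <-].
have [q qP gq] : red_span le_rn a (pred1 d) p.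
  rewrite [p]monalgE big_seq; apply: red_span_sum => w; rewrite -mcoeff_neq0 => /pd wd.
  by rewrite malgU_scale -wd; apply: red_spanZ; exact: red_span_mon.
exists q => //; apply/eqP; rewrite eq_sym -subr_eq0; apply/eqP.
by rewrite -[LHS]Ext_evalB; exact: (Ext_eval_gen conca_x basis_x a_str xi_eval gq).
Qed.

Lemma Ext_nf_ex v : exists2 q, supp_in red q & Ext_ev q = v.
Proof.
elim: (sum_of_Ext_deg v) => [|d v1 v2 /Ext_nf_deg[q1 q1P <-] _ [q2 q2P <-]].
  by exists 0; [exact: supp_in0 | exact: raddf0].
exists (q1 + q2); last exact: (raddfD Ext_ev).
by apply: supp_inD => //; apply: supp_inW q1P => w /andP[].
Qed.

Lemma Ext_nf_inj q : supp_in red q -> Ext_ev q = 0 -> q = 0.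
Proof. exact: (Ext_eval_red_inj conca_x basis_x xi_eval). Qed.

Lemma Ext_degM i j u v : @Ext_deg L G i u -> @Ext_deg L G j v -> Ext_deg (i + j) (u * v).
Proof.
move=> [y cy ->] [y' cy' ->]; exists (y * y'); last by rewrite Ext_classM.
by rewrite cocycle_valM; exact: cocycleM.
Qed.

(* Solving the relation [phi_h] for its term [xi_e xi_h]. *)
Lemma Ext_max_low (h : 'I_r) : exists b : 'I_n.+1 -> Ext G,
  W [:: ord_max] * W [:: Defs.sub_ord le_rn h] = \sum_(i < n.+1 | (i < n)%N) W [:: i] * b i.
Proof.
pose V := sum_of (fun (i : 'I_n.+1) (v : Ext G) => (i < n)%N /\ exists b, v = xi i * b).
have VP v : V v -> exists b : 'I_n.+1 -> Ext G, v = \sum_(i < n.+1 | (i < n)%N) W [:: i] * b i.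
  elim=> [|i v1 v2 [lt_in [b ->]] _ [c ->]].
    by exists (fun=> 0); rewrite big1 // => i _; rewrite mulr0.
  exists (fun j => (if j == i then b else 0) + c j).
  under [RHS]eq_bigr => j _ do rewrite mulrDr.
  rewrite big_split; congr (_ + _); rewrite (bigD1 i) //= eqxx Ext_ev_letter.
  by rewrite big1 ?addr0 // => j /andP[_ /negPf ->]; rewrite mulr0.
have Vxi (i : 'I_n.+1) b : (i < n)%N -> V (xi i * b).
  by move=> lt_in; apply: (sum_of_incl (i := i)); split=> //; exists b.
have Vsum (P : pred 'I_n.+1) (f : 'I_n.+1 -> Ext G) :
    (forall i, P i -> V (f i)) -> V (\sum_(i < n.+1 | P i) f i).
  move=> Vf; elim/big_rec: _ => [|i v Pi Vv]; first exact: sum_of0.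
  by apply: sum_of_add => //; exact: Vf.
have VN v : V v -> V (- v).
  by apply: sum_of_opp => i u [lt_in [b ->]]; split=> //; exists (- b); rewrite mulrN.
rewrite !Ext_ev_letter; apply: VP.
have /= := Ext_relation conca_x basis_x xi_eval h a_str.
set S1 := \sum_(_ < _ | _) _; set S2 := \sum_(_ < _ | _) _ => /eqP.
rewrite addrAC -!addrA addrCA addr_eq0 => /eqP ->; apply: VN.
apply: sum_of_add; first by apply: Vxi; exact: leq_trans (ltn_ord h) le_rn.
apply: sum_of_add.
  by apply: (Vsum) => i lt_in; rewrite Ext_scaleAr; exact: Vxi.
apply: (Vsum) => i lt_in; apply: Vsum => j /andP[_ lt_jn].
by rewrite scalerDr !Ext_scaleAr; apply: sum_of_add; exact: Vxi.
Qed.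

Lemma Ext_resolution_bounded_below (M : gmodule (@Ext_deg L G)) : bounded_below M ->
  has_resolution2 (@bounded_below_free _ (@Ext_deg L G)) M.
Proof.
exact: (resolution_bounded_below Ext_nf_ex Ext_nf_inj Ext_max_low Ext_nf_deg Ext_degM).
Qed.

Lemma Ext_resolution_finite (M : gmodule (@Ext_deg L G)) : finitely_presented M ->
  has_resolution2 (@finite_free _ (@Ext_deg L G)) M.
Proof.
exact: (resolution_finite Ext_nf_ex Ext_nf_inj Ext_max_low Ext_nf_deg).
Qed.
End ExtModules.

Theorem theorem2p2 (L : localRing) (G : free_resolution L) (n r : nat)
    (le_rn : (r <= n)%N) (x : 'I_n.+1 -> L)
    (a : 'I_n.+1 -> 'I_n.+1 -> 'I_r -> residue L) (xi : 'I_n.+1 -> Ext G) :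
  conca_generator (x ord_max) (@maxid L) ->
  quot_krank (@maxid L) (@maxid2 L) n.+1 ->
  quot_krank (@maxid2 L) (eq^~ 0) r ->
  conca_basis le_rn x ->
  structure_constants le_rn x a ->
  (forall i j, Ext1_eval (xi i) (x j) (i == j)%:R) ->
  [/\ exists f : {rmorphism presented (conca_rel le_rn a) -> Ext G},
        [/\ bijective f, scalable f,
            forall d p, presented_deg d p <-> Ext_deg d (f p) &
            forall i, f (presented_class (conca_rel le_rn a) (letter _ i)) = xi i],
      is_basis (fun w : {w : word n.+1 | reduced_word le_rn w} =>
        \prod_(i <- val w) xi i),
      forall M : gmodule (@Ext_deg L G), bounded_below M ->
        has_resolution2 (@bounded_below_free _ (@Ext_deg L G)) M &
      forall M : gmodule (@Ext_deg L G), finitely_presented M ->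
        has_resolution2 (@finite_free _ (@Ext_deg L G)) M].
Proof.
move=> conca_x _ _ basis_x a_str xi_eval; split.
- exact: (presented_Ext_iso conca_x basis_x a_str xi_eval).
- exact: (Ext_word_basis conca_x basis_x xi_eval).
- move=> M; exact: (Ext_resolution_bounded_below conca_x basis_x a_str xi_eval).
- move=> M; exact: (Ext_resolution_finite conca_x basis_x a_str xi_eval).
Qed.
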